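(* Let $M \subset \mathbb{R}^3$ be a smooth convex closed surface such that the origin $0$ lies in the interior of the body bounded by $M$, and let $r_0 \colon \mathbb{S}^2 \to \mathbb{R}_+$ be its distance function. Then $M$ is infinitesimally rigid if and only if every curvature preserving infinitesimal deformation $s \colon \mathbb{S}^2 \to \mathbb{R}$ of $r_0$ is trivial.
   Context: Infinitesimal rigidity: an infinitesimal deformation of $M$ is a smooth map $\xi \colon M \to \mathbb{R}^3$; it is isometric if the metrics $g_t$ induced on $M$ by the maps $x \mapsto x + t\xi(x)$ satisfy $\frac{d}{dt}\big|_{t=0} g_t = 0$; it is trivial if $\xi(x) = a\times x + b$ for some $a,b\in\mathbb{R}^3$. $M$ is infinitesimally rigid if every isometric infinitesimal deformation of $M$ is trivial. Distance function: let $\phi_0 \colon \mathbb{S}^2 \to M$ be the inverse of the radial projection $M \to \mathbb{S}^2$, $y \mapsto y/\|y\|$. The distance function of $M$ is $r_0(x) = \|\phi_0(x)\|$, so $\phi_0(x) = r_0(x)\,x$. Let $g$ be the Riemannian metric on $\mathbb{S}^2$ induced by $\phi_0$ from $\mathbb{R}^3$; then $\|\nabla r_0\|_g<1$. Warped product metrics: for a smooth function $r \colon \mathbb{S}^2 \to \mathbb{R}_+ = (0,\infty)$ with $\|\nabla r\|_g < 1$ everywhere, let $\widetilde g_r = d\rho^2 + \left(\frac{\rho}{r}\right)^2 (g - dr\otimes dr)$, a Riemannian metric on $\mathbb{R}_+\times\mathbb{S}^2$ ($\rho$ is the coordinate on $\mathbb{R}_+$). Deformations of $r_0$: for a smooth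 function $s \colon \mathbb{S}^2\to\mathbb{R}$ put $r_t = r_0 + ts$ ($t$ small) and let $\widetilde R_t$ be the curvature tensor of $\widetilde g_{r_t}$. The function $s$ is called a curvature preserving infinitesimal deformation of $r_0$ if $\lim_{t\to0}\frac{\widetilde R_t - \widetilde R_0}{t} = 0$. It is called a trivial infinitesimal deformation of $r_0$ if there is $a \in \mathbb{R}^3$ with $s(x) = \left\langle a, \frac{\phi_0(x)}{\|\phi_0(x)\|}\right\rangle$ for all $x \in \mathbb{S}^2$. *)

(* Defs.v *)
From HB Require Import structures.
From mathcomp Require Import all_boot all_order all_algebra.
From mathcomp Require Import all_classical all_reals all_analysis.

Set Implicit Arguments.
Unset Strict Implicit.
Unset Printing Implicit Defensive.

Import Order.TTheory GRing.Theory Num.Theory.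
Import numFieldNormedType.Exports.

Local Open Scope classical_set_scope.
Local Open Scope ring_scope.

(* The library norm on 'rV[R]_3 is the sup norm; the Euclidean structure of R^3
   is introduced here.  The two norms define the same topology. *)
Section Euclidean.
Context {R : realType}.
Implicit Types u v x y : 'rV[R]_3.

Definition dot u v : R := \sum_(i < 3) u 0 i * v 0 i.

Definition enorm u : R := Num.sqrt (dot u u).

(* Indices of 'I_3 are added modulo 3. *)
Definition cross u v : 'rV[R]_3 :=
  \row_(i < 3) (u 0 (i + 1) * v 0 (i + 2%:R) - u 0 (i + 2%:R) * v 0 (i + 1)).

Definition sphere : set 'rV[R]_3 := [set x | enorm x = 1].

Definition radial_proj y : 'rV[R]_3 := (enorm y)^-1 *: y.

End Euclidean.

Section Smoothness.
Context {R : realType} {E V : normedModType R}.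

Fixpoint iter_derive (vs : seq E) (f : E -> V) : E -> V :=
  if vs is v :: vs' then fun x => 'D_v (iter_derive vs' f) x else f.

(* C^oo on an open set: all iterated directional derivatives exist and are
   continuous (meant for finite-dimensional E). *)
Definition smooth_on_open (U : set E) (f : E -> V) : Prop :=
  forall (vs : seq E) (x : E), U x ->
    {for x, continuous (iter_derive vs f)} /\
    forall v : E, derivable (iter_derive vs f) x v.

(* Smoothness of the restriction of f to an arbitrary subset A: only the values
   of f on A matter. *)
Definition smooth_on (A : set E) (f : E -> V) : Prop :=
  forall p, A p -> exists (U : set E) (F : E -> V),
    [/\ open U, U p, smooth_on_open U F & {in A `&` U, F =1 f}].

End Smoothness.

Section Surfaces.
Context {R : realType}.
Implicit Types (M K : set 'rV[R]_3) (xi : 'rV[R]_3 -> 'rV[R]_3).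

(* Embedded surface without boundary, given locally as a regular level set. *)
Definition smooth_surface M : Prop :=
  forall p, M p -> exists (U : set 'rV[R]_3) (F : 'rV[R]_3 -> R),
    [/\ open U, U p, smooth_on_open U F,
        M `&` U = [set x | U x /\ F x = 0] &
        forall x, U x -> M x -> exists v, 'D_v F x != 0].

(* M is a smooth convex closed surface and K is the body bounded by M. *)
Definition smooth_convex_closed_surface M K : Prop :=
  [/\ compact K, convex_set K, K° !=set0, M = closure K `\` K°
    & smooth_surface M].

Definition smooth_curve_in M (c : R -> 'rV[R]_3) : Prop :=
  smooth_on_open setT c /\ forall u, M (c u).

(* The metric induced on M by f : M -> R^3, evaluated at the tangent vectors
   c1'(0) and c2'(0) of two curves in M with c1 0 = c2 0. *)
Definition induced_metric (f : 'rV[R]_3 -> 'rV[R]_3) (c1 c2 : R -> 'rV[R]_3)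
    : R :=
  dot (derive1 (f \o c1) 0) (derive1 (f \o c2) 0).

Definition isometric_deformation M xi : Prop :=
  forall c1 c2 : R -> 'rV[R]_3,
    smooth_curve_in M c1 -> smooth_curve_in M c2 -> c1 0 = c2 0 ->
    is_derive (0 : R) (1 : R)
      (fun t : R => induced_metric (fun x => x + t *: xi x) c1 c2) (0 : R).

Definition trivial_deformation M xi : Prop :=
  exists a b : 'rV[R]_3, forall x, M x -> xi x = cross a x + b.

Definition infinitesimally_rigid M : Prop :=
  forall xi, smooth_on M xi ->
    isometric_deformation M xi -> trivial_deformation M xi.

(* Inverse of the radial projection M -> S^2, and the distance function; only
   the values on the sphere are relevant. *)
Definition phi0 M : 'rV[R]_3 -> 'rV[R]_3 := 'pinv_(fun=> 0) M radial_proj.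

Definition dist_fun M (x : 'rV[R]_3) : R := enorm (phi0 M x).

End Surfaces.

Section Curvature.
Context {R : realType}.
Implicit Types (y v w : 'rV[R]_3) (i j k l m : 'I_3).

Definition pd i (h : 'rV[R]_3 -> R) y : R := 'D_(delta_mx 0 i) h y.

(* A Riemannian metric on an open subset of R^3 is given by its Gram matrix G in
   the standard coordinates. *)
Definition christoffel (G : 'rV[R]_3 -> 'M[R]_3) k i j y : R :=
  2%:R^-1 * \sum_l invmx (G y) k l *
    (pd i (fun z => G z j l) y + pd j (fun z => G z i l) y
     - pd l (fun z => G z i j) y).

(* Component l of Rm(d_i, d_j) d_k, where
   Rm(X, Y) Z = D_X D_Y Z - D_Y D_X Z - D_[X, Y] Z. *)
Definition riemann (G : 'rV[R]_3 -> 'M[R]_3) l k i j y : R :=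
  pd i (christoffel G l j k) y - pd j (christoffel G l i k) y
  + \sum_m (christoffel G l i m y * christoffel G m j k y
            - christoffel G l j m y * christoffel G m i k y).

(* The metric d rho^2 + (rho / r)^2 (g - dr (x) dr) on R_+ x S^2, transported to
   R^3 \ {0} by the diffeomorphism (rho, x) |-> rho x, whose inverse is
   y |-> (|y|, y / |y|); r is a function on the sphere and g is the metric
   induced by phi : S^2 -> R^3.  It is evaluated at the point y != 0 on the
   vectors v and w. *)
Definition warped_metric (phi : 'rV[R]_3 -> 'rV[R]_3) (r : 'rV[R]_3 -> R)
    y v w : R :=
  'D_v enorm y * 'D_w enorm y
  + (enorm y / r (radial_proj y)) ^+ 2
    * (dot ('D_v (phi \o radial_proj) y) ('D_w (phi \o radial_proj) y)
       - 'D_v (r \o radial_proj) y * 'D_w (r \o radial_proj) y).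

Definition warped_gram (phi : 'rV[R]_3 -> 'rV[R]_3) (r : 'rV[R]_3 -> R) y
    : 'M[R]_3 :=
  \matrix_(i, j) warped_metric phi r y (delta_mx 0 i) (delta_mx 0 j).

(* Curvature tensor of the warped metric of r_t = r_0 + t s. *)
Definition warped_curvature (M : set 'rV[R]_3) (s : 'rV[R]_3 -> R) (t : R)
    l k i j y : R :=
  riemann (warped_gram (phi0 M) (fun x => dist_fun M x + t * s x)) l k i j y.

Definition curvature_preserving (M : set 'rV[R]_3) (s : 'rV[R]_3 -> R) : Prop :=
  forall y, y != 0 -> forall l k i j,
    (warped_curvature M s t l k i j y - warped_curvature M s 0 l k i j y) / t
      @[t --> (0 : R)^'] --> (0 : R).

Definition trivial_dist_deformation (M : set 'rV[R]_3) (s : 'rV[R]_3 -> R)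
    : Prop :=
  exists a : 'rV[R]_3, forall x, sphere x ->
    s x = dot a ((enorm (phi0 M x))^-1 *: phi0 M x).

End Curvature.

(* Main.v *)
(* Extend the distance function r and the deformation s to R^3 \ {0} as functions
   homogeneous of degree 0, and let om = y / |y|.  In polar coordinates the warped
   metric of r is the Euclidean metric, so the first variation of its curvature
   is the linearization, at the flat metric, of the curvature along the first
   variation h of the metric.  Hence s is curvature preserving if and only if h
   satisfies the Saint-Venant compatibility equations, which on the simply
   connected space R^3 \ {0} means that h is the symmetrized derivative of a
   field eta.

   If s is curvature preserving, eta can be chosen tangent to the spheres about 0,
   and xi = eta + s om restricts to an isometric infinitesimal deformation of M with
   <xi, om> = s; if xi(p) = a x p + b then s = <b, om>.
   Conversely an isometric infinitesimal deformation xi of M gives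
   s = <xi, om>, and (|y| / r) (xi - s om) has symmetrized derivative h, so s
   is curvature preserving.  If moreover s = <a, om>, the same construction applied
   to xi - a has s = 0, and produces a Killing field homogeneous of degree 1, that
   is a linear antisymmetric one, which equals xi - a on M. *)
Require Import Defs.
From HB Require Import structures.
From mathcomp Require Import all_boot all_order all_algebra.
From mathcomp Require Import all_classical all_reals all_analysis.
From mathcomp Require Import ring lra.
Set Implicit Arguments.
Unset Strict Implicit.
Unset Printing Implicit Defensive.
Import Order.TTheory GRing.Theory Num.Theory.
Import numFieldNormedType.Exports.
Local Open Scope classical_set_scope.
Local Open Scope ring_scope.

(** * Directional derivatives and smooth functions *)

Section LineDerivative.
Context {R : realType} {E : normedModType R}.
Implicit Types (f g : E -> R) (x v w : E).

(** Smoothness means existence and continuity of iterated directional derivatives, so first-order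
    expansions are obtained from continuous partial derivatives, through slope functions continuous
    at the base point. The surface is given only by local level sets, hence smoothness of the
    distance function has to be proved. Convexity makes every ray from 0 transversal to M; implicit
    differentiation along the rays does the rest. The compatibility equations hide two integrations,
    of a rotation and of a field. Only the rotation w is integrated: homogeneity of h and its
    vanishing on radial vectors give eta algebraically from w, and antisymmetry of w makes eta
    tangent to the spheres. Simple connectedness enters as one gluing of two primitives over a
    connected overlap. The passage between M and space rests on N = (xi - s om) / r. As N is
    orthogonal to om, the derivatives of r multiplying N cancel from the symmetrized product of dxi
    and d(r om); the isometry equation thus determines the symmetrized product of dN and d om, which
    knows nothing of the scale. Multiplying N by |y| instead of r then gives a field in space with
    symmetrized derivative h. *)

Lemma derive_on_line (V : normedModType R) (f : E -> V) x v (u : R) :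
  'D_1 (fun u' : R => f (u' *: v + x)) u = 'D_v f (u *: v + x).
Proof.
rewrite /derive; set g1 := fun h => _ *: _; set g2 := fun h => _ *: _.
suff -> : g1 = g2 by [].
by apply/funext => h; rewrite /g1 /g2 /= [h%:A]mulr1 scalerDl addrA.
Qed.

Lemma derivable_on_line f x v (u : R) :
  derivable f (u *: v + x) v <->
  derivable (fun u' : R => f (u' *: v + x)) u 1.
Proof.
rewrite /derivable.
set g1 := fun h => h^-1 *: _; set g2 := fun h => h^-1 *: _.
suff -> : g1 = g2 by [].
by apply/funext => h; rewrite /g1 /g2 /= [h%:A]mulr1 scalerDl addrA.
Qed.

Lemma mean_value f x v (a : R) :
  (forall c, `|c| <= `|a| -> derivable f (c *: v + x) v) ->
  exists2 c, `|c| <= `|a| & f (a *: v + x) - f x = a * 'D_v f (c *: v + x).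
Proof.
move=> df; pose g u : R := f (u *: v + x).
have dg c : `|c| <= `|a| -> is_derive c (1 : R) g ('D_v f (c *: v + x)).
  by move=> /df /derivable_on_line gc; split=> //; rewrite /g derive_on_line.
have cg (i : interval R) : (forall c, c \in i -> `|c| <= `|a|) ->
    {within [set` i], continuous g}.
  move=> ia; apply: derivable_within_continuous => c /ia /dg ?.
  exact: ex_derive.
have [a0|a0] := leP 0 a.
  have ia c : c \in `[0, a] -> `|c| <= `|a|.
    by rewrite in_itv /= => /andP[? ?]; rewrite !ger0_norm.
  have [c|c|c cI] := @MVT_segment _ g (fun c => 'D_v f (c *: v + x)) 0 a a0.
  - by move=> /subset_itv_oo_cc /ia /dg.
  - by apply: cg => ? /ia.
  rewrite subr0 mulrC /g scale0r add0r => ?.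
  by exists c => //; exact: ia.
have ia c : c \in `[a, 0] -> `|c| <= `|a|.
  rewrite in_itv /= => /andP[? ?]; rewrite !ler0_norm ?lerN2 //; exact: ltW.
have [c|c|c cI] := @MVT_segment _ g (fun c => 'D_v f (c *: v + x)) a 0 (ltW a0).
- by move=> /subset_itv_oo_cc /ia /dg.
- by apply: cg => ? /ia.
rewrite sub0r mulrN mulrC /g scale0r add0r => /(congr1 -%R).
rewrite opprB opprK => ?.
by exists c => //; exact: ia.
Qed.

Lemma cvg_line x v (u : R) : (h *: v + x) @[h --> u] --> u *: v + x.
Proof.
apply: cvgD; last exact: cvg_cst.
by apply: cvgZr_tmp; exact: cvg_id.
Qed.

Lemma derive_zero_segment (U : set E) f x y :
  (forall z v, U z -> derivable f z v /\ 'D_v f z = 0) ->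
  (forall c, 0 <= c <= 1 -> U (c *: (y - x) + x)) -> f y = f x.
Proof.
move=> f0 Uxy.
pose g u : R := f (u *: (y - x) + x).
have dg c : c \in `[(0 : R), 1] -> is_derive c (1 : R) g 0.
  rewrite in_itv /= => /Uxy Uz; have [d d0] := f0 _ (y - x) Uz.
  by split; [exact/derivable_on_line|rewrite /g derive_on_line].
have dg' c : c \in `](0 : R), 1[ -> is_derive c (1 : R) g 0.
  by move=> /subset_itv_oo_cc /dg.
have cg : {within `[(0 : R), 1], continuous g}.
  apply: derivable_within_continuous => z /dg ?; exact: ex_derive.
have [c _] := MVT_segment ler01 dg' cg.
rewrite mul0r /g scale1r scale0r add0r subrK => /eqP.
by rewrite subr_eq0 => /eqP.
Qed.

End LineDerivative.

Section EpsilonDelta.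
Context {R : realType} {E V : normedModType R}.
Implicit Types (f : E -> V) (p : E).

Lemma near_dist p (P : set E) :
  (\forall z \near p, P z) <-> exists2 d, 0 < d & forall z, `|z - p| < d -> P z.
Proof.
split=> [/nbhs_ballP[d /= d0 dP]|[d d0 dP]].
  by exists d => // z zd; apply: dP; rewrite -ball_normE /= distrC.
apply/nbhs_ballP; exists d => // z.
by rewrite -ball_normE /= distrC; exact: dP.
Qed.

Lemma continuous_dist f p : {for p, continuous f} <->
  forall eps, 0 < eps -> exists2 d, 0 < d &
    forall z, `|z - p| < d -> `|f z - f p| < eps.
Proof.
split=> [cf eps eps0|cf].
  apply/near_dist; have /cvgrPdist_lt/(_ _ eps0) := cf.
  by apply: filterS => z; rewrite distrC.
apply/cvgrPdist_lt => eps /cf /near_dist.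
by apply: filterS => z; rewrite distrC.
Qed.

End EpsilonDelta.

Section RowNorm.
Context {R : realType} {n : nat}.

Lemma rV_norm_le (z : 'rV[R]_n) (a : R) : 0 <= a ->
  (forall i, `|z 0 i| <= a) -> `|z| <= a.
Proof.
move=> a0 za; rewrite /Num.Def.normr /= mx_normrE; apply: bigmax_le => // -[i j] _ /=.
by rewrite ord1.
Qed.

Lemma rV_coord_le (z : 'rV[R]_n) i : `|z 0 i| <= `|z|.
Proof.
rewrite [leRHS]/Num.Def.normr /= mx_normrE.
exact: (le_bigmax _ (fun ij : 'I_1 * 'I_n => `|z ij.1 ij.2|) (0, i)).
Qed.

Lemma continuous_coord {E : normedModType R} (f : E -> 'rV[R]_n) x :
  {for x, continuous f} <-> forall i, {for x, continuous (fun z => f z 0 i)}.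
Proof.
split=> [cf i|cf].
  by apply: (continuous_comp cf (g := fun M : 'rV[R]_n => M 0 i)); exact: coord_continuous.
apply/continuous_dist => eps eps0.
have : \forall z \near x, forall i, `|f z 0 i - f x 0 i| < eps / 2.
  apply: filter_forall => i; apply/near_dist.
  by have /continuous_dist := cf i; apply; rewrite divr_gt0.
move=> /near_dist[d d0 dP]; exists d => // z /dP fz.
apply: (@le_lt_trans _ _ (eps / 2)); last first.
  by rewrite ltr_pdivrMr // mulr2n mulrDr mulr1 ltrDl.
apply: rV_norm_le => [|i]; first by rewrite divr_ge0 // ltW.
by rewrite !mxE ltW.
Qed.

End RowNorm.

(** * Slope functions and the chain rule *)

Section Caratheodory.
Context {R : realType} {n : nat}.
Implicit Types (f : 'rV[R]_n -> R) (p z : 'rV[R]_n).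

Local Notation e i := (delta_mx 0 i : 'rV[R]_n).

Let mixed p z (k : nat) : 'rV[R]_n :=
  \row_i (if (i < k)%N then z 0 i else p 0 i).

(** Because the norm is the sup norm, a point each of whose coordinates lies between those of [p]
    and [z] stays within [|z - p|] of [p]. The mean value theorem along the [k]-th axis thus only
    meets points where [f] is derivable. *)
Let increment f p z (r : R) : `|z - p| < r ->
  (forall z', `|z' - p| < r -> forall i, derivable f z' (e i)) ->
  forall k : 'I_n, exists2 xi, `|xi - p| <= `|z - p| &
  f (mixed p z k.+1) - f (mixed p z k) = 'D_(e k) f xi * (z - p) 0 k.
Proof.
move=> zr df k; pose a := (z - p) 0 k.
have -> : mixed p z k.+1 = a *: e k + mixed p z k.
  apply/rowP => i; rewrite !mxE ltnS leq_eqVlt eqxx /=.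
  have [->|ik] := eqVneq i k; first by rewrite eqxx ltnn /= mulr1 /a !mxE subrK.
  by rewrite (inj_eq val_inj) (negbTE ik) /= mulr0 add0r.
have near_mixed c : `|c| <= `|a| -> `|c *: e k + mixed p z k - p| <= `|z - p|.
  move=> ca; apply: rV_norm_le => // i; rewrite !mxE eqxx /=.
  have [->|ik] := eqVneq i k.
    rewrite ltnn mulr1 addrK; apply: le_trans ca _; exact: rV_coord_le.
  rewrite mulr0 add0r; case: ifP => _; last by rewrite subrr normr0.
  by rewrite -[z 0 i - p 0 i](_ : (z - p) 0 i = _) ?rV_coord_le // !mxE.
have [c|c ca ->] := @mean_value _ _ f (mixed p z k) (e k) a.
  by move=> ca; apply: df; apply: le_lt_trans (near_mixed _ ca) zr.
by exists (c *: e k + mixed p z k); [exact: near_mixed|rewrite mulrC].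
Qed.

(* The slope c i z is the i-th partial derivative at an intermediate point of the
   path from p to z that changes one coordinate at a time. *)
Lemma caratheodory f p :
  (\forall z \near p, forall i, derivable f z (e i)) ->
  (forall i, {for p, continuous ('D_(e i) f)}) ->
  exists c : 'I_n -> 'rV[R]_n -> R,
    (forall i, {for p, continuous (c i)} /\ c i p = 'D_(e i) f p) /\
    \forall z \near p, f z - f p = \sum_i c i z * (z - p) 0 i.
Proof.
move=> /near_dist[r r0 df] cdf.
have ex (zk : 'rV[R]_n * 'I_n) : exists xi : 'rV[R]_n, `|zk.1 - p| < r ->
    `|xi - p| <= `|zk.1 - p| /\
    f (mixed p zk.1 zk.2.+1) - f (mixed p zk.1 zk.2) =
    'D_(e zk.2) f xi * (zk.1 - p) 0 zk.2.
  (* Outside the ball nothing is claimed, and 0 is an arbitrary value for the choice function. *)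
  case: zk => z k /=; have [zr|/negP zr] := boolP (`|z - p| < r); last by exists 0.
  have [xi ? ?] := increment zr df k; by exists xi.
have [xi xiP] := choice ex.
have xi_near z i : `|z - p| < r -> `|xi (z, i) - p| <= `|z - p|.
  by case/(xiP (z, i)).
have xi_p i : xi (p, i) = p.
  have := xi_near p i; rewrite subrr normr0 => /(_ r0).
  by rewrite normr_le0 subr_eq0 => /eqP.
exists (fun i z => 'D_(e i) f (xi (z, i))); split=> [i|].
  split; last by rewrite xi_p.
  apply/continuous_dist => eps eps0.
  have /continuous_dist/(_ _ eps0)[d d0 dP] := cdf i.
  exists (Num.min d r) => [|z]; first by rewrite lt_min d0.
  rewrite lt_min xi_p => /andP[zd zr]; apply: dP.
  by apply: le_lt_trans zd; exact: xi_near.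
apply/near_dist; exists r => // z zr.
have -> : f z = f (mixed p z n).
  by congr f; apply/rowP => i; rewrite mxE ltn_ord.
have -> : f p = f (mixed p z 0).
  by congr f; apply/rowP => i; rewrite mxE.
have /= <- := @telescope_sumr _ 0 n (fun k => f (mixed p z k)) isT; rewrite big_mkord.
by apply: eq_bigr => i _; have [] := xiP (z, i) zr.
Qed.

End Caratheodory.

Section PointwiseDerivative.
Context {R : realType} {E : normedModType R}.
Implicit Types (f g : E -> R) (x v : E).

Lemma is_derive_cvg f x v (l : R) :
  (h^-1 * (f (h *: v + x) - f x)) @[h --> (0 : R)^'] --> l -> is_derive x v f l.
Proof.
by move=> fl; apply: DeriveDef; [apply/cvg_ex; exists l|apply: cvg_lim].
Qed.

Lemma cvg_derive f x v : derivable f x v ->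
  (h^-1 * (f (h *: v + x) - f x)) @[h --> (0 : R)^'] --> 'D_v f x.
Proof. by []. Qed.

Lemma derivable_add f g x v : derivable f x v -> derivable g x v ->
  derivable (fun z => f z + g z) x v.
Proof. exact: derivableD. Qed.

Lemma derive_add f g x v : derivable f x v -> derivable g x v ->
  'D_v (fun z => f z + g z) x = 'D_v f x + 'D_v g x.
Proof. exact: deriveD. Qed.

Lemma derive_opp f x v : derivable f x v -> 'D_v (fun z => - f z) x = - 'D_v f x.
Proof. exact: deriveN. Qed.

Lemma derivable_sub f g x v : derivable f x v -> derivable g x v ->
  derivable (fun z => f z - g z) x v.
Proof. exact: derivableB. Qed.

Lemma derive_sub f g x v : derivable f x v -> derivable g x v ->
  'D_v (fun z => f z - g z) x = 'D_v f x - 'D_v g x.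
Proof. exact: deriveB. Qed.

Lemma derivable_mul f g x v : derivable f x v -> derivable g x v ->
  derivable (fun z => f z * g z) x v.
Proof. exact: derivableM. Qed.

Lemma derive_mul f g x v : derivable f x v -> derivable g x v ->
  'D_v (fun z => f z * g z) x = 'D_v f x * g x + f x * 'D_v g x.
Proof.
move=> fd gd; rewrite [LHS](deriveM fd gd) addrC.
by rewrite -[g x *: _]/(g x * 'D_v f x) (mulrC (g x)).
Qed.

Lemma derivable_sumf n (f : 'I_n -> E -> R) x v :
  (forall i, derivable (f i) x v) -> derivable (fun z => \sum_i f i z) x v.
Proof.
by move=> fd; rewrite -fct_sumE; exact: derivable_sum.
Qed.

Lemma derive_sumf n (f : 'I_n -> E -> R) x v :
  (forall i, derivable (f i) x v) ->
  'D_v (fun z => \sum_i f i z) x = \sum_i 'D_v (f i) x.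
Proof.
by move=> fd; rewrite -fct_sumE; exact: derive_sum.
Qed.

Lemma derivable_inv f x v : f x != 0 -> derivable f x v ->
  derivable (fun z => (f z)^-1) x v.
Proof. exact: derivableV. Qed.

Lemma derive_inv f x v : f x != 0 -> derivable f x v ->
  'D_v (fun z => (f z)^-1) x = - ((f x)^-1 * (f x)^-1 * 'D_v f x).
Proof.
by move=> f0 fd; rewrite deriveV // -[- _ *: _]/(- _ * _) expr2 invfM mulNr.
Qed.

Lemma derive_constant (c : R) x v : 'D_v (fun=> c) x = 0.
Proof. exact: derive_cst. Qed.

Lemma derivable_const (c : R) x v : derivable (fun=> c) x v.
Proof. exact: derivable_cst. Qed.

End PointwiseDerivative.

Lemma is_derive1_chain {R : realType} {E : normedModType R} (phi : R -> R)
    (f : E -> R) (x v : E) (d : R) :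
  is_derive (f x) 1 phi d -> derivable f x v ->
  is_derive x v (phi \o f) (d * 'D_v f x).
Proof.
move=> [dphi phid] df.
have df0 : differentiable (fun h : R => f (h *: v + x)) 0.
  by apply/derivable1_diffP; have /derivable1P := df.
have e0 : f (0 *: v + x) = f x by rewrite scale0r add0r.
have dphi0 : differentiable phi (f (0 *: v + x)).
  by rewrite e0; exact/derivable1_diffP.
have dcomp : differentiable (phi \o (fun h : R => f (h *: v + x))) 0.
  exact: differentiable_comp.
have dd : derivable (phi \o f) x v.
  by apply/derivable1P; apply/derivable1_diffP.
apply: DeriveDef => //.
have := derive_on_line (phi \o f) x v 0; rewrite scale0r add0r => <-.
rewrite -derive1E derive1_comp; last 2 first.
- by apply/derivable1_diffP.
- by apply/derivable1_diffP.
by rewrite !derive1E derive_on_line e0 scale0r add0r phid.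
Qed.

Section ChainRule.
Context {R : realType} {E : normedModType R} {n : nat}.

Local Notation e i := (delta_mx 0 i : 'rV[R]_n).

(** The slopes of [f] at [g x] turn the difference quotient of [f \o g] into a sum of factors
    converging to the partial derivatives, times the quotients of the coordinates of [g]. *)
Lemma chain_rule (f : 'rV[R]_n -> R) (g : E -> 'rV[R]_n) (x v : E) :
  (\forall z \near g x, forall i, derivable f z (e i)) ->
  (forall i, {for g x, continuous ('D_(e i) f)}) ->
  (forall i, derivable (fun z => g z 0 i) x v) ->
  is_derive x v (f \o g)
    (\sum_i 'D_(e i) f (g x) * 'D_v (fun z => g z 0 i) x).
Proof.
move=> df cdf dg.
have [c [cc /near_dist[r r0 fE]]] := caratheodory df cdf.
have dgx : derivable g x v.
  by apply/derivable_mxP => i j; rewrite ord1; exact: dg.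
have cg : {for 0, continuous (fun h : R => g (h *: v + x))}.
  apply: differentiable_continuous.
  by apply/derivable1_diffP; have /derivable1P := dgx.
apply: is_derive_cvg.
have near_r : \forall h \near (0 : R)^', `|g (h *: v + x) - g x| < r.
  apply: nbhs_dnbhs; have /continuous_dist/(_ _ r0) := cg.
  by rewrite scale0r add0r => /near_dist.
apply: (@cvg_trans _ ((\sum_i c i (g (h *: v + x)) *
    (h^-1 * (g (h *: v + x) 0 i - g x 0 i))) @[h --> (0 : R)^'])).
  apply: near_eq_cvg; apply: filterS near_r => h hr /=.
  rewrite fE // mulr_sumr; apply: eq_bigr => i _.
  by rewrite !mxE mulrCA.
apply: cvg_big => [|i _]; first exact: add_continuous.
have [ci cip] := cc i.
apply: cvgM; last exact: cvg_derive.
rewrite -cip; have -> : c i (g x) = c i (g (0 *: v + x)) by rewrite scale0r add0r.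
apply: cvg_within_filter.
apply: (@continuous_comp _ _ _ (fun h : R => g (h *: v + x)) (c i) 0) => //.
by rewrite scale0r add0r.
Qed.

End ChainRule.

(** * Functions of class C^k *)

Section Ck.
Context {R : realType} {E : normedModType R}.
Implicit Types (U V : set E) (f g : E -> R).

(** Derivatives are peeled from the inside, [f] being replaced by ['D_v f], so that closure
    properties follow by induction on [k] with [f] generalized. *)
Fixpoint Ck (k : nat) U f : Prop :=
  (forall x, U x -> {for x, continuous f}) /\
  if k is k'.+1 then
    forall v, (forall x, U x -> derivable f x v) /\ Ck k' U ('D_v f)
  else True.

Lemma Ck_continuous k U f x : Ck k U f -> U x -> {for x, continuous f}.
Proof. by case: k => [|k] [cf _] /cf. Qed.

Lemma Ck_derivable k U f x v : Ck k.+1 U f -> U x -> derivable f x v.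
Proof. by move=> [_ /(_ v)[df _]] /df. Qed.

Lemma Ck_derive k U f v : Ck k.+1 U f -> Ck k U ('D_v f).
Proof. by move=> [_ /(_ v)[]]. Qed.

Lemma Ck_pred k U f : Ck k.+1 U f -> Ck k U f.
Proof.
elim: k f => [|k IH] f [cf df]; first by split.
by split=> // v; have [? ?] := df v; split=> //; exact: IH.
Qed.

Lemma near_open U (P : set E) x : open U -> U x -> (forall z, U z -> P z) ->
  \forall z \near x, P z.
Proof.
move=> oU Ux UP; apply: (@filterS _ _ _ U) => //.
exact: open_nbhs_nbhs.
Qed.

Lemma continuous_for_eq U f g x : open U -> U x ->
  (forall z, U z -> f z = g z) -> {for x, continuous f} ->
  {for x, continuous g}.
Proof.
move=> oU Ux fg cf; rewrite /prop_for /continuous_at -(fg _ Ux); apply: cvg_trans cf.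
by apply: near_eq_cvg; apply: near_open fg.
Qed.

Lemma Ck_eq k U f g : open U -> (forall x, U x -> f x = g x) ->
  Ck k U f -> Ck k U g.
Proof.
move=> oU; elim: k f g => [|k IH] f g fg [cf df].
  by split=> // x Ux; apply: continuous_for_eq fg (cf _ Ux).
split=> [x Ux|v]; first exact: continuous_for_eq fg (cf _ Ux).
have [dfv ckf] := df v; split=> [x Ux|].
  by apply: near_eq_derivable (dfv _ Ux); apply: near_open fg.
apply: IH ckf => x Ux.
by apply: near_eq_derive; apply: near_open fg.
Qed.

Lemma Ck_sub k U V f : V `<=` U -> Ck k U f -> Ck k V f.
Proof.
move=> VU; elim: k f => [|k IH] f [cf df].
  by split=> // x /VU /cf.
split=> [x /VU /cf //|v]; have [dfv ckf] := df v.
by split=> [x /VU /dfv //|]; exact: IH.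
Qed.

Lemma Ck_local k U f :
  (forall x, U x -> exists V, [/\ open V, V x & Ck k V f]) -> Ck k U f.
Proof.
elim: k f => [|k IH] f Uf.
  by split=> // x /Uf[V [oV Vx [cf _]]]; exact: cf.
split=> [x /Uf[V [oV Vx [cf _]]]|v]; first exact: cf.
split=> [x /Uf[V [oV Vx [_ /(_ v)[df _]]]]|]; first exact: df.
by apply: IH => x /Uf[V [oV Vx [_ /(_ v)[_ ckf]]]]; exists V.
Qed.

Lemma Ck_cst k U (c : R) : Ck k U (fun=> c).
Proof.
elim: k c => [|k IH] c; first by split=> // x _; exact: cst_continuous.
split=> [x _|v]; first exact: cst_continuous.
split=> [x _|]; first exact: derivable_const.
have -> : 'D_v (fun=> c) = (fun=> 0 : R).
  by apply/funext => x; exact: derive_constant.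
exact: IH.
Qed.

Lemma Ck_add k U f g : open U -> Ck k U f -> Ck k U g ->
  Ck k U (fun x => f x + g x).
Proof.
move=> oU; elim: k f g => [|k IH] f g [cf df] [cg dg].
  by split=> // x Ux; apply: cvgD; [exact: cf|exact: cg].
split=> [x Ux|v]; first by apply: cvgD; [exact: cf|exact: cg].
have [dfv ckf] := df v; have [dgv ckg] := dg v.
split=> [x Ux|]; first by apply: derivable_add; [exact: dfv|exact: dgv].
apply: (Ck_eq oU _ (IH _ _ ckf ckg)) => x Ux /=.
by rewrite derive_add //; [exact: dfv|exact: dgv].
Qed.

Lemma Ck_mul k U f g : open U -> Ck k U f -> Ck k U g ->
  Ck k U (fun x => f x * g x).
Proof.
move=> oU; elim: k f g => [|k IH] f g ckf ckg.
  have [[cf _] [cg _]] := (ckf, ckg).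
  by split=> // x Ux; apply: cvgM; [exact: cf|exact: cg].
have [[cf df] [cg dg]] := (ckf, ckg).
split=> [x Ux|v]; first by apply: cvgM; [exact: cf|exact: cg].
have [dfv ckf'] := df v; have [dgv ckg'] := dg v.
split=> [x Ux|]; first by apply: derivable_mul; [exact: dfv|exact: dgv].
have H := Ck_add oU (IH _ _ ckf' (Ck_pred ckg)) (IH _ _ (Ck_pred ckf) ckg').
apply: (Ck_eq oU _ H) => x Ux /=.
by rewrite derive_mul //; [exact: dfv|exact: dgv].
Qed.

Lemma Ck_opp k U f : open U -> Ck k U f -> Ck k U (fun x => - f x).
Proof.
move=> oU /(Ck_mul oU (Ck_cst k U (-1))); apply: Ck_eq => // x _ /=.
by rewrite mulN1r.
Qed.

Lemma Ck_sum k U (I : Type) (r : seq I) (P : pred I) (f : I -> E -> R) :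
  open U -> (forall i, P i -> Ck k U (f i)) ->
  Ck k U (fun x => \sum_(i <- r | P i) f i x).
Proof.
move=> oU ckf; elim: r => [|i r IH].
  by apply: Ck_eq (Ck_cst k U 0) => // x _; rewrite big_nil.
have [Pi|nPi] := boolP (P i).
  apply: Ck_eq (Ck_add oU (ckf _ Pi) IH) => // x _.
  by rewrite big_cons Pi.
by apply: Ck_eq IH => // x _; rewrite big_cons (negbTE nPi).
Qed.

Lemma Ck_prod k U (I : Type) (r : seq I) (P : pred I) (f : I -> E -> R) :
  open U -> (forall i, P i -> Ck k U (f i)) ->
  Ck k U (fun x => \prod_(i <- r | P i) f i x).
Proof.
move=> oU ckf; elim: r => [|i r IH].
  by apply: Ck_eq (Ck_cst k U 1) => // x _; rewrite big_nil.
have [Pi|nPi] := boolP (P i).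
  apply: Ck_eq (Ck_mul oU (ckf _ Pi) IH) => // x _.
  by rewrite big_cons Pi.
by apply: Ck_eq IH => // x _; rewrite big_cons (negbTE nPi).
Qed.

(** The derivative of 1/f is a polynomial in 1/f and the derivative of [f], so that class C^k of 1/f
    yields class C^(k+1). The square root is treated by the same bootstrap. *)
Lemma Ck_inv k U f : open U -> (forall x, U x -> f x != 0) ->
  Ck k U f -> Ck k U (fun x => (f x)^-1).
Proof.
move=> oU f0; elim: k => [|k IH] ckf.
  by split=> // x Ux; apply: cvgV; [exact: f0|exact: Ck_continuous ckf Ux].
split=> [x Ux|v].
  by apply: cvgV; [exact: f0|exact: Ck_continuous ckf Ux].
have IHf := IH (Ck_pred ckf).
split=> [x Ux|].
  by apply: derivable_inv; [exact: f0|exact: Ck_derivable ckf Ux].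
have H := Ck_opp oU (Ck_mul oU (Ck_mul oU IHf IHf) (Ck_derive v ckf)).
apply: (Ck_eq oU _ H) => x Ux /=.
by rewrite derive_inv //; [exact: f0|exact: Ck_derivable ckf Ux].
Qed.

Lemma Ck_sqrt k U f : open U -> (forall x, U x -> 0 < f x) ->
  Ck k U f -> Ck k U (fun x => Num.sqrt (f x)).
Proof.
move=> oU f0.
have csqrt x : {for x, continuous f} ->
    {for x, continuous (fun x => Num.sqrt (f x))}.
  by move=> cf; apply: continuous_comp cf _; exact: sqrt_continuous.
have dsqrt x v : U x -> derivable f x v ->
    is_derive x v (Num.sqrt \o f) ((2 * Num.sqrt (f x))^-1 * 'D_v f x).
  by move=> Ux; exact: (is_derive1_chain (is_derive1_sqrt (f0 _ Ux))).
elim: k => [|k IH] ckf.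
  by split=> // x Ux; apply: csqrt; exact: Ck_continuous ckf Ux.
split=> [x Ux|v]; first by apply: csqrt; exact: Ck_continuous ckf Ux.
have IHf := IH (Ck_pred ckf).
split=> [x Ux|].
  by have [] := dsqrt x v Ux (Ck_derivable ckf Ux).
have s0 x : U x -> 2 * Num.sqrt (f x) != 0.
  by move=> /f0 fx; rewrite mulf_neq0 // gt_eqF // sqrtr_gt0.
have H := Ck_mul oU (Ck_inv oU s0 (Ck_mul oU (Ck_cst k U 2) IHf))
  (Ck_derive v ckf).
apply: (Ck_eq oU _ H) => x Ux /=.
by have [_ ->] := dsqrt x v Ux (Ck_derivable ckf Ux).
Qed.

End Ck.

Section CkComposition.
Context {R : realType} {E F : normedModType R}.

(** An affine [L] with linear part [L0] carries difference quotients along [v] to difference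
    quotients along [L0 v] exactly. No coordinates are involved, so the lemma applies to lines and
    to projections of a product. *)
Lemma Ck_precomp_affine k (U : set E) (V : set F) (L L0 : E -> F) (f : F -> R) :
  (forall x, {for x, continuous L}) ->
  (forall h v x, L (h *: v + x) = h *: L0 v + L x) ->
  (forall x, U x -> V (L x)) -> Ck k V f -> Ck k U (f \o L).
Proof.
move=> cL aL UV.
have growth (g : F -> R) x v :
    (fun h : R => h^-1 *: (((g \o L) \o shift x) (h *: v) - (g \o L) x)) =
    (fun h : R => h^-1 *: ((g \o shift (L x)) (h *: L0 v) - g (L x))).
  by apply/funext => h /=; rewrite aL.
elim: k f => [|k IH] f ckf.
  split=> // x Ux; apply: continuous_comp (cL x) _.
  by apply: Ck_continuous ckf _; exact: UV.
split=> [x Ux|v].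
  by apply: continuous_comp (cL x) _; apply: Ck_continuous ckf _; exact: UV.
split=> [x Ux|].
  have := Ck_derivable ckf (UV _ Ux) (v := L0 v).
  by rewrite /derivable growth.
have -> : 'D_v (f \o L) = 'D_(L0 v) f \o L.
  by apply/funext => x; rewrite /= /derive growth.
exact/IH/Ck_derive.
Qed.

Lemma is_derive_affine (f f0 : E -> R) x v :
  (forall h v x, f (h *: v + x) = h * f0 v + f x) -> is_derive x v f (f0 v).
Proof.
move=> af; apply: is_derive_cvg.
apply: (@cvg_trans _ (f0 v @[_ --> (0 : R)^'])); last exact: cvg_cst.
apply: near_eq_cvg; near=> h; rewrite af addrK mulKf //.
by near: h; exact: nbhs_dnbhs_neq.
Unshelve. all: by end_near. Qed.

Lemma Ck_affine k (U : set E) (f f0 : E -> R) :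
  (forall x, {for x, continuous f}) ->
  (forall h v x, f (h *: v + x) = h * f0 v + f x) -> Ck k U f.
Proof.
move=> cf af; have df x v := is_derive_affine x v af.
case: k => [|k]; first by split=> // x _; exact: cf.
split=> [x _|v]; first exact: cf.
split=> [x _|]; first by have [] := df x v.
have -> : 'D_v f = (fun=> f0 v) by apply/funext => x; have [] := df x v.
exact: Ck_cst.
Qed.

End CkComposition.

Section CkRowVector.
Context {R : realType} {E : normedModType R} {n : nat}.
Local Notation e i := (delta_mx 0 i : 'rV[R]_n).

Lemma Ck_coord k (U : set 'rV[R]_n) (i : 'I_n) : Ck k U (fun x => x 0 i).
Proof.
apply: (@Ck_affine _ _ k U _ (fun x => x 0 i)) => [x|h v x].
  exact: coord_continuous.
by rewrite !mxE.
Qed.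

(** By the chain rule a derivative of [f \o g] is a sum of products, whose factors are of class C^k
    by induction. *)
Lemma Ck_comp k (V : set 'rV[R]_n) (U : set E) (f : 'rV[R]_n -> R)
    (g : E -> 'rV[R]_n) : open V -> open U -> (forall x, U x -> V (g x)) ->
  Ck k V f -> (forall i, Ck k U (fun x => g x 0 i)) -> Ck k U (f \o g).
Proof.
move=> oV oU UV.
have cfg (h : 'rV[R]_n -> R) x : {for g x, continuous h} ->
    (forall i, {for x, continuous (fun x => g x 0 i)}) ->
    {for x, continuous (h \o g)}.
  by move=> ch cg; apply: continuous_comp ch; exact/continuous_coord.
elim: k f => [|k IH] f ckf ckg.
  split=> // x Ux; apply: cfg => [|i].
    by apply: Ck_continuous ckf _; exact: UV.
  exact: Ck_continuous (ckg i) Ux.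
split=> [x Ux|v].
  apply: cfg => [|i].
    by apply: Ck_continuous ckf _; exact: UV.
  exact: Ck_continuous (ckg i) Ux.
have dfg x : U x -> is_derive x v (f \o g)
    (\sum_i 'D_(e i) f (g x) * 'D_v (fun z => g z 0 i) x).
  move=> Ux; have Vx := UV _ Ux; apply: chain_rule => [|i|i].
  - by apply: near_open oV Vx _ => z Vz i; exact: Ck_derivable ckf Vz.
  - exact: Ck_continuous (Ck_derive (e i) ckf) Vx.
  - exact: Ck_derivable (ckg i) Ux.
split=> [x Ux|]; first by have [] := dfg x Ux.
apply: (@Ck_eq _ _ _ _
    (fun x => \sum_i 'D_(e i) f (g x) * 'D_v (fun z => g z 0 i) x)) => // [x Ux|].
  by have [_ ->] := dfg x Ux.
apply: Ck_sum => // i _; apply: Ck_mul => //; last exact: Ck_derive.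
by apply: (IH ('D_(e i) f)) => [|j]; [exact: Ck_derive|exact/Ck_pred].
Qed.

End CkRowVector.

(** * Symmetry of second derivatives *)

Section Schwarz.
Context {R : realType} {E : normedModType R}.
Implicit Types (U : set E) (f : E -> R) (x v w : E).

Lemma growth_translate f (a z v : E) :
  (fun h : R => h^-1 *: (((fun z => f (a + z)) \o shift z) (h *: v) - f (a + z))) =
  (fun h : R => h^-1 *: ((f \o shift (a + z)) (h *: v) - f (a + z))).
Proof. by apply/funext => h /=; rewrite addrCA. Qed.

Lemma derivable_translate f (a z v : E) :
  derivable f (a + z) v -> derivable (fun z => f (a + z)) z v.
Proof. by rewrite /derivable growth_translate. Qed.

Lemma derive_translate f (a z v : E) :
  'D_v (fun z => f (a + z)) z = 'D_v f (a + z).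
Proof. by rewrite /derive growth_translate. Qed.

(** Mean value theorem along [v] for the difference between [f] and its translate by [h *: w], then
    along [w] for ['D_v f]. *)
Lemma second_difference U f x v w (h : R) : Ck 2 U f ->
  (forall a b, `|a| <= `|h| -> `|b| <= `|h| -> U (a *: w + (b *: v + x))) ->
  exists a b, [/\ `|a| <= `|h|, `|b| <= `|h| &
    f (h *: w + (h *: v + x)) - f (h *: v + x) - (f (h *: w + x) - f x) =
    h * (h * 'D_w ('D_v f) (a *: w + (b *: v + x)))].
Proof.
move=> ck2 Uh; pose g z := f (h *: w + z) - f z.
have h0 : `|0 : R| <= `|h| by rewrite normr0.
have dg b : `|b| <= `|h| -> derivable g (b *: v + x) v /\
    'D_v g (b *: v + x) =
    'D_v f (h *: w + (b *: v + x)) - 'D_v f (b *: v + x).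
  move=> bh; have Ub : U (b *: v + x).
    by have := Uh 0 b h0 bh; rewrite scale0r add0r.
  have Uhb : U (h *: w + (b *: v + x)) by exact: Uh.
  have d1 := derivable_translate (Ck_derivable ck2 Uhb (v := v)).
  have d2 := Ck_derivable ck2 Ub (v := v).
  split; first exact: derivable_sub d1 d2.
  by rewrite [LHS](derive_sub d1 d2) derive_translate.
have [b bh] := @mean_value _ _ g x v h (fun b bh => (dg b bh).1).
rewrite (dg b bh).2 /g => ->.
have [a|a ah ->] := @mean_value _ _ ('D_v f) (b *: v + x) w h.
  by move=> ah; apply: Ck_derivable (Ck_derive v ck2) _; exact: Uh.
by exists a, b.
Qed.

(** The second difference is symmetric in [v] and [w]. Each order of differentiation realizes it at
    some point near [x], and continuity of both mixed derivatives at [x] forces them to agree. *)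
Lemma derive_commute U f x v w : open U -> U x -> Ck 2 U f ->
  'D_v ('D_w f) x = 'D_w ('D_v f) x.
Proof.
move=> oU Ux ck2; apply/eqP; rewrite -subr_eq0 -normr_eq0.
apply/eqP/le_anti/andP; split => //; apply/ler_addgt0Pr => eps eps0.
have eps2 : 0 < eps / 2 by rewrite divr_gt0.
have [d1 d10 d1P] := (continuous_dist _ _).1
  (Ck_continuous (Ck_derive v (Ck_derive w ck2)) Ux) _ eps2.
have [d2 d20 d2P] := (continuous_dist _ _).1
  (Ck_continuous (Ck_derive w (Ck_derive v ck2)) Ux) _ eps2.
have [d3 d30 d3P] : exists2 d, 0 < d & forall z, `|z - x| < d -> U z.
  by apply/near_dist; exact: near_open oU Ux _.
pose d := Num.min d1 (Num.min d2 d3).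
have d0 : 0 < d by rewrite !lt_min d10 d20.
(* With [h = d / n], every point [a v + b w + x] with |a|, |b| <= h lies within [d] of [x]; the
   summand 1 keeps [n] positive when [v] and [w] vanish. *)
pose n := `|v| + `|w| + 1.
have n0 : 0 < n by rewrite ltr_wpDl // addr_ge0.
pose h := d / n.
have h0 : 0 < h by rewrite divr_gt0.
have near_x (u u' : E) a b : `|u| + `|u'| + 1 = n -> `|a| <= `|h| -> `|b| <= `|h| ->
    `|a *: u + (b *: u' + x) - x| < d.
  move=> un ah bh; rewrite addrA addrK.
  apply: le_lt_trans (ler_normD _ _) _; rewrite !normrZ.
  apply: (@le_lt_trans _ _ (h * (`|u| + `|u'|))).
    by rewrite mulrDr lerD // ler_wpM2r // (le_trans ah, le_trans bh) // gtr0_norm.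
  rewrite /h mulrAC ltr_pdivrMr // ltr_pM2l // -un.
  by rewrite ltrDl.
have nC : `|w| + `|v| + 1 = n by rewrite (addrC `|w|).
have dd (z : E) : `|z - x| < d -> [/\ `|z - x| < d1, `|z - x| < d2 & U z].
  by rewrite !lt_min => /and3P[? ? /d3P].
have [|a [b [ah bh ab]]] := @second_difference U f x v w h ck2.
  by move=> a b ah bh; have [] := dd _ (near_x _ _ _ _ nC ah bh).
have [|a' [b' [ah' bh' ab']]] := @second_difference U f x w v h ck2.
  by move=> a' b' ah' bh'; have [] := dd _ (near_x _ _ _ _ erefl ah' bh').
have {}ab : 'D_w ('D_v f) (a *: w + (b *: v + x)) =
            'D_v ('D_w f) (a' *: v + (b' *: w + x)).
  have cancel (p q r t X Y : R) : p - q - (r - t) = h * (h * X) ->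
      p - r - (q - t) = h * (h * Y) -> X = Y.
    move=> eX eY.
    by apply: (mulfI (lt0r_neq0 h0)); apply: (mulfI (lt0r_neq0 h0)); rewrite -eX -eY; ring.
  by apply: cancel ab _; rewrite -ab' (addrCA (h *: v)).
have [_ /d2P + _] := dd _ (near_x _ _ _ _ nC ah bh).
have [/d1P + _ _] := dd _ (near_x _ _ _ _ erefl ah' bh').
have close (A B C : R) : `|C - A| < eps / 2 -> `|C - B| < eps / 2 ->
    `|A - B| <= 0 + eps.
  move=> CA CB; have -> : A - B = (C - B) - (C - A) by ring.
  rewrite add0r (splitr eps); apply: le_trans (ler_normB _ _) _.
  exact: lerD (ltW CB) (ltW CA).
by rewrite ab; exact: close.
Qed.

End Schwarz.

Section SmoothFunctions.
Context {R : realType} {E : normedModType R}.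
Implicit Types (U V : set E) (f g : E -> R).

Definition Cinf U f := forall k, Ck k U f.

Lemma Cinf_continuous U f x : Cinf U f -> U x -> {for x, continuous f}.
Proof. move=> cf Ux; exact: Ck_continuous (cf 0%N) Ux. Qed.

Lemma Cinf_derivable U f x v : Cinf U f -> U x -> derivable f x v.
Proof. by move=> cf Ux; exact: Ck_derivable (cf 1%N) Ux. Qed.

Lemma Cinf_derive U f v : Cinf U f -> Cinf U ('D_v f).
Proof. by move=> cf k; exact: Ck_derive (cf k.+1). Qed.

Lemma Cinf_eq U f g : open U -> (forall x, U x -> f x = g x) ->
  Cinf U f -> Cinf U g.
Proof. by move=> oU fg cf k; apply: Ck_eq fg (cf k). Qed.

Lemma Cinf_sub U V f : V `<=` U -> Cinf U f -> Cinf V f.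
Proof. by move=> VU cf k; apply: Ck_sub VU (cf k). Qed.

Lemma Cinf_local U f :
  (forall x, U x -> exists V, [/\ open V, V x & Cinf V f]) -> Cinf U f.
Proof.
move=> Uf k; apply: Ck_local => x /Uf[V [oV Vx cf]].
by exists V; split.
Qed.

Lemma Cinf_cst U (c : R) : Cinf U (fun=> c).
Proof. by move=> k; exact: Ck_cst. Qed.

Lemma Cinf_add U f g : open U -> Cinf U f -> Cinf U g ->
  Cinf U (fun x => f x + g x).
Proof. by move=> oU cf cg k; exact: Ck_add. Qed.

Lemma Cinf_mul U f g : open U -> Cinf U f -> Cinf U g ->
  Cinf U (fun x => f x * g x).
Proof. by move=> oU cf cg k; exact: Ck_mul. Qed.

Lemma Cinf_opp U f : open U -> Cinf U f -> Cinf U (fun x => - f x).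
Proof. by move=> oU cf k; exact: Ck_opp. Qed.

Lemma Cinf_sum U (I : Type) (r : seq I) (P : pred I) (f : I -> E -> R) :
  open U -> (forall i, P i -> Cinf U (f i)) ->
  Cinf U (fun x => \sum_(i <- r | P i) f i x).
Proof. by move=> oU cf k; apply: Ck_sum => // i Pi; exact: cf. Qed.

Lemma Cinf_prod U (I : Type) (r : seq I) (P : pred I) (f : I -> E -> R) :
  open U -> (forall i, P i -> Cinf U (f i)) ->
  Cinf U (fun x => \prod_(i <- r | P i) f i x).
Proof. by move=> oU cf k; apply: Ck_prod => // i Pi; exact: cf. Qed.

Lemma Cinf_inv U f : open U -> (forall x, U x -> f x != 0) ->
  Cinf U f -> Cinf U (fun x => (f x)^-1).
Proof. by move=> oU f0 cf k; exact: Ck_inv. Qed.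

Lemma Cinf_sqrt U f : open U -> (forall x, U x -> 0 < f x) ->
  Cinf U f -> Cinf U (fun x => Num.sqrt (f x)).
Proof. by move=> oU f0 cf k; exact: Ck_sqrt. Qed.

(** Reconciles the outside recursion of [iter_derive] with the inside recursion of [Ck]. *)
Lemma iter_derive_rcons {V : normedModType R} (vs : seq E) (v : E) (f : E -> V) :
  iter_derive (rcons vs v) f = iter_derive vs ('D_v f).
Proof. by elim: vs => [//|u vs IH] /=; rewrite IH. Qed.

Lemma smooth_on_open_Cinf U f : smooth_on_open U f <-> Cinf U f.
Proof.
split=> [|cf vs]; last first.
  elim/last_ind: vs f cf => [|vs v IH] f cf x Ux /=.
    by split=> [|v]; [exact: Cinf_continuous cf Ux|exact: Cinf_derivable cf Ux].
  rewrite iter_derive_rcons; apply: IH => //; exact: Cinf_derive.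
move=> sf k; elim: k f sf => [|k IH] f sf.
  by split=> // x Ux; have [] := sf [::] x Ux.
split=> [x Ux|v]; first by have [] := sf [::] x Ux.
split=> [x Ux|]; first by have [_] := sf [::] x Ux; apply.
by apply: IH => vs x Ux; rewrite -iter_derive_rcons; exact: sf.
Qed.

Lemma derivable_coord n (f : E -> 'rV[R]_n) x v :
  derivable f x v <-> forall i, derivable (fun z => f z 0 i) x v.
Proof.
split=> [/derivable_mxP df i|df]; first exact: df.
by apply/derivable_mxP => i j; rewrite ord1; exact: df.
Qed.

Lemma derive_coord n (f : E -> 'rV[R]_n) x v i : derivable f x v ->
  ('D_v f x) 0 i = 'D_v (fun z => f z 0 i) x.
Proof. by move=> df; rewrite derive_mx // mxE. Qed.

Lemma smooth_on_open_coord n U (f : E -> 'rV[R]_n) : open U ->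
  smooth_on_open U f <-> forall i, Cinf U (fun x => f x 0 i).
Proof.
move=> oU; split=> [sf i|cf].
  apply/smooth_on_open_Cinf => vs.
  have E1 x : U x -> iter_derive vs (fun x => f x 0 i) x =
              (iter_derive vs f x) 0 i.
    elim: vs x => [//|v vs IH] x Ux /=.
    rewrite derive_coord; last by have [_] := sf vs x Ux; apply.
    by apply: near_eq_derive; exact: near_open IH.
  move=> x Ux; have [cx dx] := sf vs x Ux; split=> [|v].
    apply: (continuous_for_eq oU Ux (f := fun z => iter_derive vs f z 0 i)).
      by move=> z Uz; rewrite E1.
    exact: (continuous_coord _ _).1.
  apply: (@near_eq_derivable _ _ _ (fun z => iter_derive vs f z 0 i)).
    by apply: near_open oU Ux _ => z Uz; rewrite E1.
  exact: (derivable_coord _ _ _).1.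
move=> vs; have sf i := (smooth_on_open_Cinf U (fun x => f x 0 i)).2 (cf i).
suff E1 x : U x -> (forall i, iter_derive vs (fun x => f x 0 i) x =
    (iter_derive vs f x) 0 i).
  move=> x Ux; split=> [|v].
    apply/continuous_coord => i.
    apply: (continuous_for_eq oU Ux (f := iter_derive vs (fun x => f x 0 i))).
      by move=> z Uz; rewrite E1.
    by have [] := sf i vs x Ux.
  apply/derivable_coord => i.
  apply: (@near_eq_derivable _ _ _ (iter_derive vs (fun x => f x 0 i))).
    by apply: near_open oU Ux _ => z Uz; rewrite E1.
  by have [_] := sf i vs x Ux; apply.
elim: vs x => [//|v vs IH] x Ux i /=.
rewrite derive_coord; last first.
  apply/derivable_coord => j.
  apply: (@near_eq_derivable _ _ _ (iter_derive vs (fun x => f x 0 j))).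
    by apply: near_open oU Ux _ => z Uz; rewrite IH.
  by have [_] := sf j vs x Ux; apply.
by apply: near_eq_derive; apply: near_open oU Ux _ => z Uz; rewrite IH.
Qed.

End SmoothFunctions.

Section SmoothRowVector.
Context {R : realType} {E : normedModType R} {n : nat}.

Lemma Cinf_coord (U : set 'rV[R]_n) (i : 'I_n) : Cinf U (fun x => x 0 i).
Proof. by move=> k; exact: Ck_coord. Qed.

Lemma Cinf_comp (V : set 'rV[R]_n) (U : set E) (f : 'rV[R]_n -> R)
    (g : E -> 'rV[R]_n) : open V -> open U -> (forall x, U x -> V (g x)) ->
  Cinf V f -> (forall i, Cinf U (fun x => g x 0 i)) -> Cinf U (f \o g).
Proof.
by move=> oV oU UV cf cg k; apply: Ck_comp (cf k) _ => // i; exact: cg.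
Qed.

Lemma Cinf_chain (V : set 'rV[R]_n) (f : 'rV[R]_n -> R) (g : E -> 'rV[R]_n)
    (x v : E) : open V -> V (g x) -> Cinf V f ->
  (forall i, derivable (fun z => g z 0 i) x v) ->
  is_derive x v (f \o g)
    (\sum_i 'D_(delta_mx 0 i) f (g x) * 'D_v (fun z => g z 0 i) x).
Proof.
move=> oV Vx cf dg; apply: (chain_rule _ _ dg) => [|i].
  by apply: near_open oV Vx _ => z Vz i; exact: Cinf_derivable cf Vz.
exact: Cinf_continuous (Cinf_derive _ cf) Vx.
Qed.

End SmoothRowVector.

Lemma is_derive_scale_param {R : realType} (a b u : R) :
  is_derive u (1 : R) (fun u => u * a + b) a.
Proof.
have did : derivable (fun u : R => u) u 1 by exact: derivable_id.
have da : derivable (fun=> a) u 1 by exact: derivable_const.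
have db : derivable (fun=> b) u 1 by exact: derivable_const.
have dm := derivable_mul did da.
split; first exact: derivable_add dm db.
rewrite [LHS](derive_add dm db) [X in X + _](derive_mul did da).
by rewrite !derive_constant derive_id mul1r mulr0 !addr0.
Qed.

(** The chain rule along the line [u *: v + x]. It supplies linearity in the direction [v], which is
    not built into directional derivatives. *)
Lemma derive_partials {R : realType} {n : nat} (V : set 'rV[R]_n)
    (f : 'rV[R]_n -> R) (x v : 'rV[R]_n) :
  open V -> V x -> Cinf V f ->
  'D_v f x = \sum_i v 0 i * 'D_(delta_mx 0 i) f x.
Proof.
move=> oV Vx cf; pose g (u : R) : 'rV[R]_n := u *: v + x.
have gx : g 0 = x by rewrite /g scale0r add0r.
have gE i : (fun u => g u 0 i) = (fun u => u * v 0 i + x 0 i).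
  by apply/funext => u; rewrite !mxE.
have dg i : is_derive (0 : R) (1 : R) (fun u => g u 0 i) (v 0 i).
  by rewrite gE; exact: is_derive_scale_param.
have Vg : V (g 0) by rewrite gx.
have [_] := Cinf_chain oV Vg cf (fun i => @ex_derive _ _ _ _ _ _ _ (dg i)).
rewrite (derive_on_line f x v) -/(g 0) gx => ->.
by apply: eq_bigr => i _; rewrite mulrC; have [_ ->] := dg i.
Qed.

(** * The radial function of a convex surface *)

Section Euclid.
Context {R : realType}.
Implicit Types u v w x y : 'rV[R]_3.

Lemma dotC u v : dot u v = dot v u.
Proof. by apply: eq_bigr => i _; rewrite mulrC. Qed.

Lemma dotDl u v w : dot (u + v) w = dot u w + dot v w.
Proof. by rewrite -big_split; apply: eq_bigr => i _ /=; rewrite mxE mulrDl. Qed.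

Lemma dotZl (a : R) u v : dot (a *: u) v = a * dot u v.
Proof. by rewrite mulr_sumr; apply: eq_bigr => i _; rewrite mxE mulrA. Qed.

Lemma dotDr u v w : dot u (v + w) = dot u v + dot u w.
Proof. by rewrite !(dotC u) dotDl. Qed.

Lemma dotZr (a : R) u v : dot u (a *: v) = a * dot u v.
Proof. by rewrite !(dotC u) dotZl. Qed.

Lemma dotNl u v : dot (- u) v = - dot u v.
Proof. by rewrite -scaleN1r dotZl mulN1r. Qed.

Lemma dot_ge0 u : 0 <= dot u u.
Proof. by apply: sumr_ge0 => i _; rewrite -expr2 sqr_ge0. Qed.

Lemma dot_eq0 u : (dot u u == 0) = (u == 0).
Proof.
apply/eqP/eqP => [/eqP|->]; last first.
  by rewrite /dot big1 // => i _; rewrite mxE mul0r.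
rewrite psumr_eq0 => [/allP u0|i _]; last by rewrite -expr2 sqr_ge0.
apply/rowP => i; rewrite mxE; have := u0 i (mem_index_enum _).
by rewrite -expr2 sqrf_eq0 => /eqP.
Qed.

Lemma dot_gt0 u : (0 < dot u u) = (u != 0).
Proof. by rewrite lt_def dot_eq0 dot_ge0 andbT. Qed.

Lemma enorm_gt0 u : (0 < enorm u) = (u != 0).
Proof. by rewrite sqrtr_gt0 dot_gt0. Qed.

Lemma enormZ (a : R) u : 0 <= a -> enorm (a *: u) = a * enorm u.
Proof.
move=> a0; rewrite /enorm dotZl dotZr mulrA sqrtrM ?mulr_ge0 //.
by rewrite -expr2 sqrtr_sqr ger0_norm.
Qed.

Lemma sqr_enorm u : enorm u * enorm u = dot u u.
Proof. by rewrite -expr2 sqr_sqrtr ?dot_ge0. Qed.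

Lemma enorm_radial_proj y : y != 0 -> enorm (radial_proj y) = 1.
Proof.
rewrite -enorm_gt0 => y0.
by rewrite enormZ ?invr_ge0 1?ltW // mulVf // gt_eqF.
Qed.

Lemma radial_projZ (a : R) y : 0 < a -> radial_proj (a *: y) = radial_proj y.
Proof.
move=> a0; rewrite /radial_proj enormZ 1?ltW // invfM scalerA -mulrA mulrC.
by rewrite -mulrA mulfV ?mulr1 // gt_eqF.
Qed.

Lemma enorm_scale_radial_proj y : y != 0 -> enorm y *: radial_proj y = y.
Proof.
rewrite -enorm_gt0 => y0.
by rewrite scalerA mulfV ?scale1r // gt_eqF.
Qed.

End Euclid.

Lemma IVT_sign {R : realType} (f : R -> R) (a b : R) : a <= b ->
  {within `[a, b], continuous f} -> f a * f b < 0 ->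
  exists2 c, c \in `[a, b] & f c = 0.
Proof.
move=> ab cf fab; apply: IVT => //.
have [fa|fa|fa] := ltgtP (f a) 0; last by move: fab; rewrite fa mul0r ltxx.
  by move: fab; rewrite nmulr_rlt0 // => fb; rewrite ge_min le_max (ltW fa) (ltW fb) orbT.
by move: fab; rewrite pmulr_rlt0 // => fb; rewrite ge_min le_max (ltW fa) (ltW fb) orbT.
Qed.

(** * Rays from an interior point of a convex body *)

Section ConvexBody.
Context {R : realType}.
Variables M K : set 'rV[R]_3.
Hypothesis hM : smooth_convex_closed_surface M K.
Hypothesis h0 : K° 0.

Let closedK : closed K.
Proof.
by case: hM => cK _ _ _ _; apply: compact_closed cK; exact: norm_hausdorff.
Qed.

Lemma surfaceE : M = K `\` K°.
Proof.
by case: hM => _ _ _ -> _; rewrite -((closure_id K).1 closedK).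
Qed.

Lemma body_convex p q (t : R) : K p -> K q -> 0 <= t <= 1 ->
  K (t *: p + (1 - t) *: q).
Proof.
move=> Kp Kq /andP[t0 t1]; case: hM => _ cK _ _ _.
have := cK p q (Itv01 t0 t1) (mem_set Kp) (mem_set Kq).
by move/set_mem.
Qed.

Lemma body_inner_radius : exists2 d : R, 0 < d & forall z, `|z| < d -> K z.
Proof.
have : \forall z \near (0 : 'rV[R]_3), K z by exact: h0.
by move=> /near_dist[d d0 dP]; exists d => // z zd; apply: dP; rewrite subr0.
Qed.

(** The convex hull of [p] and the ball of radius [d] about 0 contains the ball of radius
    [(1 - t) d] about [t *: p]. *)
Lemma body_interior_cone d p (t : R) z : (forall z, `|z| < d -> K z) -> K p ->
  0 <= t < 1 -> `|z| < (1 - t) * d -> K° (t *: p + z).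
Proof.
move=> dK Kp /andP[t0 t1] zd.
have t1' : 0 < 1 - t by rewrite subr_gt0.
have e0 : 0 < (1 - t) * d - `|z| by rewrite subr_gt0.
suff : \forall w \near (t *: p + z), K w by [].
apply/near_dist; exists ((1 - t) * d - `|z|) => // w wd.
have -> : w = t *: p + (1 - t) *: ((1 - t)^-1 *: (w - t *: p)).
  by rewrite scalerA mulfV ?gt_eqF // scale1r addrC subrK.
apply: body_convex => //; last by rewrite t0 ltW.
apply: dK; rewrite normrZ gtr0_norm ?invr_gt0 // mulrC ltr_pdivrMr // mulrC.
have -> : w - t *: p = (w - (t *: p + z)) + z by rewrite opprD addrA subrK.
by apply: le_lt_trans (ler_normD _ _) _; rewrite -ltrBrDr.
Qed.

Lemma body_bounded : exists2 C : R, 0 < C & forall p, K p -> `|p| <= C.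
Proof.
have [cK _ _ _ _] := hM; have [C [_ CP]] := compact_bounded cK.
exists (`|C| + 1) => [|p Kp]; first by rewrite ltr_wpDl.
by apply: CP => //; rewrite (le_lt_trans (ler_norm C)) // ltrDl.
Qed.

Lemma surface_neq0 p : M p -> p != 0.
Proof.
by rewrite surfaceE => -[_ np]; apply/eqP => p0; apply: np; rewrite p0.
Qed.

Lemma body_interior_scale p (t : R) : K p -> 0 <= t < 1 -> K° (t *: p).
Proof.
move=> Kp t01; have [d d0 dK] := body_inner_radius.
rewrite -[t *: p]addr0; apply: (body_interior_cone dK Kp t01).
rewrite normr0; apply: mulr_gt0 d0.
by rewrite subr_gt0; case/andP: t01.
Qed.

(** For t < 1 the point [t *: p] is interior, hence off the surface; for t > 1 the roles of [p] and
    [t *: p] are exchanged. *)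
Lemma surface_ray_unique p (t : R) : M p -> 0 < t -> M (t *: p) -> t = 1.
Proof.
rewrite surfaceE => -[Kp np] t0 [Ktp ntp].
have [t1|t1|//] := ltgtP t 1; exfalso.
  by apply: (ntp (body_interior_scale Kp _)); rewrite (ltW t0) t1.
have ti : 0 <= t^-1 < 1 by rewrite invr_ge0 (ltW t0) (invf_lt1 t0) t1.
have := body_interior_scale Ktp ti.
rewrite scalerA (mulVf (lt0r_neq0 t0)) scale1r; exact: np.
Qed.

(** The ray leaves [K] at the supremum of the parameters with [t *: y] in [K]: closedness keeps that
    point in [K], and an interior point could be pushed further out. *)
Lemma surface_ray_exists y : y != 0 -> exists2 t : R, 0 < t & M (t *: y).
Proof.
move=> y0; have [d d0 dK] := body_inner_radius.
have [C C0 KC] := body_bounded.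
have ny : 0 < `|y| by rewrite normr_gt0.
pose S : set R := [set t | 0 <= t /\ K (t *: y)].
have K0 : K 0 by apply: dK; rewrite normr0.
have S0 : S 0 by split; rewrite ?scale0r.
have Sub t : S t -> t <= C / `|y|.
  move=> [t0 /KC]; rewrite normrZ ger0_norm // => ?.
  by rewrite ler_pdivlMr.
have hS : has_sup S by split; [exists 0|exists (C / `|y|) => t /Sub].
have supS t : S t -> t <= sup S by move=> St; apply: ub_le_sup St; case: hS.
have supd : 0 < sup S.
  have dy : 0 < d / (2 * `|y|) by rewrite divr_gt0 // mulr_gt0.
  apply: (lt_le_trans dy (supS _ _)); split; first exact: ltW.
  apply: dK; rewrite normrZ gtr0_norm // invfM mulrA mulfVK ?gt_eqF //.
  by rewrite ltr_pdivrMr // mulr2n mulrDr mulr1 ltrDl.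
exists (sup S) => //; rewrite surfaceE; split.
  apply: contrapT => nK.
  have : \forall z \near sup S *: y, ~ K z.
    by apply: open_nbhs_nbhs; split => //; exact: closed_openC.
  move=> /near_dist[e e0 eK].
  have [t St tS] := sup_adherent (divr_gt0 e0 ny) hS.
  apply: (eK (t *: y)); last by case: St.
  rewrite -scalerBl normrZ distrC ger0_norm ?subr_ge0 ?supS //.
  by rewrite -ltr_pdivlMr // ltrBlDr addrC -ltrBlDr.
move=> /near_dist[e e0 eK].
pose t := sup S + e / (2 * `|y|).
have ey : 0 < e / (2 * `|y|) by rewrite divr_gt0 // mulr_gt0.
have : S t.
  split; first by rewrite addr_ge0 // ltW.
  apply: eK; rewrite -scalerBl normrZ /t addrC addKr gtr0_norm //.
  rewrite invfM mulrA mulfVK ?gt_eqF //.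
  by rewrite ltr_pdivrMr // mulr2n mulrDr mulr1 ltrDl.
by move=> /supS; rewrite /t gerDl leNgt ey.
Qed.

(* The number t > 0 such that t *: y lies on M, so that the distance function at
   radial_proj y is ray_scale y * enorm y. *)
Definition ray_scale (y : 'rV[R]_3) : R :=
  enorm (phi0 M (radial_proj y)) / enorm y.

(** Rays meet the surface only once; this makes the partial inverse [phi0] cancel [radial_proj] on
    [M]. *)
Let radial_proj_inj : {in M &, injective radial_proj}.
Proof.
move=> p q /set_mem Mp /set_mem Mq pq.
have p0 := surface_neq0 Mp; have q0 := surface_neq0 Mq.
have pE : p = (enorm p / enorm q) *: q.
  by rewrite -{1}(enorm_scale_radial_proj p0) pq /radial_proj scalerA.
have t0 : 0 < enorm p / enorm q by rewrite divr_gt0 // enorm_gt0.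
move: pE t0; move: (_ / _) => t pE t0.
have t1 : t = 1 by apply: (surface_ray_unique Mq t0); rewrite -pE.
by rewrite pE t1 scale1r.
Qed.

Lemma phi0_radial_proj p : M p -> phi0 M (radial_proj p) = p.
Proof.
by move=> Mp; rewrite /phi0 pinvKV // inE.
Qed.

Lemma phi0_ray y (t : R) : y != 0 -> 0 < t -> M (t *: y) ->
  phi0 M (radial_proj y) = t *: y.
Proof.
by move=> y0 t0 /phi0_radial_proj <-; rewrite radial_projZ.
Qed.

Lemma ray_scale_unique y (t : R) : y != 0 -> 0 < t -> M (t *: y) ->
  ray_scale y = t.
Proof.
move=> y0 t0 Mty; rewrite /ray_scale (phi0_ray y0 t0 Mty) enormZ ?ltW //.
by rewrite mulfK // gt_eqF // enorm_gt0.
Qed.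

Lemma ray_scaleP y : y != 0 -> [/\ 0 < ray_scale y, M (ray_scale y *: y) &
  phi0 M (radial_proj y) = ray_scale y *: y].
Proof.
move=> y0; have [t t0 Mty] := surface_ray_exists y0.
by rewrite (ray_scale_unique y0 t0 Mty); split => //; exact: phi0_ray.
Qed.

(* If the ray through p were tangent to M, then F would take values of opposite
   signs at the points (1 - h) p + h e v and (1 - h) p - h e v for small h > 0.
   The segment between them lies in the interior of K, yet F has a zero on it. *)
Lemma surface_transversal p (U : set 'rV[R]_3) (F : 'rV[R]_3 -> R) :
  M p -> open U -> U p -> Cinf U F ->
  M `&` U = [set x | U x /\ F x = 0] ->
  (exists v, 'D_v F p != 0) -> 'D_p F p != 0.
Proof.
move=> Mp oU Up cF MU [v dv0]; apply/eqP => dp0.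
have [d d0 dK] := body_inner_radius.
have Kp : K p by move: Mp; rewrite surfaceE => -[].
have Fp0 : F p = 0.
  by have : (M `&` U) p by []; rewrite MU => -[].
(* Chosen so that [e * |v| < d]: the points [(1 - h) p + h th v] with |th| <= e are then interior by
   [body_interior_cone]. *)
pose e := d / (2 * (`|v| + 1)).
have v1 : 0 < `|v| + 1 by rewrite ltr_wpDl.
have e0 : 0 < e by rewrite divr_gt0 // mulr_gt0.
have ev : e * `|v| < d.
  rewrite /e mulrAC ltr_pdivrMr ?mulr_gt0 // ltr_pM2l //.
  by have := normr_ge0 v; lra.
have der a : 'D_(a *: v - p) F p = a * 'D_v F p.
  transitivity (a * 'D_v F p - 'D_p F p); last by rewrite dp0 subr0.
  rewrite !(derive_partials _ oU Up cF) mulr_sumr -sumrB.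
  by apply: eq_bigr => i _; rewrite !mxE mulrBl mulrA.
have lim a : (h^-1 * (F (h *: (a *: v - p) + p))) @[h --> (0 : R)^'] -->
    a * 'D_v F p.
  rewrite -der; have := cvg_derive (Cinf_derivable cF Up (v := a *: v - p)).
  by under eq_fun do rewrite Fp0 subr0.
have opp_sign : (e * 'D_v F p) * (- e * 'D_v F p) < 0.
  have -> : (e * 'D_v F p) * (- e * 'D_v F p) = - (e * 'D_v F p) ^+ 2 by ring.
  by rewrite oppr_lt0 exprn_even_gt0 //= mulf_neq0 // gt_eqF.
have near_sign := cvgr_lt _ (cvgM (lim e) (lim (- e))) _ opp_sign.
have [d1 d10 d1U] : exists2 d, 0 < d & forall z, `|z - p| < d -> U z.
  by apply/near_dist; exact: near_open oU Up _.
have n0 : 0 < `|p| + d by apply: ltr_wpDl.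
have near_U : \forall h \near (0 : R)^', `|h| * (`|p| + d) < d1 /\ `|h| < 1.
  suff : \forall h \near (0 : R), `|h| * (`|p| + d) < d1 /\ `|h| < 1.
    exact: nbhs_dnbhs.
  apply/near_dist; exists (Num.min (d1 / (`|p| + d)) 1) => [|h].
    by rewrite lt_min ltr01 divr_gt0.
  by rewrite subr0 lt_min ltr_pdivlMr // => /andP[].
pose good (h : R) := h^-1 * F (h *: (e *: v - p) + p) *
  (h^-1 * F (h *: (- e *: v - p) + p)) < 0 /\
  (`|h| * (`|p| + d) < d1 /\ `|h| < 1).
have [h h0' [hs [hd1 h1]]] : exists2 h : R, 0 < h & good h.
  have near_good : \forall h \near (0 : R)^', good h.
    by near=> h; split; near: h; [exact: near_sign|exact: near_U].
  have /near_dist[r r0 rP] : \forall h \near (0 : R), h != 0 -> good h.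
    exact: near_good.
  exists (r / 2); first by rewrite divr_gt0.
  apply: rP; last by rewrite gt_eqF // divr_gt0.
  by rewrite subr0 gtr0_norm ?divr_gt0 // ltr_pdivrMr // mulr2n mulrDr mulr1 ltrDl.
pose gam (th : R) := h *: (th *: v - p) + p.
have gamU th : `|th| <= e -> U (gam th) /\ K° (gam th).
  move=> the; have thv : `|th *: v| < d.
    by rewrite normrZ; apply: le_lt_trans ev; rewrite ler_wpM2r.
  split.
    apply: d1U; rewrite /gam addrK normrZ; apply: le_lt_trans hd1.
    rewrite ler_wpM2l //; apply: le_trans (ler_normB _ _) _.
    by rewrite addrC lerD2l ltW.
  have -> : gam th = (1 - h) *: p + h *: (th *: v).
    by apply/rowP => i; rewrite !mxE; ring.
  have h1' : h < 1 by rewrite -(gtr0_norm h0').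
  apply: (body_interior_cone dK Kp); first by rewrite subr_ge0 (ltW h1') gtrBl.
  by rewrite subKr normrZ (gtr0_norm h0') ltr_pM2l.
have cgam : {within `[- e, e], continuous (F \o gam)}.
  apply: continuous_in_subspaceT => th; rewrite inE /= in_itv /= => the.
  have [Uth _] := gamU th ltac:(by rewrite ler_norml).
  apply: continuous_comp; last exact: Cinf_continuous cF Uth.
  rewrite /gam; apply: cvgD; last exact: cvg_cst.
  apply: cvgZl_tmp; apply: cvgD; last exact: cvg_cst.
  by apply: cvgZr_tmp; exact: cvg_id.
have prod_neg : F (gam (- e)) * F (gam e) < 0.
  move: hs; rewrite mulrACA -expr2 mulrC pmulr_llt0 1?mulrC //.
  by rewrite exprn_gt0 // invr_gt0.
have [|th] := IVT_sign _ cgam prod_neg; first by rewrite ge0_cp // ltW.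
rewrite in_itv /= -ler_norml => /gamU[Uth Kth] Fth.
have : [set x | U x /\ F x = 0] (gam th) by [].
by rewrite -MU surfaceE => -[[_ /(_ Kth)]].
Unshelve. all: by end_near. Qed.

End ConvexBody.

Section PuncturedSpace.
Context {R : realType} {E : normedModType R}.

Lemma open_neq0 : open [set y : E | y != 0].
Proof.
rewrite openE => y /= y0; apply/near_dist; exists `|y|; first by rewrite normr_gt0.
move=> z zy; apply/eqP => z0; move: zy.
by rewrite z0 sub0r normrN ltxx.
Qed.

Lemma open_dist (U : set E) x : open U -> U x ->
  exists2 d : R, 0 < d & forall z, `|z - x| < d -> U z.
Proof. by move=> oU Ux; apply/near_dist; exact: near_open oU Ux _. Qed.

End PuncturedSpace.

Section ContinuousNear.
Context {R : realType} {E : normedModType R}.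

Lemma open_preimage (F : normedModType R) (U : set E) (V : set F) (g : E -> F) :
  open U -> open V -> (forall x, U x -> {for x, continuous g}) ->
  open [set x | U x /\ V (g x)].
Proof.
move=> oU oV cg; rewrite openE => x [Ux Vx]; apply/near_dist.
have [d1 d10 d1U] := open_dist oU Ux.
have [e e0 eV] := open_dist oV Vx.
have [d2 d20 d2P] := (continuous_dist _ _).1 (cg x Ux) e e0.
exists (Num.min d1 d2) => [|z]; first by rewrite lt_min d10.
by rewrite lt_min => /andP[/d1U ? /d2P /eV].
Qed.

Lemma continuous_scale (a : R) (x : E) : {for x, continuous (fun y : E => a *: y)}.
Proof. by apply: cvgZ; [exact: cvg_cst|exact: cvg_id]. Qed.

Lemma continuous_scalel (y : E) (t : R) : {for t, continuous (fun t : R => t *: y)}.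
Proof. by apply: cvgZ; [exact: cvg_id|exact: cvg_cst]. Qed.

Lemma continuous_near_lt0 (f : E -> R) x : {for x, continuous f} -> f x < 0 ->
  exists2 d : R, 0 < d & forall z, `|z - x| < d -> f z < 0.
Proof.
move=> cf fx; have nf : 0 < - f x by rewrite oppr_gt0.
have [d d0 dP] := (continuous_dist _ _).1 cf _ nf.
exists d => // z /dP; rewrite ltr_norml => /andP[_].
by rewrite ltrBlDr addrC subrr.
Qed.

(** Near 0 the difference quotient stays within half of |'D_v f p| of ['D_v f p], so it has the same
    sign on both sides; multiplication by [h] and [- h] gives opposite signs. *)
Lemma sign_change (f : E -> R) (p v : E) : derivable f p v -> f p = 0 ->
  'D_v f p != 0 -> exists2 d : R, 0 < d & forall h, 0 < h -> h < d ->
    f (h *: v + p) * f (- h *: v + p) < 0.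
Proof.
move=> df fp dv0.
have half0 : 0 < `|'D_v f p| / 2 by rewrite divr_gt0 // normr_gt0.
have /cvgrPdist_lt/(_ _ half0) near_d := cvg_derive df.
have /near_dist[d d0 dP] : \forall h \near (0 : R), h != 0 ->
    `|'D_v f p - h^-1 * (f (h *: v + p) - f p)| < `|'D_v f p| / 2.
  exact: near_d.
exists d => // h h0 hd.
have h1 := dP h _ (lt0r_neq0 h0); have h2 := dP (- h) _ _.
move: h1 h2; rewrite fp !subr0 normrN gtr0_norm // oppr_eq0 => /(_ hd) h1.
move=> /(_ hd (lt0r_neq0 h0)); move: h1.
move: ('D_v f p) (f (h *: v + p)) (f (- h *: v + p)) => D a b.
rewrite invrN mulNr => h1 h2.
have ha : a = h * (h^-1 * a) by rewrite mulrA mulfV ?mul1r ?lt0r_neq0.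
have hb : b = h * (h^-1 * b) by rewrite mulrA mulfV ?mul1r ?lt0r_neq0.
move: (h^-1 * a) (h^-1 * b) ha hb h1 h2 => a' b' -> ->.
rewrite mulrACA pmulr_rlt0 ?mulr_gt0 //.
have [D0|D0] := leP 0 D.
  rewrite (ger0_norm D0) !ltr_norml => /andP[_ ?] /andP[_ ?].
  by rewrite pmulr_rlt0; lra.
rewrite (ltr0_norm D0) !ltr_norml => /andP[? _] /andP[? _].
by rewrite nmulr_rlt0; lra.
Qed.

End ContinuousNear.

(** * Smoothness of the radial function *)

Section RayScale.
Context {R : realType}.
Variables M K : set 'rV[R]_3.
Hypothesis hM : smooth_convex_closed_surface M K.
Hypothesis h0 : K° 0.

Local Notation lam := (ray_scale M).

(** Convexity upgrades a nonzero gradient to a nonzero derivative in the radial direction [x]. *)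
Lemma surface_chart p : M p -> exists (U : set 'rV[R]_3) (F : 'rV[R]_3 -> R),
  [/\ open U, U p, Cinf U F, forall x, U x -> (M x <-> F x = 0) &
      forall x, U x -> M x -> 'D_x F x != 0].
Proof.
move=> Mp; have [_ _ _ _ sM] := hM.
have [U [F [oU Up sF MU dF]]] := sM p Mp.
have cF := (smooth_on_open_Cinf U F).1 sF.
exists U, F; split=> // [x Ux|x Ux Mx]; last first.
  exact (surface_transversal hM h0 Mx oU Ux cF MU (dF x Ux Mx)).
split=> [Mx|Fx].
  by have : (M `&` U) x by []; rewrite MU => -[].
have : [set x | U x /\ F x = 0] x by [].
by rewrite -MU => -[].
Qed.

Lemma ray_scale_chart_derive (U : set 'rV[R]_3) (F : 'rV[R]_3 -> R) y :
  open U -> Cinf U F -> (forall x, U x -> M x -> 'D_x F x != 0) -> y != 0 ->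
  U (lam y *: y) -> 'D_y F (lam y *: y) != 0.
Proof.
move=> oU cF dF y0 Uy; have [l0 My _] := ray_scaleP hM h0 y0.
have := dF _ Uy My; rewrite !(derive_partials _ oU Uy cF).
have -> : \sum_i (lam y *: y) 0 i * 'D_(delta_mx 0 i) F (lam y *: y) =
    lam y * \sum_i y 0 i * 'D_(delta_mx 0 i) F (lam y *: y).
  by rewrite mulr_sumr; apply: eq_bigr => i _; rewrite !mxE mulrA.
by rewrite mulf_eq0 negb_or => /andP[].
Qed.

(** By transversality [F] has opposite signs at [(lam y0 + h) *: y0] and [(lam y0 - h) *: y0], and
    this persists for [y] near [y0]. The intermediate value theorem gives a point of [M] on the ray
    of [y] with parameter within [h] of [lam y0]; by uniqueness this parameter is [lam y]. *)
Lemma ray_scale_continuous y0 : y0 != 0 -> {for y0, continuous lam}.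
Proof.
move=> yn0; apply/continuous_dist => eps eps0.
have [l0 My _] := ray_scaleP hM h0 yn0.
have [U [F [oU Up cF MU dF]]] := surface_chart My.
have Dy := ray_scale_chart_derive oU cF dF yn0 Up.
have Fp : F (lam y0 *: y0) = 0 by exact/MU.
have [d d0 sgn] := sign_change (Cinf_derivable cF Up) Fp Dy.
have [d1 d10 d1U] := open_dist oU Up.
have ny : 0 < `|y0| by rewrite normr_gt0.
(* The four bounds serve, in order, the sign change, the accuracy [eps], positivity of the
   parameters in [[lam y0 - h, lam y0 + h]], and membership in the chart. *)
pose h := Num.min (Num.min (d / 2) (eps / 2)) (Num.min (lam y0 / 2) (d1 / 2 / `|y0|)).
have hh : [/\ 0 < h, h < d, h < eps, h < lam y0 & h * `|y0| <= d1 / 2].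
  have half (a : R) : 0 < a -> 0 < a / 2 /\ a / 2 < a by lra.
  have [d2 d2'] := half d d0; have [e2 e2'] := half eps eps0.
  have [l2 l2'] := half _ l0; have [D2 D2'] := half _ d10.
  split; rewrite /h.
  - by rewrite !lt_min d2 e2 l2 divr_gt0.
  - by apply: le_lt_trans d2'; rewrite !ge_min lexx.
  - by apply: le_lt_trans e2'; rewrite !ge_min lexx orbT.
  - by apply: le_lt_trans l2'; rewrite !ge_min lexx !orbT.
  - by rewrite -ler_pdivlMr // !ge_min lexx !orbT.
case: hh; move: (h) => {}h hp hd heps hl hy.
have inU (t : R) y : `|t - lam y0| <= h -> `|y - y0| < d1 / 2 / (2 * lam y0) ->
    U (t *: y).
  move=> tl yy; apply: d1U.
  have -> : t *: y - lam y0 *: y0 = t *: (y - y0) + (t - lam y0) *: y0.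
    by apply/rowP => i; rewrite !mxE; ring.
  apply: le_lt_trans (ler_normD _ _) _; rewrite !normrZ.
  rewrite (splitr d1) ltr_leD //; last first.
    by apply: le_trans hy; rewrite ler_wpM2r.
  apply: (@le_lt_trans _ _ (2 * lam y0 * `|y - y0|)).
    rewrite ler_wpM2r //; have : `|t| <= `|t - lam y0| + `|lam y0|.
      by rewrite -{1}(subrK (lam y0) t) ler_normD.
    rewrite (gtr0_norm l0); lra.
  by rewrite mulrC -ltr_pdivlMr // mulr_gt0.
pose G (y : 'rV[R]_3) := F ((lam y0 + h) *: y) * F ((lam y0 - h) *: y).
have Gy0 : G y0 < 0.
  have := sgn h hp hd; rewrite /G !scalerDl scaleNr.
  by rewrite (addrC (h *: y0)) (addrC (- (h *: y0))).
have cG : {for y0, continuous G}.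
  have cs (a : R) : `|a - lam y0| <= h -> {for y0, continuous (fun y : 'rV[R]_3 => F (a *: y))}.
    move=> al; apply: continuous_comp; first exact: continuous_scale.
    apply: Cinf_continuous cF _; apply: inU => //.
    by rewrite subrr normr0 !divr_gt0 // mulr_gt0.
  have c1 : `|lam y0 + h - lam y0| <= h by rewrite addrC addKr gtr0_norm.
  have c2 : `|lam y0 - h - lam y0| <= h by rewrite addrC addKr normrN gtr0_norm.
  exact: cvgM (cs _ c1) (cs _ c2).
have [d2 d20 d2P] := continuous_near_lt0 cG Gy0.
have [d3 d30 d3P] := open_dist open_neq0 yn0.
exists (Num.min d2 (Num.min d3 (d1 / 2 / (2 * lam y0)))) => [|y].
  by rewrite !lt_min d20 d30 !divr_gt0 // mulr_gt0.
rewrite !lt_min => /and3P[/d2P Gy /d3P /= yne0 yU].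
have cF' : {within `[lam y0 - h, lam y0 + h], continuous (fun t : R => F (t *: y))}.
  apply: continuous_in_subspaceT => t; rewrite inE /= in_itv /= => tI.
  apply: continuous_comp; first exact: continuous_scalel.
  apply: Cinf_continuous cF _; apply: inU => //.
  by rewrite ler_distl.
have [||t] := IVT_sign _ cF'.
- by lra.
- by rewrite mulrC.
rewrite in_itv /= => tI Ft.
have tl : `|t - lam y0| <= h by rewrite ler_distl.
have t0 : 0 < t by case/andP: tI => ? _; lra.
have Mty : M (t *: y) by apply/(MU _ (inU _ _ tl yU)).
by rewrite (ray_scale_unique hM h0 yne0 t0 Mty); exact: le_lt_trans heps.
Qed.

(* Implicit differentiation of F (lam y *: y) = 0. *)
Lemma ray_scale_is_derive (U : set 'rV[R]_3) (F : 'rV[R]_3 -> R) y v :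
  open U -> Cinf U F -> (forall x, U x -> (M x <-> F x = 0)) ->
  (forall x, U x -> M x -> 'D_x F x != 0) -> y != 0 -> U (lam y *: y) ->
  is_derive y v lam
    (- lam y * ('D_v F (lam y *: y) * ('D_y F (lam y *: y))^-1)).
Proof.
move=> oU cF MU dF y0 Uy.
have Dy := ray_scale_chart_derive oU cF dF y0 Uy.
have cl := ray_scale_continuous y0.
set p := lam y *: y in Uy Dy *.
have [|i|c [cc /near_dist[r r0 rP]]] := @caratheodory _ _ F p.
- by apply: near_open oU Uy _ => z Uz i; exact: Cinf_derivable cF Uz.
- exact: Cinf_continuous (Cinf_derive _ cF) Uy.
pose yh (h : R) := h *: v + y; pose bh h := lam (yh h) *: yh h.
have yh0 : yh 0 = y by rewrite /yh scale0r add0r.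
have bh0 : bh 0 = p by rewrite /bh yh0.
have cyh : {for 0, continuous yh} by exact: cvg_line.
have cbh : {for 0, continuous bh}.
  apply: cvgZ; last exact: cyh.
  by apply: (continuous_comp cyh); rewrite yh0.
pose A h := \sum_i c i (bh h) * (yh h) 0 i.
pose B h := \sum_i c i (bh h) * v 0 i.
have cci i : {for 0, continuous (fun h => c i (bh h))}.
  by apply: (continuous_comp cbh); rewrite bh0; have [] := cc i.
have cA : {for 0, continuous A}.
  apply: cvg_big => [|i _]; first exact: add_continuous.
  apply: cvgM; first exact: cci.
  exact: ((continuous_coord _ _).1 cyh).
have cB : {for 0, continuous B}.
  apply: cvg_big => [|i _]; first exact: add_continuous.
  by apply: cvgM; [exact: cci|exact: cvg_cst].
have A0 : A 0 = 'D_y F p.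
  rewrite (derive_partials _ oU Uy cF) /A bh0 yh0; apply: eq_bigr => i _.
  by rewrite mulrC; have [_ ->] := cc i.
have B0 : B 0 = 'D_v F p.
  rewrite (derive_partials _ oU Uy cF) /B bh0; apply: eq_bigr => i _.
  by rewrite mulrC; have [_ ->] := cc i.
rewrite -A0 -B0; apply: is_derive_cvg.
apply: (@cvg_trans _ ((- lam y * (B h * (A h)^-1)) @[h --> (0 : R)^'])); last first.
  apply: cvg_within_filter; apply: cvgM; first exact: cvg_cst.
  by apply: cvgM => //; apply: cvgV => //; rewrite A0.
have M0 h : yh h != 0 -> M (bh h) by move=> /(ray_scaleP hM h0)[].
have Fp : F p = 0 by apply/MU => //; have [] := ray_scaleP hM h0 y0.
have [d1 d10 d1U] := open_dist oU Uy.
have rd0 : 0 < Num.min r d1 by rewrite lt_min r0.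
have [d2 d20 d2P] := (continuous_dist _ _).1 cbh _ rd0.
have nA : 0 < `|A 0| by rewrite normr_gt0 A0.
have [d3 d30 d3P] := (continuous_dist _ _).1 cA _ nA.
have [e e0 eP] := open_dist open_neq0 y0.
have [d4 d40 d4P] := (continuous_dist _ _).1 cyh _ e0.
apply: near_eq_cvg.
suff H : \forall h \near (0 : R), h != 0 ->
    - lam y * (B h * (A h)^-1) = h^-1 * (lam (h *: v + y) - lam y).
  exact: H.
apply/near_dist; exists (Num.min d2 (Num.min d3 d4)) => [|h].
  by rewrite !lt_min d20 d30.
rewrite !lt_min => /and3P[/d2P + /d3P Ah /d4P]; rewrite bh0 yh0 => + /eP yhn0 hn0.
rewrite lt_min => /andP[/rP + /d1U Ub].
have -> : F (bh h) = 0 by apply/(MU _ Ub); exact: M0.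
rewrite Fp subrr => sum0.
have An0 : A h != 0.
  by apply/eqP => Ah0; move: Ah; rewrite Ah0 sub0r normrN ltxx.
(* Here [bh h - p = (lam (yh h) - lam y) *: yh h + (lam y * h) *: v], and the slopes of [F]
   annihilate this vector because [F] vanishes at both points of [M]. *)
have key : (lam (yh h) - lam y) * A h = - (lam y * (h * B h)).
  apply/eqP; rewrite -subr_eq0 opprK; apply/eqP.
  rewrite [RHS]sum0 /A /B !mulr_sumr -big_split.
  by apply: eq_bigr => i _; rewrite /bh /p /yh !mxE /=; ring.
rewrite -[h *: v + y]/(yh h); move: (lam _) (lam y) (A h) (B h) An0 key.
move=> l' l a b an0 key; have -> : l' - l = - (l * (h * b)) / a.
  by rewrite -key mulfK.
by field; rewrite hn0 an0.
Qed.

(** Bootstrap: [ray_scale_is_derive] expresses a derivative of [lam] through [lam] itself and smooth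
    functions, so class C^k gives class C^(k+1). On [W] a single chart contains the surface points
    of all rays. *)
Lemma ray_scale_smooth : Cinf [set y | y != 0] lam.
Proof.
move=> k; apply: Ck_local => y yn0.
have [l0 My _] := ray_scaleP hM h0 yn0.
have [U [F [oU Uy cF MU dF]]] := surface_chart My.
pose W := [set y | y != 0 /\ U (lam y *: y)].
have oW : open W.
  apply: (open_preimage (g := fun x => lam x *: x) open_neq0 oU).
  by move=> x xn0; exact: cvgZ (ray_scale_continuous xn0) (@cvg_id _ _).
exists W; split=> //; elim: k => [|k IH].
  by split=> // x [xn0 _]; exact: ray_scale_continuous.
split=> [x [xn0 _]|v]; first exact: ray_scale_continuous.
have der x (Wx : W x) := ray_scale_is_derive v oU cF MU dF Wx.1 Wx.2.
split=> [x Wx|]; first by have [] := der x Wx.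
have comp f : Cinf U f -> Ck k W (fun y => f (lam y *: y)).
  move=> cf; apply: (@Ck_comp _ _ _ k U W f (fun y => lam y *: y)) => //.
  - by move=> x [].
  - move=> i; apply: (@Ck_eq _ _ _ _ (fun x : 'rV[R]_3 => lam x * x 0 i)) => //.
      by move=> x _; rewrite mxE.
    by apply: Ck_mul => //; exact: Ck_coord.
have cy : Ck k W (fun y => 'D_y F (lam y *: y)).
  apply: (@Ck_eq _ _ _ _
    (fun y : 'rV[R]_3 => \sum_i y 0 i * 'D_(delta_mx 0 i) F (lam y *: y))) => //.
    by move=> x [_ Ux]; rewrite (derive_partials _ oU Ux cF).
  apply: Ck_sum => // i _; apply: Ck_mul => //; first exact: Ck_coord.
  exact: (comp _ (Cinf_derive _ cF)).
have cv := comp _ (Cinf_derive v cF).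
have cn x : W x -> 'D_x F (lam x *: x) != 0.
  by move=> [xn0 Ux]; exact: (ray_scale_chart_derive oU cF dF xn0 Ux).
have H := Ck_mul oW (Ck_opp oW IH) (Ck_mul oW cv (Ck_inv oW cn cy)).
by apply: Ck_eq H => // x Wx; have [_ ->] := der x Wx.
Qed.

End RayScale.

(** * Functions on a product and their partial maps *)

Section Slices.
Context {R : realType} {E : normedModType R}.
Implicit Types (F : R * E -> R) (t : R) (y v : E).

Let growth2 F t y v :
  (fun h : R => h^-1 *: (((fun y => F (t, y)) \o shift y) (h *: v) - F (t, y))) =
  (fun h : R => h^-1 *: ((F \o shift (t, y)) (h *: (0, v)) - F (t, y))).
Proof.
apply/funext => h; congr (_ *: (F _ - _)).
by congr pair; rewrite /= scaler0 add0r.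
Qed.

Let growth1 F t y (a : R) :
  (fun h : R => h^-1 *: (((fun t => F (t, y)) \o shift t) (h *: a) - F (t, y))) =
  (fun h : R => h^-1 *: ((F \o shift (t, y)) (h *: (a, 0)) - F (t, y))).
Proof.
apply/funext => h; congr (_ *: (F _ - _)).
by congr pair; rewrite /= scaler0 add0r.
Qed.

Lemma derive_slice2 F t y v : 'D_v (fun y => F (t, y)) y = 'D_(0, v) F (t, y).
Proof. by rewrite /derive growth2. Qed.

Lemma derivable_slice2 F t y v :
  derivable F (t, y) (0, v) -> derivable (fun y => F (t, y)) y v.
Proof. by rewrite /derivable growth2. Qed.

Lemma derive_slice1 F t y (a : R) :
  'D_a (fun t => F (t, y)) t = 'D_(a, 0) F (t, y).
Proof. by rewrite /derive growth1. Qed.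

Lemma derivable_slice1 F t y (a : R) :
  derivable F (t, y) (a, 0) -> derivable (fun t => F (t, y)) t a.
Proof. by rewrite /derivable growth1. Qed.

Lemma Cinf_fst (U : set (R * E)) : Cinf U (fun z : R * E => z.1).
Proof.
move=> k; apply: (@Ck_affine _ _ k U _ (fun z => z.1)) => [x|h v x].
  exact: cvg_fst.
reflexivity.
Qed.

End Slices.

Lemma Cinf_snd {R : realType} (U : set (R * R)) : Cinf U (fun z : R * R => z.2).
Proof.
move=> k; apply: (@Ck_affine _ _ k U _ (fun z => z.2)) => [x|h v x].
  exact: cvg_snd.
reflexivity.
Qed.

(** * The Poincare lemma on the punctured space *)

Section IntegralOverUnitInterval.
Context {R : realType}.
Local Notation mu := (@lebesgue_measure R).

Lemma within_continuous_segment (f : R -> R) (a b : R) :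
  (forall t : R, a <= t <= b -> {for t, continuous f}) ->
  {within `[a, b], continuous f}.
Proof.
move=> cf; apply: continuous_in_subspaceT => t.
by rewrite inE /= in_itv /= => /cf.
Qed.

(** The constant [C] is the dominating function for differentiation under the integral sign. *)
Lemma is_derive_Rintegral (f : R -> R -> R) (d C : R) : 0 < d ->
  (forall x t, `|x| < d -> 0 <= t <= 1 -> {for t, continuous (f x)}) ->
  (forall x t, `|x| < d -> 0 <= t <= 1 -> derivable (f ^~ t) x 1) ->
  (forall x t, `|x| < d -> 0 <= t <= 1 -> `|'D_1 (f ^~ t) x| <= C) ->
  is_derive (0 : R) (1 : R) (fun x => \int[mu]_(t in `[0, 1]) f x t)
    (\int[mu]_(t in `[0, 1]) 'D_1 (f ^~ t) 0).
Proof.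
move=> d0 cf df bf.
have I01 (t : R) : `[0, 1]%classic t -> 0 <= t <= 1 by rewrite /= in_itv.
have Id (x : R) : `]- d, d[%classic x -> `|x| < d by rewrite /= in_itv /= ltr_norml.
have C0 : 0 <= C.
  by apply: le_trans (bf 0 0 _ _) => //; rewrite ?normr0 ?lexx ?ler01.
have m01 : measurable (`[0, 1]%classic : set (measurableTypeR R)) by [].
have I0 : `]- d, d[%classic (0 : R) by rewrite /= in_itv /= oppr_lt0 d0.
have intf x : `]- d, d[%classic x -> mu.-integrable `[0, 1] (EFin \o f x).
  move=> /Id xd; apply: continuous_compact_integrable; first exact: segment_compact.
  by apply: within_continuous_segment => t; exact: cf.
have intC : mu.-integrable `[0, 1] (EFin \o (fun=> C)).
  apply: continuous_compact_integrable; first exact: segment_compact.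
  by apply: within_continuous_segment => t _; exact: cst_continuous.
have derf x t : `]- d, d[%classic x -> `[0, 1]%classic t -> derivable (f ^~ t) x 1.
  by move=> /Id xd /I01; exact: df.
have ubf x t : `]- d, d[%classic x -> `[0, 1]%classic t ->
    `|partial1of2 f x t| <= C.
  by move=> /Id xd /I01 t01; rewrite partial1of2E; exact: bf.
have dF := derivable_under_integral (mu := mu) m01 I0 intf derf (fun=> C0) intC ubf.
have := differentiation_under_integral (mu := mu) m01 I0 intf derf (fun=> C0) intC ubf.
rewrite derive1E => eF; split; first exact: dF.
rewrite [LHS]eF.
by apply: eq_Rintegral => t _; rewrite partial1of2E.
Qed.

Lemma Rintegral_derive (F f : R -> R) :
  (forall t : R, 0 <= t <= 1 -> is_derive t (1 : R) F (f t)) ->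
  (forall t : R, 0 <= t <= 1 -> {for t, continuous f}) ->
  \int[mu]_(t in `[0, 1]) f t = F 1 - F 0.
Proof.
move=> dF cf.
have cF (t : R) : 0 <= t <= 1 -> {for t, continuous F}.
  move=> /dF ?; apply: differentiable_continuous.
  by apply/derivable1_diffP; exact: ex_derive.
have cwf := within_continuous_segment cf.
have dFo : derivable_oo_LRcontinuous F 0 1.
  split.
  - move=> t; rewrite in_itv /= => /andP[t0 t1].
    by have [] := dF t; rewrite ?(ltW t0) ?(ltW t1).
  - by apply: cvg_at_right_filter; apply: cF; rewrite lexx ler01.
  - by apply: cvg_at_left_filter; apply: cF; rewrite lexx ler01.
have dFe : {in `]0, 1[, derive1 F =1 f}.
  move=> t; rewrite in_itv /= => /andP[t0 t1]; rewrite derive1E.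
  by have [] := dF t; rewrite ?(ltW t0) ?(ltW t1).
by rewrite /Rintegral (continuous_FTC2 ltr01 cwf dFo dFe).
Qed.

End IntegralOverUnitInterval.

Section Poincare.
Context {R : realType} {n : nat}.
Local Notation mu := (@lebesgue_measure R).
Local Notation e i := (delta_mx 0 i : 'rV[R]_n).
Variables (U : set 'rV[R]_n) (p : 'rV[R]_n) (alpha : 'I_n -> 'rV[R]_n -> R).
Hypothesis oU : open U.
Hypothesis starU : forall y (t : R), U y -> 0 <= t <= 1 -> U (p + t *: (y - p)).
Hypothesis smooth_alpha : forall i, Cinf U (alpha i).
Hypothesis closed_alpha : forall i j y, U y ->
  'D_(e i) (alpha j) y = 'D_(e j) (alpha i) y.

(** The line integral of the 1-form \sum_i alpha_i dy_i along the segment from [p] to [y]. *)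
Definition star_primitive (y : 'rV[R]_n) : R :=
  \int[mu]_(t in `[0, 1]) \sum_i alpha i (p + t *: (y - p)) * (y - p) 0 i.

Section Variation.
Variables (y v : 'rV[R]_n).
Hypothesis Uy : U y.

(** In [z = (x, t)] the first entry moves the endpoint to [y + x v], and the second is the parameter
    on the segment from [p] to that endpoint. *)
Let m i (z : R * R) : R := y 0 i + z.1 * v 0 i - p 0 i.
Let g (z : R * R) : 'rV[R]_n := p + z.2 *: (y + z.1 *: v - p).
Let V := [set z | [set: R * R] z /\ U (g z)].

Let gE z i : g z 0 i = p 0 i + z.2 * m i z.
Proof. by rewrite /g /m !mxE. Qed.

Let Cinf_m W i : open W -> Cinf W (m i).
Proof.
move=> oW; apply: Cinf_add => //; last exact: Cinf_cst.
apply: Cinf_add => //; first exact: Cinf_cst.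
by apply: Cinf_mul => //; [exact: Cinf_fst|exact: Cinf_cst].
Qed.

Let Cinf_g W i : open W -> Cinf W (fun z => g z 0 i).
Proof.
move=> oW; apply: (@Cinf_eq _ _ _ (fun z : R * R => p 0 i + z.2 * m i z) _ oW).
  by move=> z _; rewrite gE.
apply: Cinf_add => //; first exact: Cinf_cst.
by apply: Cinf_mul => //; [exact: Cinf_snd|exact: Cinf_m].
Qed.

Let oV : open V.
Proof.
apply: (open_preimage (@openT _) oU) => z Tz; apply/continuous_coord => i.
exact: Cinf_continuous (Cinf_g i (@openT _)) Tz.
Qed.

Let a i z := alpha i (g z).

Let Cinf_a i : Cinf V (a i).
Proof.
apply: (@Cinf_comp _ _ _ U V (alpha i) g) => // [z []//|j]; exact: Cinf_g.
Qed.

Let f z := \sum_i a i z * m i z.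

Let Cinf_f : Cinf V f.
Proof. by apply: Cinf_sum => // i _; apply: Cinf_mul => //; exact: Cinf_m. Qed.

Let b z := \sum_i v 0 i * a i z.

Let Cinf_b : Cinf V b.
Proof. by apply: Cinf_sum => // i _; apply: Cinf_mul => //; exact: Cinf_cst. Qed.

Let derive_a i z w : V z ->
  'D_w (a i) z = \sum_k 'D_(e k) (alpha i) (g z) * 'D_w (fun z => g z 0 k) z.
Proof.
move=> [_ Uz]; have [|_ //] := @Cinf_chain _ _ _ U (alpha i) g z w oU Uz (smooth_alpha i).
by move=> k; exact: (Cinf_derivable (Cinf_g k (@openT _)) I).
Qed.

Let derive_m i z w : 'D_w (m i) z = w.1 * v 0 i.
Proof.
have [|_ //] := @is_derive_affine _ _ (m i) (fun w => w.1 * v 0 i) z w.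
by move=> h w' x; rewrite /m /= -[h *: w'.1]/(h * w'.1); ring.
Qed.

Let derive_g i z w : 'D_w (fun z => g z 0 i) z = w.2 * m i z + z.2 * (w.1 * v 0 i).
Proof.
have -> : (fun z => g z 0 i) = (fun z : R * R => p 0 i + z.2 * m i z).
  by apply/funext => z'; rewrite gE.
have d2 : is_derive z w (fun z : R * R => z.2) w.2.
  exact: is_derive_affine.
have dm : derivable (m i) z w by exact: (Cinf_derivable (Cinf_m i (@openT _)) I).
have dc : derivable (fun=> p 0 i) z w by exact: derivable_const.
have d2m := derivable_mul (@ex_derive _ _ _ _ _ _ _ d2) dm.
rewrite [LHS](derive_add dc d2m) derive_constant add0r.
rewrite [LHS](derive_mul (@ex_derive _ _ _ _ _ _ _ d2) dm) derive_m.
by have [_ ->] := d2.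
Qed.

Let derive_f z : V z ->
  'D_(1, 0) f z = 'D_(0, 1) (fun z : R * R => z.2 * b z) z.
Proof.
move=> Vz; have [_ Uz] := Vz.
have da i w := Cinf_derivable (Cinf_a i) Vz (v := w).
have dm i w : derivable (m i) z w by exact: (Cinf_derivable (Cinf_m i (@openT _)) I).
have dam i w := derivable_mul (da i w) (dm i w).
have dc i w : derivable (fun=> v 0 i) z w by exact: derivable_const.
have dca i w := derivable_mul (dc i w) (da i w).
have d2 : is_derive z (0, 1) (fun z : R * R => z.2) 1.
  exact: (@is_derive_affine _ _ (fun z : R * R => z.2) (fun w => w.2) z (0, 1)).
have [dd2 e2] := d2.
have dba : derivable b z (0, 1) by exact: Cinf_derivable Cinf_b Vz.
rewrite [RHS](derive_mul dd2 dba) e2 mul1r /b.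
rewrite [in RHS]derive_sumf; last by move=> i; exact: dca.
rewrite /f derive_sumf; last by move=> i; exact: dam.
under eq_bigr do rewrite (derive_mul (da _ _) (dm _ _)) derive_m mul1r.
rewrite big_split /= addrC; congr (_ + _).
  by apply: eq_bigr => i _; rewrite mulrC.
rewrite mulr_sumr.
(* Closedness exchanges the index of the form with that of differentiation, whence the transposition
   of the double sum. *)
transitivity (\sum_i \sum_k z.2 * (v 0 i * ('D_(e k) (alpha i) (g z) * m k z))).
  rewrite exchange_big; apply: eq_bigr => i _.
  rewrite derive_a // mulr_suml; apply: eq_bigr => k _.
  by rewrite derive_g /= (closed_alpha _ _ Uz); ring.
apply: eq_bigr => i _.
rewrite (derive_mul (dc _ _) (da _ _)) derive_constant mul0r add0r derive_a //.
rewrite !mulr_sumr; apply: eq_bigr => k _.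
by rewrite derive_g /=; ring.
Qed.

(** The bound on [x] is closed, so that the parameter rectangle is compact and the derivative of the
    integrand is bounded on it. *)
Let radius : exists2 d : R, 0 < d & forall x t, `|x| <= d -> 0 <= t <= 1 -> V (x, t).
Proof.
have [r r0 rU] := open_dist oU Uy.
have v0 : 0 < `|v| + 1 by rewrite ltr_wpDl.
exists (r / (2 * (`|v| + 1))) => [|x t xr t01]; first by rewrite divr_gt0 // mulr_gt0.
split=> //; rewrite /g; apply: starU => //; apply: rU.
rewrite /= addrC addKr normrZ; apply: (@le_lt_trans _ _ (r / 2)); last first.
  by rewrite ltr_pdivrMr // mulr2n mulrDr mulr1 ltrDl.
apply: le_trans (ler_wpM2r (normr_ge0 v) xr) _.
rewrite mulrAC ler_pdivrMr ?mulr_gt0 //.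
have -> : r / 2 * (2 * (`|v| + 1)) = r * (`|v| + 1) by field.
by rewrite ler_pM2l // lerDl.
Qed.

(* By closedness the derivative of the integrand in the direction v is the
   t-derivative of t * \sum_i v_i alpha_i (p + t (y - p)), see derive_f. *)
Lemma star_primitive_is_derive :
  is_derive y v star_primitive (\sum_i v 0 i * alpha i y).
Proof.
have [d d0 dV] := radius.
have dV' x t : `|x| < d -> 0 <= t <= 1 -> V (x, t) by move=> /ltW; exact: dV.
pose F x t := f (x, t).
pose A := `[- d, d]%classic `*` `[(0 : R), 1]%classic.
have cA : compact A by apply: compact_setX; exact: segment_compact.
have cont2 (h : R * R -> R) x t : Cinf V h -> V (x, t) ->
    {for t, continuous (fun t => h (x, t))}.
  move=> ch Vz.
  have cpair : {for t, continuous (fun t : R => (x, t))}.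
    have -> : (fun t : R => (x, t)) = (fun t : R => t *: ((0, 1) : R * R) + (x, 0)).
      apply/funext => u; congr pair; first by rewrite /= scaler0 add0r.
      by rewrite /= [u%:A]mulr1 addr0.
    exact: cvg_line.
  apply: (continuous_comp cpair); exact: Cinf_continuous ch Vz.
have [C CP] : exists C, forall z, A z -> `|'D_(1, 0) f z| <= C.
  have cD : {within A, continuous ('D_(1, 0) f)}.
    apply: continuous_in_subspaceT => -[x t]; rewrite inE => -[/= xd t01].
    apply: Cinf_continuous (Cinf_derive _ Cinf_f) _.
    by apply: dV; [rewrite ler_norml; rewrite in_itv in xd|rewrite in_itv in t01].
  have [C [_ CP]] := compact_bounded (continuous_compact cD cA).
  exists (`|C| + 1) => z Az; apply: CP; last by exists z.
  by rewrite (le_lt_trans (ler_norm C)) // ltrDl.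
have H := @is_derive_Rintegral R F d C d0.
have {}H : is_derive (0 : R) (1 : R) (fun x => \int[mu]_(t in `[0, 1]) F x t)
    (\int[mu]_(t in `[0, 1]) 'D_1 (F ^~ t) 0).
  apply: H => x t xd t01.
  - exact: cont2 Cinf_f (dV' _ _ xd t01).
  - apply: (@derivable_slice1 _ _ f).
    exact: Cinf_derivable Cinf_f (dV' _ _ xd t01).
  - rewrite /F (derive_slice1 f); apply: CP; split; rewrite /= in_itv //.
    by rewrite /= -ler_norml ltW.
have E1 : \int[mu]_(t in `[0, 1]) 'D_1 (F ^~ t) 0 = \sum_i v 0 i * alpha i y.
  have V0 t : 0 <= t <= 1 -> V (0, t) by apply: dV'; rewrite normr0.
  have Cinf_tb : Cinf V (fun z : R * R => z.2 * b z).
    by apply: Cinf_mul => //; exact: Cinf_snd.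
  have e0 : \int[mu]_(t in `[0, 1]) 'D_1 (F ^~ t) 0 =
      \int[mu]_(t in `[0, 1]) 'D_(0, 1) (fun z : R * R => z.2 * b z) (0, t).
    apply: eq_Rintegral => t; rewrite inE /= in_itv /= => t01.
    by rewrite /F (derive_slice1 f) derive_f //; exact: V0.
  have dtb (t : R) : 0 <= t <= 1 -> is_derive t (1 : R) (fun t : R => t * b (0, t))
      ('D_(0, 1) (fun z : R * R => z.2 * b z) (0, t)).
    move=> /V0 Vt; split.
      apply: (@derivable_slice2 _ _ (fun z : R * R => z.2 * b z)).
      exact: Cinf_derivable Cinf_tb Vt.
    by rewrite (derive_slice2 (fun z : R * R => z.2 * b z)).
  have ctb (t : R) : 0 <= t <= 1 ->
      {for t, continuous (fun t => 'D_(0, 1) (fun z : R * R => z.2 * b z) (0, t))}.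
    by move=> /V0 Vt; exact: cont2 (Cinf_derive _ Cinf_tb) Vt.
  rewrite e0 (Rintegral_derive dtb ctb) mul1r mul0r subr0.
  apply: eq_bigr => i _; congr (_ * _).
  by rewrite /a /g /= scale0r addr0 scale1r subrKC.
have E2 : (fun x => \int[mu]_(t in `[0, 1]) F x t) =
    (fun x : R => star_primitive (x *: v + y)).
  apply/funext => x; apply: eq_Rintegral => t _; apply: eq_bigr => i _.
  rewrite /a /g /m /= (addrC y); congr (_ * _).
  by rewrite !mxE (addrC (y 0 i)).
rewrite E1 E2 in H; have [dH eH] := H.
split; first by apply/derivable1P.
by rewrite -eH derive_on_line scale0r add0r.
Qed.

End Variation.

End Poincare.

Lemma continuous_sum_for {R : realType} {E : normedModType R} n
    (f : 'I_n -> E -> R) x : (forall i, {for x, continuous (f i)}) ->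
  {for x, continuous (fun z => \sum_i f i z)}.
Proof.
move=> cf; apply: cvg_big => [|i _]; first exact: add_continuous.
exact: cf.
Qed.

Section Gradient.
Context {R : realType} {n : nat}.
Local Notation e i := (delta_mx 0 i : 'rV[R]_n).

Lemma C1_continuous (f : 'rV[R]_n -> R) p :
  (\forall z \near p, forall i, derivable f z (e i)) ->
  (forall i, {for p, continuous ('D_(e i) f)}) -> {for p, continuous f}.
Proof.
move=> df cdf; have [c [cc /near_dist[r r0 fE]]] := caratheodory df cdf.
pose g z := f p + \sum_i c i z * (z 0 i - p 0 i).
have gE z : `|z - p| < r -> g z = f z.
  move=> /fE fz; rewrite /g -[RHS](subrK (f p)) fz addrC; congr (_ + _).
  by apply: eq_bigr => i _; rewrite !mxE.
have cg : {for p, continuous g}.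
  have ct i : {for p, continuous (fun z => c i z * (z 0 i - p 0 i))}.
    have ci : {for p, continuous (fun z : 'rV[R]_n => z 0 i)} by exact: coord_continuous.
    have [cci _] := cc i; exact: cvgM cci (cvgB ci (cvg_cst (p 0 i))).
  have cs : {for p, continuous (fun z => \sum_i c i z * (z 0 i - p 0 i))}.
    exact: continuous_sum_for.
  exact: cvgD (cvg_cst (f p)) cs.
apply/continuous_dist => eps eps0.
have [d d0 dP] := (continuous_dist _ _).1 cg _ eps0.
exists (Num.min d r) => [|z]; first by rewrite lt_min d0.
rewrite lt_min => /andP[/dP zd zr].
by rewrite -gE // -[f p]gE // subrr normr0.
Qed.

(** The partial derivatives are the smooth functions [alpha i]; what remains is continuity of [f],
    which directional derivatives alone would not give and which comes from [C1_continuous]. *)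
Lemma Cinf_primitive (U : set 'rV[R]_n) (f : 'rV[R]_n -> R)
    (alpha : 'I_n -> 'rV[R]_n -> R) : open U -> (forall i, Cinf U (alpha i)) ->
  (forall y v, U y -> is_derive y v f (\sum_i v 0 i * alpha i y)) -> Cinf U f.
Proof.
move=> oU ca df.
have de y i : U y -> 'D_(e i) f y = alpha i y.
  move=> Uy; have [_ ->] := df y (e i) Uy; rewrite (bigD1 i) //= big1 ?addr0.
    by rewrite mxE !eqxx mul1r.
  by move=> j ji; rewrite mxE (negbTE ji) andbF mul0r.
have cf y : U y -> {for y, continuous f}.
  move=> Uy; apply: C1_continuous => [|i].
    by apply: near_open oU Uy _ => z Uz i; have [] := df z (e i) Uz.
  apply: (continuous_for_eq oU Uy (f := alpha i)) => [z Uz|].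
    by rewrite de.
  exact: Cinf_continuous (ca i) Uy.
case=> [|k]; first by split=> // y; exact: cf.
split=> [y|v]; first exact: cf.
split=> [y Uy|]; first by have [] := df y v Uy.
apply: (@Ck_eq _ _ _ _ (fun y => \sum_i v 0 i * alpha i y)) => // [y Uy|].
  by have [_ ->] := df y v Uy.
by apply: Ck_sum => // i _; apply: Ck_mul => //; [exact: Ck_cst|exact: ca].
Qed.

Lemma constant_halfspace (U : set 'rV[R]_n) (f : 'rV[R]_n -> R) (i : 'I_n) (s : R)
    (y z : 'rV[R]_n) : (forall z v, U z -> derivable f z v /\ 'D_v f z = 0) ->
  (forall z : 'rV[R]_n, 0 < s * z 0 i -> U z) -> 0 < s * y 0 i -> 0 < s * z 0 i -> f y = f z.
Proof.
move=> f0 Ui yi zi; apply: (derive_zero_segment f0) => c /andP[c0 c1].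
apply: Ui; rewrite !mxE.
have -> : s * (c * (y 0 i - z 0 i) + z 0 i) = c * (s * y 0 i) + (1 - c) * (s * z 0 i).
  by ring.
have [->|cn0] := eqVneq c 0; first by rewrite mul0r add0r subr0 mul1r.
apply: ltr_wpDr; first by apply: mulr_ge0; [rewrite subr_ge0|exact: ltW].
by apply: mulr_gt0 yi; rewrite lt_def cn0.
Qed.

End Gradient.

(** * Gluing primitives on the punctured space *)

Section Punctured.
Context {R : realType}.
Local Notation e i := (delta_mx 0 i : 'rV[R]_3).
Local Notation i1 := (1 : 'I_3).
Local Notation i2 := (2%:R : 'I_3).

Let hub : 'rV[R]_3 := const_mx 1.

(** [U] is a union of open half-spaces, and [hub] lies in all the positive ones. From a negative
    one, [hub] is reached through [- hub] and [m], consecutive points sharing a half-space; [m] is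
    positive in coordinate 1 and negative in coordinate 2. With all indices in [J] this is the
    punctured space, and without the index 0 the complement of a line. *)
Lemma constant_of_derive0 (J : pred 'I_3) (U : set 'rV[R]_3) (f : 'rV[R]_3 -> R) y :
  J i1 -> J i2 -> (forall y : 'rV[R]_3, U y <-> exists2 i, J i & y 0 i != 0) ->
  (forall z v, U z -> derivable f z v /\ 'D_v f z = 0) ->
  U y -> f y = f hub.
Proof.
move=> J1 J2 UP f0 /UP[i Ji yi].
have half j (s : R) (x z : 'rV[R]_3) : J j -> 0 < s * x 0 j -> 0 < s * z 0 j -> f x = f z.
  move=> Jj; apply: (constant_halfspace f0) => z' z'j; apply/UP; exists j => //.
  by apply/eqP => z'0; move: z'j; rewrite z'0 mulr0 ltxx.
have N11 : 0 < (-1 : R) * -1 by rewrite mulrNN mulr1.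
have [y0|y0|y0] := ltgtP (y 0 i) 0; last by rewrite y0 eqxx in yi.
  transitivity (f (- hub)).
    by apply: (half i (-1)) => //; rewrite ?mxE ?mxE // mulN1r oppr_gt0.
  pose m : 'rV[R]_3 := \row_j (if j == i1 then 1 else -1).
  transitivity (f m); first by apply: (half i2 (-1)) => //; rewrite !mxE.
  by apply: (half i1 1) => //; rewrite !mxE /= mul1r.
by apply: (half i 1) => //; rewrite mul1r // mxE.
Qed.

Lemma constant_punctured (f : 'rV[R]_3 -> R) :
  (forall z v, z != 0 -> derivable f z v /\ 'D_v f z = 0) ->
  exists c, forall y, y != 0 -> f y = c.
Proof.
move=> f0; exists (f hub) => y y0.
apply: (@constant_of_derive0 predT [set y | y != 0]) => // z; split.
  move=> /eqP z0; apply: contrapT => nz; apply: z0; apply/rowP => i.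
  rewrite mxE; apply/eqP; apply: contrapT => /negP zi.
  by apply: nz; exists i.
by move=> [i _ zi]; apply/eqP => z0; move: zi; rewrite z0 mxE eqxx.
Qed.

Variable alpha : 'I_3 -> 'rV[R]_3 -> R.
Hypothesis smooth_alpha : forall i, Cinf [set y | y != 0] (alpha i).
Hypothesis closed_alpha : forall i j y, y != 0 ->
  'D_(e i) (alpha j) y = 'D_(e j) (alpha i) y.

(* U 1 and U (-1) are complements of closed half-lines, star-shaped about e 0 and
   - e 0; together they cover the punctured space, and their intersection is
   connected. *)
Let U (s : R) : set 'rV[R]_3 :=
  [set y | [\/ y 0 i1 != 0, y 0 i2 != 0 | 0 < s * y 0 0]].

Let Un0 s y : U s y -> y != 0.
Proof.
by move=> Uy; apply/eqP => y0; move: Uy; rewrite y0 /U /= !mxE mulr0 ltxx eqxx => -[].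
Qed.

Let oU s : open (U s).
Proof.
have coord (A : set R) i (a : R) : open A ->
    open [set y : 'rV[R]_3 | A (a * y 0 i)].
  move=> oA; have : open [set y : 'rV[R]_3 | setT y /\ A (a * y 0 i)].
    apply: (open_preimage (@openT _) oA) => x _.
    have ci : {for x, continuous (fun z : 'rV[R]_3 => z 0 i)} by exact: coord_continuous.
    exact: cvgM (cvg_cst a) ci.
  by congr open; apply/seteqP; split=> y //= [].
have -> : U s = [set y : 'rV[R]_3 | (1 * y 0 i1) != 0] `|`
    ([set y : 'rV[R]_3 | (1 * y 0 i2) != 0] `|` [set y : 'rV[R]_3 | 0 < s * y 0 0]).
  apply/seteqP; split=> y; rewrite /U /= !mul1r.
    by case=> ?; [left|right; left|right; right].
  by case=> [?|[?|?]]; [constructor 1|constructor 2|constructor 3].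
apply: openU; last apply: openU.
- exact: (coord _ i1 1 open_neq0).
- exact: (coord _ i2 1 open_neq0).
- exact: (coord _ 0 s (@open_gt _ 0)).
Qed.

Let starU s y (t : R) : s * s = 1 -> U s y -> 0 <= t <= 1 ->
  U s (s *: e 0 + t *: (y - s *: e 0)).
Proof.
move=> ss Uy /andP[t0 t1].
have [->|tn0] := eqVneq t 0.
  by constructor 3; rewrite !mxE /= mul0r addr0 mulr1 ss.
have tp : 0 < t by rewrite lt_def tn0.
case: Uy => [y1|y2|y0].
- by constructor 1; rewrite !mxE /= mulr0 add0r subr0 mulf_neq0.
- by constructor 2; rewrite !mxE /= mulr0 add0r subr0 mulf_neq0.
- constructor 3; rewrite !mxE /= mulr1.
  have -> : s * (s + t * (y 0 0 - s)) = t * (s * y 0 0) + (1 - t) * (s * s) by ring.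
  by rewrite ss mulr1; apply: ltr_wpDr; rewrite ?subr_ge0 // mulr_gt0.
Qed.

(** On the overlap [L], the complement of a coordinate axis, the two line integrals differ by a
    constant; shifting one of them glues them. *)
Lemma poincare_punctured : exists w, Cinf [set y | y != 0] w /\
  forall i y, y != 0 -> 'D_(e i) w y = alpha i y.
Proof.
pose W s := star_primitive (s *: e 0) alpha.
have smooth_s s i : Cinf (U s) (alpha i).
  by apply: Cinf_sub (smooth_alpha i) => y /Un0.
have dW s y v : s * s = 1 -> U s y -> is_derive y v (W s) (\sum_i v 0 i * alpha i y).
  move=> ss Uy.
  have star y' (t : R) : U s y' -> 0 <= t <= 1 -> U s (s *: e 0 + t *: (y' - s *: e 0)).
    exact: starU.
  have closed i j y' : U s y' -> 'D_(e i) (alpha j) y' = 'D_(e j) (alpha i) y'.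
    by move=> /Un0; exact: closed_alpha.
  exact: (star_primitive_is_derive (@oU s) star (smooth_s s) closed v Uy).
have cW s : s * s = 1 -> Cinf (U s) (W s).
  by move=> ss; apply: (Cinf_primitive (@oU s) (smooth_s s)) => y v; exact: dW.
have s1 : 1 * 1 = 1 :> R by rewrite mulr1.
have sN1 : -1 * -1 = 1 :> R by rewrite mulrNN mulr1.
pose L : set 'rV[R]_3 := [set y | U 1 y /\ U (-1) y].
pose J : pred 'I_3 := fun i => i != 0.
have LP y : L y <-> exists2 i, J i & y 0 i != 0.
  split=> [[U1 U2]|].
    case: U1 => [y1|y2|y0]; [by exists i1|by exists i2|].
    case: U2 => [y1|y2|]; [by exists i1|by exists i2|].
    by rewrite mulN1r oppr_gt0; move: y0; rewrite mul1r => /lt_trans h /h; rewrite ltxx.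
  move=> [[[|[|[|//]]] i3] //= _ yi].
    have e1 : Ordinal i3 = i1 by apply: val_inj.
    by rewrite e1 in yi; split; constructor 1.
  have e2 : Ordinal i3 = i2 by apply: val_inj.
  by rewrite e2 in yi; split; constructor 2.
pose c := W 1 hub - W (-1) hub.
have Wc y : L y -> W 1 y = W (-1) y + c.
  move=> Ly; suff : W 1 y - W (-1) y = c by move=> <-; rewrite addrC subrK.
  apply: (@constant_of_derive0 J L (fun y => W 1 y - W (-1) y)) => // z v [Uz1 Uz2].
  have [d1 e1] := dW 1 z v s1 Uz1; have [d2 e2] := dW (-1) z v sN1 Uz2.
  split; first exact: derivable_sub.
  by rewrite (derive_sub d1 d2) e1 e2 subrr.
(* A point with [0 < y 0 0] lies in [U 1], any other nonzero point in [U (-1)]; on the overlap both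
   branches agree by [Wc]. *)
pose w (y : 'rV[R]_3) := if 0 < y 0 0 then W 1 y else W (-1) y + c.
have w1 y : U 1 y -> w y = W 1 y.
  rewrite /w; case: ltP => // y0 Uy; rewrite Wc //; apply/LP.
  case: Uy => [y1|y2|]; [by exists i1|by exists i2|].
  by rewrite mul1r => /(le_lt_trans y0); rewrite ltxx.
have w2 y : U (-1) y -> w y = W (-1) y + c.
  rewrite /w; case: ltP => // y0 Uy; rewrite Wc //; apply/LP.
  case: Uy => [y1|y2|]; [by exists i1|by exists i2|].
  by rewrite mulN1r oppr_gt0 => /(lt_trans y0); rewrite ltxx.
have Ucover y : y != 0 -> U 1 y \/ U (-1) y.
  move=> yn0; have [y0|y0|y0] := ltgtP (y 0 0) 0.
  - by right; constructor 3; rewrite mulN1r oppr_gt0.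
  - by left; constructor 3; rewrite mul1r.
  left; have [y1|y1] := eqVneq (y 0 i1) 0; last by constructor 1.
  constructor 2; apply: contra_neq yn0 => y2; apply/rowP => -[[|[|[|//]]] i3].
  - by rewrite mxE -y0; congr (y 0 _); apply: val_inj.
  - by rewrite mxE -y1; congr (y 0 _); apply: val_inj.
  - by rewrite mxE -y2; congr (y 0 _); apply: val_inj.
have cw1 : Cinf (U 1) w by apply: Cinf_eq (cW _ s1) => // y /w1.
have cw2 : Cinf (U (-1)) w.
  apply: (@Cinf_eq _ _ _ (fun y => W (-1) y + c)) => // [y /w2 //|].
  by apply: Cinf_add => //; [exact: cW|exact: Cinf_cst].
have part i y : \sum_j (e i) 0 j * alpha j y = alpha i y.
  rewrite (bigD1 i) //= big1 ?addr0; first by rewrite mxE !eqxx mul1r.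
  by move=> j ji; rewrite mxE (negbTE ji) andbF mul0r.
exists w; split=> [|i y /Ucover[Uy|Uy]].
- apply: Cinf_local => y /Ucover[Uy|Uy]; first by exists (U 1).
  by exists (U (-1)).
- rewrite -(part i y); have [_ <-] := dW 1 y (e i) s1 Uy.
  by apply: near_eq_derive; apply: near_open (@oU 1) Uy w1.
- rewrite -(part i y); have [dW2 <-] := dW (-1) y (e i) sN1 Uy.
  transitivity ('D_(e i) (fun y => W (-1) y + c) y).
    by apply: near_eq_derive; apply: near_open (@oU (-1)) Uy w2.
  have dc : derivable (fun=> c) y (e i) by exact: derivable_const.
  by rewrite (derive_add dW2 dc) derive_constant addr0.
Qed.

End Punctured.

(** * Linearization of the curvature at a flat metric *)

(** Used for the quadratic Christoffel terms of the curvature, both of whose factors vanish at the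
    flat metric. *)
Lemma derive_mul0 {R : realType} {E : normedModType R} (f g : E -> R) x v :
  derivable f x v -> derivable g x v -> f x = 0 -> g x = 0 ->
  'D_v (fun z => f z * g z) x = 0.
Proof.
by move=> df dg fx gx; rewrite (derive_mul df dg) fx gx mulr0 mul0r addr0.
Qed.

Section SmoothMatrix.
Context {R : realType} {E : normedModType R}.

Lemma Cinf_det n (U : set E) (A : E -> 'M[R]_n) : open U ->
  (forall i j, Cinf U (fun z => A z i j)) -> Cinf U (fun z => \det (A z)).
Proof.
move=> oU cA; apply: Cinf_sum => // s _; apply: Cinf_mul => //.
  exact: Cinf_cst.
by apply: Cinf_prod => // i _; exact: cA.
Qed.

(** By Cramer's rule the entries are cofactors divided by the determinant. *)
Lemma Cinf_invmx n (U : set E) (A : E -> 'M[R]_n) : open U ->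
  (forall i j, Cinf U (fun z => A z i j)) ->
  (forall z, U z -> \det (A z) != 0) ->
  forall i j, Cinf U (fun z => invmx (A z) i j).
Proof.
move=> oU cA dA i j.
apply: (@Cinf_eq _ _ _ (fun z => (\det (A z))^-1 * cofactor (A z) j i)) => //.
  by move=> z /dA Az; rewrite /invmx unitmxE unitfE Az !mxE.
apply: Cinf_mul => //; first by apply: Cinf_inv => //; exact: Cinf_det.
apply: Cinf_mul => //; first exact: Cinf_cst.
apply: Cinf_det => // i' j'.
by apply: (Cinf_eq oU _ (cA (lift j i') (lift i j'))) => z _; rewrite !mxE.
Qed.

End SmoothMatrix.

(** First variation of the Christoffel symbols at the Euclidean metric, in the direction [h]; the
    inverse Gram matrix there is the identity. *)
Definition christoffel_variation {R : realType} (h : 'I_3 -> 'I_3 -> 'rV[R]_3 -> R)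
    (k i j : 'I_3) (y : 'rV[R]_3) : R :=
  2%:R^-1 * ('D_(delta_mx 0 i) (h j k) y + 'D_(delta_mx 0 j) (h i k) y
             - 'D_(delta_mx 0 k) (h i j) y).

Section Linearization.
Context {R : realType}.
Variables (G : R -> 'rV[R]_3 -> 'M[R]_3) (W : set (R * 'rV[R]_3)) (Y : set 'rV[R]_3).
Hypothesis oW : open W.
Hypothesis oY : open Y.
Hypothesis smoothG : forall i j, Cinf W (fun z => G z.1 z.2 i j).
Hypothesis YW : forall y, Y y -> W (0, y).
Hypothesis G0 : forall y, Y y -> G 0 y = 1%:M.

Local Notation e i := (delta_mx 0 i : 'rV[R]_3).
(* The metrics, Christoffel symbols and curvatures are treated as functions of
   (t, y), so that the derivatives in t and in y commute by Schwarz's theorem. *)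
Let Gh i j (z : R * 'rV[R]_3) : R := G z.1 z.2 i j.

Definition metric_variation i j (y : 'rV[R]_3) : R :=
  'D_(1, 0) (fun z : R * 'rV[R]_3 => G z.1 z.2 i j) (0, y).

Local Notation h := metric_variation.

Let W' := [set z | W z /\ (\det (G z.1 z.2) != 0)].

Let oW' : open W'.
Proof.
have cdet : Cinf W (fun z => \det (G z.1 z.2)) by exact: Cinf_det.
apply: (open_preimage (V := [set x : R | x != 0]) oW open_neq0) => z Wz.
exact: Cinf_continuous cdet Wz.
Qed.

Let YW' y : Y y -> W' (0, y).
Proof. by move=> Yy; split; [exact: YW|rewrite /= G0 // det1 oner_neq0]. Qed.

Let cG i j : Cinf W' (Gh i j).
Proof. by apply: Cinf_sub (smoothG i j) => z []. Qed.

Let Inv k l (z : R * 'rV[R]_3) : R := invmx (G z.1 z.2) k l.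

Let cInv k l : Cinf W' (Inv k l).
Proof.
apply: (Cinf_invmx (A := fun z => G z.1 z.2) oW') => [i j|z []] //.
exact: cG.
Qed.

Let S i j l (z : R * 'rV[R]_3) : R :=
  'D_(0, e i) (Gh j l) z + 'D_(0, e j) (Gh i l) z - 'D_(0, e l) (Gh i j) z.

Let cS i j l : Cinf W' (S i j l).
Proof.
apply: Cinf_add => //; last by apply: Cinf_opp => //; exact: Cinf_derive.
by apply: Cinf_add => //; exact: Cinf_derive.
Qed.

Let Gam k i j (z : R * 'rV[R]_3) : R := 2%:R^-1 * \sum_l Inv k l z * S i j l z.

Let cGam k i j : Cinf W' (Gam k i j).
Proof.
apply: Cinf_mul => //; first exact: Cinf_cst.
by apply: Cinf_sum => // l _; apply: Cinf_mul.
Qed.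

Let christoffelE t k i j y : christoffel (G t) k i j y = Gam k i j (t, y).
Proof.
rewrite /christoffel /Gam; congr (_ * _); apply: eq_bigr => l _; congr (_ * _).
by rewrite /S -!derive_slice2.
Qed.

Let Rie l k i j (z : R * 'rV[R]_3) : R :=
  'D_(0, e i) (Gam l j k) z - 'D_(0, e j) (Gam l i k) z +
  \sum_m (Gam l i m z * Gam m j k z - Gam l j m z * Gam m i k z).

Let cRie l k i j : Cinf W' (Rie l k i j).
Proof.
apply: Cinf_add => //.
  apply: Cinf_add => //; first exact: Cinf_derive.
  by apply: Cinf_opp => //; exact: Cinf_derive.
apply: Cinf_sum => // m _; apply: Cinf_add => //; first exact: Cinf_mul.
by apply: Cinf_opp => //; exact: Cinf_mul.
Qed.

Let riemannE t l k i j y : riemann (G t) l k i j y = Rie l k i j (t, y).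
Proof.
have cE k' i' j' : christoffel (G t) k' i' j' = (fun y => Gam k' i' j' (t, y)).
  by apply/funext => y'; exact: christoffelE.
have dE a b c d : pd a (christoffel (G t) b c d) y = 'D_(0, e a) (Gam b c d) (t, y).
  by rewrite /pd cE; exact: derive_slice2.
rewrite /riemann (dE i l j k) (dE j l i k); congr (_ + _).
by apply: eq_bigr => m _; rewrite !christoffelE.
Qed.

Let commute (F : R * 'rV[R]_3 -> R) z v w : Cinf W' F -> W' z ->
  'D_v ('D_w F) z = 'D_w ('D_v F) z.
Proof. move=> cF Wz; exact: (derive_commute v w oW' Wz (cF 2%N)). Qed.

Let S0 i j l y : Y y -> S i j l (0, y) = 0.
Proof.
move=> Yy; have D0 a b c : 'D_(0, e a) (Gh b c) (0, y) = 0.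
  rewrite -derive_slice2; transitivity ('D_(e a) (fun=> (1%:M : 'M[R]_3) b c) y).
    by apply: near_eq_derive; apply: near_open oY Yy _ => z Yz; rewrite /Gh /= G0.
  exact: derive_constant.
by rewrite /S !D0 addr0 subr0.
Qed.

Let Gam0 k i j y : Y y -> Gam k i j (0, y) = 0.
Proof.
move=> Yy; rewrite /Gam big1 ?mulr0 // => l _.
by rewrite S0 // mulr0.
Qed.

Let dS i j l y : Y y -> 'D_(1, 0) (S i j l) (0, y) =
  'D_(e i) (h j l) y + 'D_(e j) (h i l) y - 'D_(e l) (h i j) y.
Proof.
move=> /YW' Wy.
have dd a b c : derivable ('D_(0, e a) (Gh b c)) (0, y) (1, 0).
  exact: Cinf_derivable (Cinf_derive _ (cG b c)) Wy.
have E a b c : 'D_(1, 0) ('D_(0, e a) (Gh b c)) (0, y) = 'D_(e a) (h b c) y.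
  rewrite (commute _ _ (cG b c) Wy).
  exact: (esym (derive_slice2 ('D_(1, 0) (Gh b c)) 0 y (e a))).
rewrite [LHS](derive_sub (derivable_add (dd _ _ _) (dd _ _ _)) (dd _ _ _)).
by rewrite (derive_add (dd _ _ _) (dd _ _ _)) !E.
Qed.

(** The combination [S] of first derivatives vanishes at t = 0, so the variation of the inverse Gram
    matrix contributes nothing, and only the term [l = k] survives. *)
Let dGam k i j y : Y y ->
  'D_(1, 0) (Gam k i j) (0, y) = christoffel_variation h k i j y.
Proof.
move=> Yy; have Wy := YW' Yy.
have dI l : derivable (Inv k l) (0, y) (1, 0) by exact: Cinf_derivable (cInv k l) Wy.
have dS' l : derivable (S i j l) (0, y) (1, 0) by exact: Cinf_derivable (cS i j l) Wy.
have dP l := derivable_mul (dI l) (dS' l).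
have dc : derivable (fun=> 2%:R^-1 : R) ((0, y) : R * 'rV[R]_3) (1, 0).
  by exact: derivable_const.
rewrite [LHS](derive_mul dc (derivable_sumf dP)) derive_constant mul0r add0r.
rewrite (derive_sumf dP) /christoffel_variation; congr (_ * _).
rewrite (bigD1 k) //= big1 => [|l lk].
  rewrite (derive_mul (dI _) (dS' _)) S0 // mulr0 add0r addr0 dS //.
  by rewrite /Inv /= G0 // invmx1 mxE eqxx mul1r.
rewrite (derive_mul (dI _) (dS' _)) S0 // mulr0 add0r.
by rewrite /Inv /= G0 // invmx1 mxE eq_sym (negbTE lk) mul0r.
Qed.

(** At t = 0 the Christoffel symbols vanish, hence the quadratic terms of the curvature have no
    first variation; in the other terms the derivatives in t and y are exchanged. *)
Lemma riemann_linearization l k i j y : Y y ->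
  (riemann (G t) l k i j y - riemann (G 0) l k i j y) / t @[t --> (0 : R)^'] -->
  'D_(e i) (christoffel_variation h l j k) y - 'D_(e j) (christoffel_variation h l i k) y.
Proof.
move=> Yy; have Wy := YW' Yy.
have dR : derivable (Rie l k i j) (0, y) (1, 0).
  exact: Cinf_derivable (cRie l k i j) Wy.
have dG a b c : derivable (Gam a b c) (0, y) (1, 0).
  exact: Cinf_derivable (cGam a b c) Wy.
have dDG w a b c : derivable ('D_w (Gam a b c)) (0, y) (1, 0).
  exact: Cinf_derivable (Cinf_derive w (cGam a b c)) Wy.
have <- : 'D_(1, 0) (Rie l k i j) (0, y) =
    'D_(e i) (christoffel_variation h l j k) y - 'D_(e j) (christoffel_variation h l i k) y.
  have dP (a b c a' b' c' : 'I_3) := derivable_mul (dG a b c) (dG a' b' c').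
  have dQ m := derivable_sub (dP l i m m j k) (dP l j m m i k).
  rewrite [LHS](derive_add (derivable_sub (dDG _ _ _ _) (dDG _ _ _ _)) (derivable_sumf dQ)).
  rewrite (derive_sumf dQ) big1 ?addr0 => [|m _]; last first.
    rewrite (derive_sub (dP l i m m j k) (dP l j m m i k)).
    have z0 a b c := @Gam0 a b c y Yy.
    have D0 a b c a' b' c' := derive_mul0 (dG a b c) (dG a' b' c') (z0 a b c) (z0 a' b' c').
    by rewrite (D0 l i m m j k) (D0 l j m m i k) subrr.
  rewrite (derive_sub (dDG _ _ _ _) (dDG _ _ _ _)).
  have E a b c d : 'D_(1, 0) ('D_(0, e a) (Gam b c d)) (0, y) =
      'D_(e a) (christoffel_variation h b c d) y.
    rewrite (commute _ _ (cGam b c d) Wy).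
    rewrite -(derive_slice2 ('D_(1, 0) (Gam b c d)) 0 y (e a)); apply: near_eq_derive.
    by apply: near_open oY Yy _ => z Yz; exact: dGam.
  exact: (congr2 (fun a b => a - b) (E i l j k) (E j l i k)).
rewrite -derive_slice1.
have := cvg_derive (derivable_slice1 dR).
apply: cvg_trans; apply: near_eq_cvg; near=> t.
by rewrite !riemannE mulrC [t%:A]mulr1 addr0.
Unshelve. all: by end_near. Qed.

End Linearization.

(** * Compatibility equations *)

Section VectorDerivative.
Context {R : realType} {E : normedModType R} {n : nat}.
Implicit Types (f : E -> R) (g : E -> 'rV[R]_n) (x v : E).

Lemma scale_coord f g i :
  (fun z => (f z *: g z) 0 i) = (fun z => f z * g z 0 i).
Proof. by apply/funext => z; rewrite mxE. Qed.

Lemma derivable_scalev f g x v : derivable f x v -> derivable g x v ->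
  derivable (fun z => f z *: g z) x v.
Proof.
move=> df /derivable_coord dg; apply/derivable_coord => i.
rewrite scale_coord; exact: derivable_mul df (dg i).
Qed.

Lemma derive_scalev f g x v : derivable f x v -> derivable g x v ->
  'D_v (fun z => f z *: g z) x = 'D_v f x *: g x + f x *: 'D_v g x.
Proof.
move=> df dg; have dgi := (derivable_coord _ _ _).1 dg.
apply/rowP => i; rewrite derive_coord; last exact: derivable_scalev.
by rewrite scale_coord (derive_mul df (dgi i)) !mxE derive_coord.
Qed.

Lemma derive_addv (g1 g2 : E -> 'rV[R]_n) x v :
  derivable g1 x v -> derivable g2 x v ->
  'D_v (fun z => g1 z + g2 z) x = 'D_v g1 x + 'D_v g2 x.
Proof. exact: deriveD. Qed.

Definition CinfV (U : set E) g := forall i, Cinf U (fun x => g x 0 i).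

Lemma CinfV_derivable U g x v : CinfV U g -> U x -> derivable g x v.
Proof.
by move=> cg Ux; apply/derivable_coord => i; exact: Cinf_derivable (cg i) Ux.
Qed.

Lemma CinfV_scale U f g : open U -> Cinf U f -> CinfV U g ->
  CinfV U (fun z => f z *: g z).
Proof. by move=> oU cf cg i; rewrite scale_coord; exact: Cinf_mul. Qed.

Lemma CinfV_add U (g1 g2 : E -> 'rV[R]_n) : open U -> CinfV U g1 -> CinfV U g2 ->
  CinfV U (fun z => g1 z + g2 z).
Proof.
move=> oU c1 c2 i; apply: (Cinf_eq oU _ (Cinf_add oU (c1 i) (c2 i))) => x _.
by rewrite mxE.
Qed.

Lemma CinfV_eq U (g1 g2 : E -> 'rV[R]_n) : open U -> (forall x, U x -> g1 x = g2 x) ->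
  CinfV U g1 -> CinfV U g2.
Proof. by move=> oU e c1 i; apply: (Cinf_eq oU _ (c1 i)) => x /e ->. Qed.

Lemma CinfV_derive U g v : open U -> CinfV U g -> CinfV U ('D_v g).
Proof.
move=> oU cg i; apply: (Cinf_eq oU _ (Cinf_derive v (cg i))) => x Ux.
by rewrite derive_coord //; exact: CinfV_derivable cg Ux.
Qed.

End VectorDerivative.

Section DotDerivative.
Context {R : realType} {E : normedModType R}.
Implicit Types (f g : E -> 'rV[R]_3) (x v : E).

Lemma derive_dot f g x v : derivable f x v -> derivable g x v ->
  'D_v (fun z => dot (f z) (g z)) x = dot ('D_v f x) (g x) + dot (f x) ('D_v g x).
Proof.
move=> df dg; have dfi := (derivable_coord _ _ _).1 df.
have dgi := (derivable_coord _ _ _).1 dg.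
have dp i := derivable_mul (dfi i) (dgi i).
rewrite [LHS](derive_sumf dp) -big_split; apply: eq_bigr => i _ /=.
by rewrite (derive_mul (dfi i) (dgi i)) !derive_coord.
Qed.

Lemma Cinf_dot U f g : open U -> CinfV U f -> CinfV U g ->
  Cinf U (fun z => dot (f z) (g z)).
Proof. by move=> oU cf cg; apply: Cinf_sum => // i _; exact: Cinf_mul. Qed.

End DotDerivative.

Section RowDomain.
Context {R : realType} {n : nat}.
Local Notation e i := (delta_mx 0 i : 'rV[R]_n).

Lemma derive_partialsV m (V : set 'rV[R]_n) (f : 'rV[R]_n -> 'rV[R]_m)
    (x v : 'rV[R]_n) : open V -> V x -> CinfV V f ->
  'D_v f x = \sum_i v 0 i *: 'D_(e i) f x.
Proof.
move=> oV Vx cf; have df w := CinfV_derivable (v := w) cf Vx.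
apply/rowP => j; rewrite derive_coord // (derive_partials _ oV Vx (cf j)) summxE.
by apply: eq_bigr => i _; rewrite mxE derive_coord.
Qed.

Lemma derive_homogeneous0 (V : normedModType R) (f : 'rV[R]_n -> V) (y : 'rV[R]_n) :
  (forall c : R, 0 < c -> f (c *: y) = f y) -> derivable f y y /\ 'D_y f y = 0.
Proof.
move=> hf.
have near0 : \forall h \near (0 : R)^', h^-1 *: ((f \o shift y) (h *: y) - f y) = 0.
  suff H : \forall h \near (0 : R), h^-1 *: ((f \o shift y) (h *: y) - f y) = 0.
    exact: nbhs_dnbhs.
  apply/near_dist; exists 1 => // h; rewrite subr0 => h1 /=.
  rewrite -{2}[y]scale1r -scalerDl hf ?subrr ?scaler0 //.
  by move: h1; rewrite ltr_norml => /andP[? _]; lra.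
split; first by apply: (is_cvg_near_cst 0) near0.
exact: lim_near_cst near0.
Qed.

Lemma derive_homogeneous1 (f : 'rV[R]_n -> R) (y : 'rV[R]_n) :
  (forall c : R, 0 < c -> f (c *: y) = c * f y) -> 'D_y f y = f y.
Proof.
move=> hf.
have near0 : \forall h \near (0 : R)^', h^-1 *: ((f \o shift y) (h *: y) - f y) = f y.
  suff H : \forall h \near (0 : R), h != 0 ->
      h^-1 *: ((f \o shift y) (h *: y) - f y) = f y.
    exact: H.
  apply/near_dist; exists 1 => // h; rewrite subr0 => h1 h0 /=.
  rewrite -{2}[y]scale1r -scalerDl hf; last first.
    by move: h1; rewrite ltr_norml => /andP[? _]; lra.
  by rewrite mulrDl mul1r addrK scalerA mulVf // scale1r.
exact: lim_near_cst near0.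
Qed.

Lemma derive_scale_arg (V : normedModType R) (f : 'rV[R]_n -> V)
    (y v : 'rV[R]_n) (c : R) : 0 < c ->
  (forall (a : R) z, 0 < a -> f (a *: z) = f z) ->
  'D_(c *: v) f (c *: y) = 'D_v f y.
Proof.
move=> c0 hf.
have growth : (fun h : R => h^-1 *: ((f \o shift (c *: y)) (h *: (c *: v)) - f (c *: y))) =
    (fun h : R => h^-1 *: ((f \o shift y) (h *: v) - f y)).
  apply/funext => h /=.
  by rewrite scalerA mulrC -scalerA -scalerDr !hf.
by rewrite /derive growth.
Qed.

Lemma derive_scale_dir (V : set 'rV[R]_n) (f : 'rV[R]_n -> R) (x v : 'rV[R]_n) (c : R) :
  open V -> V x -> Cinf V f -> 'D_(c *: v) f x = c * 'D_v f x.
Proof.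
move=> oV Vx cf; rewrite !(derive_partials _ oV Vx cf) mulr_sumr.
by apply: eq_bigr => i _; rewrite mxE mulrA.
Qed.

Lemma derive_scale_dirV m (V : set 'rV[R]_n) (f : 'rV[R]_n -> 'rV[R]_m)
    (x v : 'rV[R]_n) (c : R) : open V -> V x -> CinfV V f ->
  'D_(c *: v) f x = c *: 'D_v f x.
Proof.
move=> oV Vx cf; rewrite !(derive_partialsV _ oV Vx cf) scaler_sumr.
by apply: eq_bigr => i _; rewrite mxE scalerA.
Qed.

End RowDomain.

Section Compatibility.
Context {R : realType}.
Local Notation P := ([set y : 'rV[R]_3 | y != 0]).
Local Notation e i := (delta_mx 0 i : 'rV[R]_3).
Variable h : 'I_3 -> 'I_3 -> 'rV[R]_3 -> R.

Let oP : open P := open_neq0.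

(* The linearized curvature vanishes. *)
Definition flat_variation := forall l k i j y, y != 0 ->
  'D_(e i) (christoffel_variation h l j k) y =
  'D_(e j) (christoffel_variation h l i k) y.

Let derive_eq (f g : 'rV[R]_3 -> R) v y : P y ->
  (forall z, P z -> f z = g z) -> 'D_v f y = 'D_v g y.
Proof. by move=> Py fg; apply: near_eq_derive; exact: near_open oP Py fg. Qed.

Let swap (f : 'rV[R]_3 -> R) v w y : Cinf P f -> P y ->
  'D_v ('D_w f) y = 'D_w ('D_v f) y.
Proof. by move=> cf Py; exact: (derive_commute v w oP Py (cf 2%N)). Qed.

(** The variation of the Christoffel symbols is the Hessian of [eta], and the claim becomes the
    symmetry of third derivatives. *)
Lemma flat_variation_of_deformation (eta : 'I_3 -> 'rV[R]_3 -> R) :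
  (forall i, Cinf P (eta i)) ->
  (forall i j y, y != 0 -> h i j y = 'D_(e i) (eta j) y + 'D_(e j) (eta i) y) ->
  flat_variation.
Proof.
move=> ce hE.
have dd i j v y : P y -> derivable ('D_(e i) (eta j)) y v.
  by move=> Py; exact: Cinf_derivable (Cinf_derive (e i) (ce j)) Py.
have dh v i j y : P y ->
    'D_v (h i j) y = 'D_v ('D_(e i) (eta j)) y + 'D_v ('D_(e j) (eta i)) y.
  move=> Py; rewrite (derive_eq _ Py (hE i j)).
  have d1 : derivable ('D_(e i) (eta j)) y v by exact: dd.
  have d2 : derivable ('D_(e j) (eta i)) y v by exact: dd.
  exact: derive_add d1 d2.
have cvE k i j y : P y ->
    christoffel_variation h k i j y = 'D_(e i) ('D_(e j) (eta k)) y.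
  move=> Py; rewrite /christoffel_variation !dh //.
  rewrite (swap (e j) (e i) (ce k) Py) (swap (e i) (e k) (ce j) Py).
  rewrite (swap (e j) (e k) (ce i) Py).
  move: ('D_(e i) ('D_(e j) (eta k)) y) => a.
  move: ('D_(e k) ('D_(e i) (eta j)) y) ('D_(e k) ('D_(e j) (eta i)) y) => b c.
  by field.
move=> l k i j y Py.
rewrite (derive_eq (e i) Py (cvE l j k)) (derive_eq (e j) Py (cvE l i k)).
exact: swap (Cinf_derive _ (ce l)) Py.
Qed.

Hypothesis smooth_h : forall i j, Cinf P (h i j).
Hypothesis sym_h : forall i j y, h i j y = h j i y.
Hypothesis radial_h : forall l (y : 'rV[R]_3), y != 0 -> \sum_k y 0 k * h k l y = 0.
Hypothesis euler_h : forall i j (y : 'rV[R]_3), y != 0 -> 'D_y (h i j) y = 0.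

(* If h is the symmetrized derivative of eta, this is the derivative along e j of
   the infinitesimal rotation ('D_(e k) eta_l - 'D_(e l) eta_k) / 2. *)
Let alpha k l j (y : 'rV[R]_3) : R := 2%:R^-1 * ('D_(e k) (h j l) y - 'D_(e l) (h j k) y).

Let smooth_alpha k l j : Cinf P (alpha k l j).
Proof.
apply: Cinf_mul => //; first exact: Cinf_cst.
apply: Cinf_add => //; first exact: Cinf_derive.
by apply: Cinf_opp => //; exact: Cinf_derive.
Qed.

(** [alpha k l a] differs from the variation of the Christoffel symbols by half the derivative of
    [h k l] along [e a], a gradient in the index [a]. Vanishing linearized curvature is therefore
    closedness of [alpha k l]. *)
Let closed_alpha k l i j y : flat_variation -> y != 0 ->
  'D_(e i) (alpha k l j) y = 'D_(e j) (alpha k l i) y.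
Proof.
move=> flat y0.
have cvE a z : christoffel_variation h l a k z =
    2%:R^-1 * 'D_(e a) (h k l) z + alpha k l a z.
  rewrite /christoffel_variation /alpha.
  by rewrite -mulrDr -addrA.
have dh a b : derivable (fun z => 2%:R^-1 * 'D_(e a) (h k l) z) y (e b).
  have dc : derivable (fun=> 2%:R^-1 : R) y (e b) by exact: derivable_const.
  exact: derivable_mul dc (Cinf_derivable (Cinf_derive (e a) (smooth_h k l)) y0).
have da a b : derivable (alpha k l a) y (e b).
  exact: Cinf_derivable (smooth_alpha k l a) y0.
have dE a b : 'D_(e b) (christoffel_variation h l a k) y =
    2%:R^-1 * 'D_(e b) ('D_(e a) (h k l)) y + 'D_(e b) (alpha k l a) y.
  have -> : christoffel_variation h l a k =
      (fun z => 2%:R^-1 * 'D_(e a) (h k l) z + alpha k l a z).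
    by apply/funext => z; exact: cvE.
  rewrite [LHS](derive_add (dh a b) (da a b)); congr (_ + _).
  have dc : derivable (fun=> 2%:R^-1 : R) y (e b) by exact: derivable_const.
  have d2 : derivable ('D_(e a) (h k l)) y (e b).
    exact: Cinf_derivable (Cinf_derive (e a) (smooth_h k l)) y0.
  by rewrite (derive_mul dc d2) derive_constant mul0r add0r.
have := flat l k i j y y0; rewrite !dE (swap (e i) (e j) (smooth_h k l) y0).
by move/addrI.
Qed.

(* The rotation w has gradient alpha.  Since h is homogeneous of degree 0 and
   annihilates radial vectors, eta_j = \sum_k y_k w_kj already has symmetrized
   derivative h, without a second integration. *)
Lemma deformation_of_flat_variation : flat_variation ->
  exists w : 'I_3 -> 'I_3 -> 'rV[R]_3 -> R,
  [/\ forall k l, Cinf P (w k l), forall k l y, w k l y = - w l k y &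
      forall i j y, y != 0 ->
      'D_(e i) (fun y : 'rV[R]_3 => \sum_k y 0 k * w k j y) y +
      'D_(e j) (fun y : 'rV[R]_3 => \sum_k y 0 k * w k i y) y = h i j y].
Proof.
move=> flat.
have ex (kl : 'I_3 * 'I_3) : exists w, Cinf P w /\
    forall j y, y != 0 -> 'D_(e j) w y = alpha kl.1 kl.2 j y.
  apply: poincare_punctured => [i|i j y y0]; first exact: smooth_alpha.
  exact: closed_alpha.
have [w0 w0P] := choice ex.
(* The primitives for (k, l) and (l, k) are chosen independently, so they are opposite only up to a
   constant. Antisymmetrizing removes it and keeps the gradient, [alpha] being antisymmetric in [k]
   and [l]. *)
pose w k l (y : 'rV[R]_3) := 2%:R^-1 * (w0 (k, l) y - w0 (l, k) y).
have cw k l : Cinf P (w k l).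
  apply: Cinf_mul => //; first exact: Cinf_cst.
  apply: Cinf_add => //; first by have [] := w0P (k, l).
  by apply: Cinf_opp => //; have [] := w0P (l, k).
have dw k l j y : P y -> 'D_(e j) (w k l) y = alpha k l j y.
  move=> Py; have [c1 d1] := w0P (k, l); have [c2 d2] := w0P (l, k).
  have dd1 := Cinf_derivable c1 Py (v := e j).
  have dd2 := Cinf_derivable c2 Py (v := e j).
  have dc : derivable (fun=> 2%:R^-1 : R) y (e j) by exact: derivable_const.
  rewrite [LHS](derive_mul dc (derivable_sub dd1 dd2)) derive_constant mul0r add0r.
  rewrite (derive_sub dd1 dd2) d1 // d2 // /alpha /=.
  by field.
exists w; split=> // [k l y|]; first by rewrite /w -mulrN opprB.
have deta i j y : P y -> 'D_(e i) (fun y : 'rV[R]_3 => \sum_k y 0 k * w k j y) y =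
    w i j y + 2%:R^-1 * h i j y.
  move=> Py.
  have dx k : derivable (fun z : 'rV[R]_3 => z 0 k) y (e i).
    exact: (Cinf_derivable (Cinf_coord P k) Py).
  have ex1 k : 'D_(e i) (fun z : 'rV[R]_3 => z 0 k) y = (k == i)%:R.
    have [|_ ->] := @is_derive_affine _ _ (fun z : 'rV[R]_3 => z 0 k)
      (fun z => z 0 k) y (e i); last by rewrite mxE eqxx.
    by move=> a v z; rewrite !mxE.
  have dwk k := Cinf_derivable (cw k j) Py (v := e i).
  have dhk k := Cinf_derivable (smooth_h k i) Py (v := e j).
  rewrite (derive_sumf (fun k => derivable_mul (dx k) (dwk k))).
  under eq_bigr do rewrite (derive_mul (dx _) (dwk _)) ex1 (dw _ _ _ _ Py).
  rewrite big_split /= (bigD1 i) //= eqxx mul1r big1 ?addr0; last first.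
    by move=> k /negbTE ->; rewrite mul0r.
  congr (_ + _).
  (* The first sum is the radial derivative of [h i j], zero by homogeneity. The second equals
     [- h i j], by differentiating \sum_k y_k h_ki = 0 along [e j]. *)
  transitivity (2%:R^-1 * (\sum_k y 0 k * 'D_(e k) (h i j) y -
                           \sum_k y 0 k * 'D_(e j) (h k i) y)).
    rewrite -sumrB mulr_sumr; apply: eq_bigr => k _; rewrite /alpha.
    have -> : 'D_(e j) (h k i) y = 'D_(e j) (h i k) y.
      by apply: derive_eq => // z _; exact: sym_h.
    by ring.
  rewrite -(derive_partials _ oP Py (smooth_h i j)) euler_h // sub0r; congr (_ * _).
  have dxj k : derivable (fun z : 'rV[R]_3 => z 0 k) y (e j).
    exact: (Cinf_derivable (Cinf_coord P k) Py).
  have exj k : 'D_(e j) (fun z : 'rV[R]_3 => z 0 k) y = (k == j)%:R.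
    have [|_ ->] := @is_derive_affine _ _ (fun z : 'rV[R]_3 => z 0 k)
      (fun z => z 0 k) y (e j); last by rewrite mxE eqxx.
    by move=> a v z; rewrite !mxE.
  have : 'D_(e j) (fun z : 'rV[R]_3 => \sum_k z 0 k * h k i z) y = 0.
    transitivity ('D_(e j) (fun=> 0 : R) y); last exact: derive_constant.
    by apply: derive_eq => // z; exact: radial_h.
  rewrite (derive_sumf (fun k => derivable_mul (dxj k) (dhk k))).
  under eq_bigr do rewrite (derive_mul (dxj _) (dhk _)) exj.
  rewrite big_split /= (bigD1 j) //= eqxx mul1r big1 ?addr0; last first.
    by move=> k /negbTE ->; rewrite mul0r.
  by move/eqP; rewrite addrC addr_eq0 => /eqP ->; rewrite opprK sym_h.
move=> i j y y0; rewrite !deta // (sym_h j i).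
have -> : w j i y = - w i j y by rewrite /w -mulrN opprB.
by field.
Qed.

End Compatibility.

(** * The warped metric in Cartesian coordinates *)

Lemma polar_dot {R : realType} (o a b : 'rV[R]_3) (p q c d : R) :
  dot o o = 1 -> dot o a = 0 -> dot o b = 0 ->
  dot (p *: o + c *: a) (q *: o + d *: b) = p * q + c * d * dot a b.
Proof.
move=> oo oa ob; rewrite !(dotDl, dotDr, dotZl, dotZr) oo ob (dotC a o) oa.
ring.
Qed.

(** One Gram entry as a function of t: [p] stands for [rho], [a] for [r], [A] for the product of the
    derivatives of [Phi], [bi], [bj] for those of [r], and [ci], [cj] for those of [s]. *)
Lemma derive_conformal_factor {R : realType} (c0 p a s A bi ci bj cj : R) : a != 0 ->
  'D_(1 : R) (fun t : R => c0 + (p * (t * s + a)^-1) * (p * (t * s + a)^-1)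
    * (A - (t * ci + bi) * (t * cj + bj))) (0 : R) =
  - (2%:R * p ^+ 2 * s / a ^+ 3) * (A - bi * bj)
  - (p / a) ^+ 2 * (bi * cj + ci * bj).
Proof.
move=> a0; pose q (t : R) := t * s + a.
have qn0 : q 0 != 0 by rewrite /q mul0r add0r.
have cst (b : R) : derivable (fun=> b) (0 : R) (1 : R) by exact: derivable_const.
have [dq eq] : is_derive (0 : R) (1 : R) q s by exact: is_derive_scale_param.
have [di ei] := is_derive_scale_param ci bi 0.
have [dj ej] := is_derive_scale_param cj bj 0.
have dv := derivable_inv qn0 dq.
have du := derivable_mul (cst p) dv.
have dB := derivable_sub (cst A) (derivable_mul di dj).
rewrite [LHS](derive_add (cst _) (derivable_mul (derivable_mul du du) dB)).
rewrite derive_constant add0r (derive_mul (derivable_mul du du) dB).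
rewrite (derive_sub (cst A) (derivable_mul di dj)) (derive_mul di dj).
rewrite (derive_mul du du) (derive_mul (cst p) dv) (derive_inv qn0 dq).
rewrite !derive_constant eq ei ej /q !mul0r !add0r.
by field.
Qed.

Section Polar.
Context {R : realType}.
Local Notation P := ([set y : 'rV[R]_3 | y != 0]).
Local Notation om := (@radial_proj R).
Local Notation rho := (@enorm R).

Lemma Cinf_enorm : Cinf P rho.
Proof.
apply: Cinf_sqrt => [|y y0|]; [exact: open_neq0|by rewrite dot_gt0|].
by apply: Cinf_dot; [exact: open_neq0|move=> i; exact: Cinf_coord..].
Qed.

Lemma enorm_neq0 y : P y -> rho y != 0.
Proof. by move=> y0; rewrite gt_eqF // enorm_gt0. Qed.

Lemma CinfV_radial_proj : CinfV P om.
Proof.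
apply: CinfV_scale; [exact: open_neq0| |by move=> i; exact: Cinf_coord].
by apply: Cinf_inv; [exact: open_neq0|exact: enorm_neq0|exact: Cinf_enorm].
Qed.

Lemma radial_proj_sphere x : enorm x = 1 -> radial_proj x = x :> 'rV[R]_3.
Proof. by move=> x1; rewrite /radial_proj x1 invr1 scale1r. Qed.

Lemma dot_radial_proj y : P y -> dot (om y) (om y) = 1.
Proof. by move=> y0; rewrite -sqr_enorm enorm_radial_proj // mulr1. Qed.

Section At.
Variables (y : 'rV[R]_3).
Hypothesis y0 : P y.
Implicit Types v w : 'rV[R]_3.

Lemma derivable_enorm v : derivable rho y v.
Proof. exact: Cinf_derivable Cinf_enorm y0. Qed.

Lemma derivable_radial_proj v : derivable om y v.
Proof. exact: CinfV_derivable CinfV_radial_proj y0. Qed.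

Lemma dot_derive_radial_proj v : dot (om y) ('D_v om y) = 0.
Proof.
have d : derivable om y v by exact: derivable_radial_proj.
have : 'D_v (fun z => dot (om z) (om z)) y = 0.
  transitivity ('D_v (fun=> 1 : R) y); last exact: derive_constant.
  by apply: near_eq_derive; apply: near_open open_neq0 y0 _; exact: dot_radial_proj.
rewrite (derive_dot d d) (dotC ('D_v om y)) => e.
by lra.
Qed.

(** Leibniz rule for [z = rho z *: om z]. *)
Lemma polar_decomposition v : v = 'D_v rho y *: om y + rho y *: 'D_v om y.
Proof.
have d1 : derivable rho y v by exact: derivable_enorm.
have d2 : derivable om y v by exact: derivable_radial_proj.
rewrite -(derive_scalev d1 d2).
transitivity ('D_v id y); first by rewrite derive_id.
apply: near_eq_derive; apply: near_open open_neq0 y0 _ => z z0.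
by rewrite enorm_scale_radial_proj.
Qed.

End At.

End Polar.

Lemma Cinf_comp_snd {R : realType} {E : normedModType R} (U : set E)
    (W : set (R * E)) (F : E -> R) : (forall z, W z -> U z.2) -> Cinf U F ->
  Cinf W (fun z => F z.2).
Proof.
move=> WU cF k.
apply: (@Ck_precomp_affine _ _ _ k W U (fun z => z.2) (fun z => z.2) F _ _ WU (cF k)).
  by move=> x; exact: cvg_snd.
by [].
Qed.

Section Warped.
Context {R : realType}.
Local Notation P := ([set y : 'rV[R]_3 | y != 0]).
Local Notation om := (@radial_proj R).
Local Notation rho := (@enorm R).
Local Notation e i := (delta_mx 0 i : 'rV[R]_3).
Variables (r s : 'rV[R]_3 -> R) (Phi : 'rV[R]_3 -> 'rV[R]_3).
Hypothesis smooth_r : Cinf P r.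
Hypothesis smooth_s : Cinf P s.
Hypothesis r_gt0 : forall y, P y -> 0 < r y.
Hypothesis r_homogeneous : forall (c : R) y, 0 < c -> r (c *: y) = r y.
Hypothesis s_homogeneous : forall (c : R) y, 0 < c -> s (c *: y) = s y.
Hypothesis PhiE : forall y, P y -> Phi y = r y *: om y.

Let oP : open P := open_neq0.

Definition gram (t : R) (y : 'rV[R]_3) : 'M[R]_3 := \matrix_(i, j)
  ('D_(e i) rho y * 'D_(e j) rho y
   + (rho y / (r y + t * s y)) ^+ 2
   * (dot ('D_(e i) Phi y) ('D_(e j) Phi y)
      - 'D_(e i) (fun z => r z + t * s z) y * 'D_(e j) (fun z => r z + t * s z) y)).

(* The derivative at t = 0 of gram t, see gram_variation. *)
Definition hform (y v w : 'rV[R]_3) : R :=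
  - 2%:R * (s y / r y) * rho y ^+ 2 * dot ('D_v om y) ('D_w om y)
  - (rho y / r y) ^+ 2 * ('D_v r y * 'D_w s y + 'D_v s y * 'D_w r y).

Section At.
Variable y : 'rV[R]_3.
Hypothesis y0 : P y.

Let dr v : derivable r y v.
Proof. exact: Cinf_derivable smooth_r y0. Qed.

Let ds v : derivable s y v.
Proof. exact: Cinf_derivable smooth_s y0. Qed.

Let rn0 : r y != 0.
Proof. by rewrite gt_eqF // r_gt0. Qed.

Lemma derive_Phi v : 'D_v Phi y = 'D_v r y *: om y + r y *: 'D_v om y.
Proof.
have d1 : derivable r y v by exact: dr.
have d2 : derivable om y v by exact: derivable_radial_proj.
rewrite -(derive_scalev d1 d2).
by apply: near_eq_derive; apply: near_open oP y0 _; exact: PhiE.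
Qed.

Let derive_rts t v : 'D_v (fun z => r z + t * s z) y = 'D_v r y + t * 'D_v s y.
Proof.
have dc : derivable (fun=> t) y v by exact: derivable_const.
have d1 : derivable r y v by exact: dr.
have d2 : derivable s y v by exact: ds.
rewrite (derive_add d1 (derivable_mul dc d2)) (derive_mul dc d2).
by rewrite derive_constant mul0r add0r.
Qed.

Let dot_dPhi v w : dot ('D_v Phi y) ('D_w Phi y) =
  'D_v r y * 'D_w r y + r y * r y * dot ('D_v om y) ('D_w om y).
Proof.
rewrite !derive_Phi; apply: polar_dot; first exact: dot_radial_proj.
  exact: dot_derive_radial_proj.
exact: dot_derive_radial_proj.
Qed.

Lemma gramE t i j : gram t y i j = 'D_(e i) rho y * 'D_(e j) rho y
   + (rho y * (r y + t * s y)^-1) * (rho y * (r y + t * s y)^-1)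
   * (dot ('D_(e i) Phi y) ('D_(e j) Phi y)
      - ('D_(e i) r y + t * 'D_(e i) s y) * ('D_(e j) r y + t * 'D_(e j) s y)).
Proof. by rewrite mxE !derive_rts expr2. Qed.

(** The metric induced by [Phi = r om] is dr^2 + r^2 |d om|^2. Removing dr^2 and rescaling by (rho /
    r)^2 leaves rho^2 |d om|^2, the spherical part of the Euclidean metric. *)
Lemma gram0 : gram 0 y = 1%:M.
Proof.
apply/matrixP => i j; rewrite gramE !mul0r !addr0 dot_dPhi.
have -> : (1%:M : 'M[R]_3) i j = dot (e i) (e j).
  rewrite /dot (bigD1 i) //= big1 ?addr0 => [|k ki].
    by rewrite !mxE !eqxx mul1r.
  by rewrite !mxE (negbTE ki) andbF mul0r.
rewrite [in RHS](polar_decomposition y0 (e i)) [in RHS](polar_decomposition y0 (e j)).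
rewrite (polar_dot _ _ _ _ (dot_radial_proj y0) (dot_derive_radial_proj y0 _)
  (dot_derive_radial_proj y0 _)).
move: rn0; move: (r y) ('D_(e i) rho y) ('D_(e j) rho y) ('D_(e i) r y) ('D_(e j) r y).
move: (dot _ _) (rho y) => A c a p q u v a0.
by field.
Qed.

Lemma gram_variation i j :
  metric_variation gram i j y = hform y (e i) (e j).
Proof.
rewrite /metric_variation -(derive_slice1 (fun z : R * 'rV[R]_3 => gram z.1 z.2 i j)) /=.
transitivity ('D_(1 : R) (fun t : R => 'D_(e i) rho y * 'D_(e j) rho y
   + (rho y * (t * s y + r y)^-1) * (rho y * (t * s y + r y)^-1)
   * (dot ('D_(e i) Phi y) ('D_(e j) Phi y)
      - (t * 'D_(e i) s y + 'D_(e i) r y) * (t * 'D_(e j) s y + 'D_(e j) r y))) (0 : R)).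
  congr (derive _ _ _); apply/funext => t.
  by rewrite gramE (addrC (r y)) (addrC ('D_(e i) r y)) (addrC ('D_(e j) r y)).
rewrite derive_conformal_factor // dot_dPhi /hform.
move: rn0; move: (r y) (s y) (rho y) => a b c a0.
move: ('D_(e i) r y) ('D_(e j) r y) ('D_(e i) s y) ('D_(e j) s y) (dot _ _) => *.
by field.
Qed.

End At.

Let smooth_Phi : CinfV P Phi.
Proof.
apply: (CinfV_eq oP (g1 := fun y => r y *: om y)) => [y y0|].
  by rewrite PhiE.
by apply: CinfV_scale => //; exact: CinfV_radial_proj.
Qed.

Let W1 : set (R * 'rV[R]_3) := [set z | [set: R * 'rV[R]_3] z /\ P z.2].

Let W : set (R * 'rV[R]_3) := [set z | W1 z /\ (r z.2 + z.1 * s z.2) != 0].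

Let oW1 : open W1.
Proof.
by apply: (open_preimage (@openT _) oP) => z _; exact: cvg_snd.
Qed.

Let smooth_q : Cinf W1 (fun z : R * 'rV[R]_3 => r z.2 + z.1 * s z.2).
Proof.
have sub (z : R * 'rV[R]_3) : W1 z -> P z.2 by case.
apply: Cinf_add => //; first exact: Cinf_comp_snd smooth_r.
apply: Cinf_mul => //; first exact: Cinf_fst.
exact: Cinf_comp_snd smooth_s.
Qed.

Let oW : open W.
Proof.
apply: (open_preimage (V := [set x : R | x != 0]) oW1 open_neq0) => z Wz.
exact: Cinf_continuous smooth_q Wz.
Qed.

Let gram_smooth i j : Cinf W (fun z => gram z.1 z.2 i j).
Proof.
have sub (z : R * 'rV[R]_3) : W z -> P z.2 by case=> -[].
have lift (F : 'rV[R]_3 -> R) (cF : Cinf P F) : Cinf W (fun z => F z.2).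
  exact: Cinf_comp_snd sub cF.
have lin a b : Cinf P a -> Cinf P b -> Cinf W (fun z : R * 'rV[R]_3 => a z.2 + z.1 * b z.2).
  move=> ca cb; apply: (Cinf_add oW (lift a ca)).
  exact: (Cinf_mul oW (Cinf_fst W) (lift b cb)).
have cu : Cinf W (fun z => rho z.2 * (r z.2 + z.1 * s z.2)^-1).
  apply: (Cinf_mul oW (lift _ (@Cinf_enorm R))).
  apply: (Cinf_inv oW _ (lin r s smooth_r smooth_s)).
  by move=> z [].
have H1 : Cinf W (fun z => 'D_(e i) rho z.2 * 'D_(e j) rho z.2).
  exact: (Cinf_mul oW (lift _ (Cinf_derive (e i) (@Cinf_enorm R)))
    (lift _ (Cinf_derive (e j) (@Cinf_enorm R)))).
have H2 : Cinf W (fun z => dot ('D_(e i) Phi z.2) ('D_(e j) Phi z.2)).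
  apply: (lift (fun y => dot ('D_(e i) Phi y) ('D_(e j) Phi y))).
  by apply: Cinf_dot => //; exact: CinfV_derive oP smooth_Phi.
have cD v : Cinf W (fun z => 'D_v r z.2 + z.1 * 'D_v s z.2).
  exact: (lin _ _ (Cinf_derive v smooth_r) (Cinf_derive v smooth_s)).
have H3 := Cinf_mul oW (cD (e i)) (cD (e j)).
have H4 := Cinf_add oW H2 (Cinf_opp oW H3).
apply: (Cinf_eq oW _ (Cinf_add oW H1 (Cinf_mul oW (Cinf_mul oW cu cu) H4))).
by move=> z /sub z0; rewrite gramE.
Qed.

Local Notation h := (fun i j y => hform y (e i) (e j)).

Lemma riemann_gram_variation l k i j y : P y ->
  (riemann (gram t) l k i j y - riemann (gram 0) l k i j y) / t
    @[t --> (0 : R)^'] -->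
  'D_(e i) (christoffel_variation h l j k) y
  - 'D_(e j) (christoffel_variation h l i k) y.
Proof.
move=> y0.
have YW z : P z -> W (0, z).
  move=> z0; split=> //=.
  by rewrite mul0r addr0 gt_eqF // r_gt0.
have := riemann_linearization oW oP gram_smooth YW gram0 (l := l) (k := k) (i := i) (j := j) y0.
have cvE a b c z : P z -> christoffel_variation (metric_variation gram) a b c z =
    christoffel_variation h a b c z.
  move=> z0; rewrite /christoffel_variation; congr (_ * (_ + _ - _));
    by apply: near_eq_derive; apply: near_open oP z0 _ => z' z'0; exact: gram_variation.
have dE a b c d : 'D_(e a) (christoffel_variation (metric_variation gram) b c d) y =
    'D_(e a) (christoffel_variation h b c d) y.
  by apply: near_eq_derive; apply: near_open oP y0 _ => z z0; exact: cvE.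
have transfer (f : R -> R) (A B A' B' : R) : A = A' -> B = B' ->
    f t @[t --> (0 : R)^'] --> A - B -> f t @[t --> (0 : R)^'] --> A' - B'.
  by move=> -> ->.
exact: transfer (dE i l j k) (dE j l i k).
Qed.

Lemma hform_sym y v w : hform y v w = hform y w v.
Proof.
have alg (a b c d : R) : a * b + c * d = d * c + b * a by ring.
by rewrite /hform (dotC ('D_v om y) ('D_w om y))
  (alg ('D_v r y) ('D_w s y) ('D_v s y) ('D_w r y)).
Qed.

Lemma hform_smooth v w : Cinf P (fun y => hform y v w).
Proof.
have rn0 y : P y -> r y != 0 by move=> /r_gt0 ?; rewrite gt_eqF.
have ci := Cinf_inv oP rn0 smooth_r.
have cr u := Cinf_derive u smooth_r.
have cs u := Cinf_derive u smooth_s.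
have co u := CinfV_derive u oP (@CinfV_radial_proj R).
have ce := @Cinf_enorm R.
have c1 := Cinf_mul oP (Cinf_mul oP (Cinf_mul oP (Cinf_cst P (- 2%:R : R))
  (Cinf_mul oP smooth_s ci)) (Cinf_mul oP ce ce)) (Cinf_dot oP (co v) (co w)).
have cq := Cinf_mul oP ce ci.
have c2 := Cinf_mul oP (Cinf_mul oP cq cq)
  (Cinf_add oP (Cinf_mul oP (cr v) (cs w)) (Cinf_mul oP (cs v) (cr w))).
apply: (Cinf_eq oP _ (Cinf_add oP c1 (Cinf_opp oP c2))) => y y0.
by rewrite /hform !expr2.
Qed.

Lemma hform_partials y v w : P y ->
  hform y v w = \sum_i v 0 i * hform y (e i) w.
Proof.
move=> y0; rewrite /hform.
rewrite (derive_partialsV v oP y0 (@CinfV_radial_proj R)).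
rewrite (derive_partials v oP y0 smooth_r) (derive_partials v oP y0 smooth_s).
have -> : dot (\sum_i v 0 i *: 'D_(e i) om y) ('D_w om y) =
    \sum_i v 0 i * dot ('D_(e i) om y) ('D_w om y).
  rewrite (big_morph (fun u => dot u ('D_w om y)) (id1 := 0) (op1 := +%R)).
  - by apply: eq_bigr => i _; rewrite dotZl.
  - by move=> u u'; rewrite dotDl.
  - by rewrite /dot big1 // => i _; rewrite mxE mul0r.
rewrite !mulr_suml -big_split !mulr_sumr -sumrB; apply: eq_bigr => i _ /=.
move: (s y / r y) (rho y) (rho y / r y) (dot _ _) (v 0 i) => *.
move: ('D_(e i) r y) ('D_w r y) ('D_(e i) s y) ('D_w s y) => *.
by ring.
Qed.

(** [r], [s] and [om] are homogeneous of degree 0, and every term of [hform] contains a derivative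
    of one of them along the radial argument. *)
Lemma hform_radial y w : P y -> hform y y w = 0.
Proof.
move=> y0.
have oh (c : R) : 0 < c -> om (c *: y) = om y by exact: radial_projZ.
have [_ o0] := derive_homogeneous0 oh.
have [_ r0] := derive_homogeneous0 (fun c => r_homogeneous (c := c) y).
have [_ s0] := derive_homogeneous0 (fun c => s_homogeneous (c := c) y).
rewrite /hform o0 r0 s0 /dot big1 => [|i _]; last by rewrite mxE mul0r.
by rewrite !mul0r addr0 !mulr0 subr0.
Qed.

(** The two derivatives in each term contribute a factor c^-2, compensated by [rho ^+ 2]. *)
Lemma hform_homogeneous (c : R) y v w : 0 < c -> P y ->
  hform (c *: y) v w = hform y v w.
Proof.
move=> c0 y0; have cn0 : c != 0 by rewrite gt_eqF.
have cy0 : P (c *: y) by rewrite /= scaler_eq0 negb_or cn0.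
have oE u : 'D_u om (c *: y) = c^-1 *: 'D_u om y.
  rewrite -(derive_scale_arg y u c0 (fun a z a0 => radial_projZ z a0)).
  rewrite (derive_scale_dirV u c oP cy0 (@CinfV_radial_proj R)).
  by rewrite scalerA mulVf // scale1r.
have fE f u : Cinf P f -> (forall (a : R) z, 0 < a -> f (a *: z) = f z) ->
    'D_u f (c *: y) = c^-1 * 'D_u f y.
  move=> cf hf; rewrite -(derive_scale_arg y u c0 hf).
  by rewrite (derive_scale_dir u c oP cy0 cf) mulrA mulVf // mul1r.
have rE u := fE r u smooth_r r_homogeneous.
have sE u := fE s u smooth_s s_homogeneous.
rewrite /hform !oE !rE !sE enormZ ?(ltW c0) // r_homogeneous // s_homogeneous //.
rewrite dotZl dotZr; have rn0 : r y != 0 by rewrite gt_eqF // r_gt0.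
move: rn0; move: (r y) (s y) (rho y) (dot _ _) => a b p A a0.
move: ('D_v r y) ('D_w r y) ('D_v s y) ('D_w s y) => *.
by field; rewrite cn0 a0.
Qed.

Lemma hform_euler y v w : P y -> 'D_y (fun y => hform y v w) y = 0.
Proof.
move=> y0; have hh (c : R) : 0 < c -> hform (c *: y) v w = hform y v w.
  by move=> c0; exact: hform_homogeneous.
by have [] := derive_homogeneous0 (f := fun y => hform y v w) hh.
Qed.

End Warped.

(** * Isometric deformations *)

Section DotAlgebra.
Context {R : realType}.
Implicit Types (o N A a b : 'rV[R]_3).

(** Expansion of the product of d_v (r N + s o) and d_w (r o): [A] is d_v N, [a] and [b] are d_v o
    and d_w o, while [p], [q], [t], [u] are d_v r, d_w r, d_v s, s. *)
Lemma deformation_dot o N A a b (p q r t u : R) :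
  dot o o = 1 -> dot o a = 0 -> dot o b = 0 -> dot N o = 0 ->
  dot (p *: N + r *: A + (t *: o + u *: a)) (q *: o + r *: b) =
  p * r * dot N b + r * q * dot A o + r ^+ 2 * dot A b + t * q + u * r * dot a b.
Proof.
move=> oo oa ob No; rewrite !(dotDl, dotDr, dotZl, dotZr) oo ob No (dotC a o) oa.
ring.
Qed.

(** [Nvw], [Nvo], [Nv], [X] stand for the products of d_v N with d_w om, of d_v N with om, of N with
    d_v om, and of d_v om with d_w om. Orthogonality of N and om gives [Nvo = - Nv], which cancels
    every term with a derivative of [r] against N. The isometry equation then gives [Nvw + Nwv], and
    on the right the derivatives of [c] cancel likewise, leaving [c ^+ 2 * (Nvw + Nwv)]. *)
Lemma isometry_variation_algebra (r s c rv rw sv sw : R) (Nvw Nwv Nvo Nwo Nv Nw X : R) :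
  r != 0 -> Nvo = - Nv -> Nwo = - Nw ->
  (rv * r * Nw + r * rw * Nvo + r ^+ 2 * Nvw + sv * rw + s * r * X) +
  (rw * r * Nv + r * rv * Nwo + r ^+ 2 * Nwv + sw * rv + s * r * X) = 0 ->
  forall cv cw,
  - 2%:R * (s / r) * c ^+ 2 * X - (c / r) ^+ 2 * (rv * sw + sv * rw) =
  (cv * c * Nw + c * cw * Nvo + c ^+ 2 * Nvw) +
  (cw * c * Nv + c * cv * Nwo + c ^+ 2 * Nwv).
Proof.
move=> r0 -> -> iso cv cw.
have r20 : r ^+ 2 != 0 by rewrite expf_neq0.
have E : r ^+ 2 * (Nvw + Nwv) = - (sv * rw + sw * rv + 2%:R * s * r * X).
  by apply/eqP; rewrite -subr_eq0 opprK; apply/eqP; rewrite -[RHS]iso; ring.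
have {}E : Nvw = - (sv * rw + sw * rv + 2%:R * s * r * X) / r ^+ 2 - Nwv.
  by rewrite -E; field.
by rewrite E; field.
Qed.

End DotAlgebra.

Section Curves.
Context {R : realType}.

Lemma derive_curve m n (U : set 'rV[R]_n) (X : 'rV[R]_n -> 'rV[R]_m)
    (c : R -> 'rV[R]_n) (u : R) :
  open U -> U (c u) -> CinfV U X -> derivable c u 1 ->
  derivable (X \o c) u 1 /\ 'D_1 (X \o c) u = 'D_('D_1 c u) X (c u).
Proof.
move=> oU Uc cX dc; have dci := (derivable_coord _ _ _).1 dc.
have H j := Cinf_chain oU Uc (cX j) dci.
have dXc : derivable (X \o c) u 1.
  by apply/derivable_coord => j; have [] := H j.
split; first exact: dXc.
apply/rowP => j; rewrite (derive_coord j dXc).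
rewrite derive_coord; last exact: CinfV_derivable cX Uc.
have [_ ->] := H j; rewrite (derive_partials _ oU Uc (cX j)).
by apply: eq_bigr => i _; rewrite mulrC derive_coord.
Qed.

Lemma is_derive_quadratic (c0 c1 c2 : R) :
  is_derive (0 : R) (1 : R) (fun t : R => (t * c2 + c1) * t + c0) c1.
Proof.
have [d1 e1] := is_derive_scale_param c2 c1 0.
have d2 : derivable (fun t : R => t) (0 : R) 1 by exact: derivable_id.
have d3 : derivable (fun=> c0) (0 : R) (1 : R) by exact: derivable_const.
split; first exact: derivable_add (derivable_mul d1 d2) d3.
rewrite [LHS](derive_add (derivable_mul d1 d2) d3) derive_constant addr0.
by rewrite (derive_mul d1 d2) derive_id mulr0 !add0r mul0r add0r mulr1.
Qed.

Lemma is_derive_dot_line (A B A' B' : 'rV[R]_3) :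
  is_derive (0 : R) (1 : R) (fun t : R => dot (A + t *: B) (A' + t *: B'))
    (dot A B' + dot B A').
Proof.
have -> : (fun t : R => dot (A + t *: B) (A' + t *: B')) =
    (fun t : R => (t * dot B B' + (dot A B' + dot B A')) * t + dot A A').
  apply/funext => t; rewrite !(dotDl, dotDr, dotZl, dotZr); ring.
exact: is_derive_quadratic.
Qed.

Lemma Cinf_line {E : normedModType R} (U : set E) (f : E -> R) (x v : E) :
  (forall u : R, U (u *: v + x)) -> Cinf U f ->
  Cinf setT (fun u : R => f (u *: v + x)).
Proof.
move=> Ul cf k.
apply: (@Ck_precomp_affine _ _ _ k setT U (fun u : R => u *: v + x)
  (fun a : R => a *: v) f _ _ _ (cf k)) => //.
- by move=> u; exact: cvg_line.
- by move=> h a u; rewrite scalerDl scalerA addrA.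
Qed.

End Curves.

Section IsometricDeformations.
Context {R : realType}.
Local Notation P := ([set y : 'rV[R]_3 | y != 0]).
Local Notation om := (@radial_proj R).
Local Notation rho := (@enorm R).
Local Notation e i := (delta_mx 0 i : 'rV[R]_3).
Variables (r s : 'rV[R]_3 -> R) (Phi : 'rV[R]_3 -> 'rV[R]_3).
Hypothesis smooth_r : Cinf P r.
Hypothesis smooth_s : Cinf P s.
Hypothesis r_gt0 : forall y, P y -> 0 < r y.
Hypothesis PhiE : forall y, P y -> Phi y = r y *: om y.

Let oP : open P := open_neq0.

(* The component of Xi orthogonal to om, if s is the inner product of Xi and om,
   rescaled so that it is unchanged on M, where r y = rho y. *)
Definition radial_extension (Xi : 'rV[R]_3 -> 'rV[R]_3) (y : 'rV[R]_3) : 'rV[R]_3 :=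
  rho y *: ((r y)^-1 *: (Xi y + (- s y) *: om y)).

Lemma radial_extension_smooth Xi : CinfV P Xi -> CinfV P (radial_extension Xi).
Proof.
move=> cXi; apply: CinfV_scale => //; first exact: Cinf_enorm.
apply: CinfV_scale => //.
  by apply: Cinf_inv => // y y0; rewrite gt_eqF // r_gt0.
apply: CinfV_add => //; apply: CinfV_scale => //; last exact: CinfV_radial_proj.
exact: Cinf_opp.
Qed.

(** Write [Xi = r N + s om] with N orthogonal to [om]; the extension is [rho N]. Both symmetrized
    products have the same expansion in N, up to replacing [r] by [rho] and the terms in [s], which
    make up [hform]. *)
Lemma hform_of_isometric Xi y v w : P y -> CinfV P Xi ->
  (forall z, P z -> s z = dot (Xi z) (om z)) ->
  dot ('D_v Xi y) ('D_w Phi y) + dot ('D_v Phi y) ('D_w Xi y) = 0 ->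
  hform r s y v w =
  dot ('D_v (radial_extension Xi) y) w + dot v ('D_w (radial_extension Xi) y).
Proof.
move=> y0 cXi sE iso.
have rn0 z : P z -> r z != 0 by move=> /r_gt0 ?; rewrite gt_eqF.
pose N z := (r z)^-1 *: (Xi z + (- s z) *: om z).
have cN : CinfV P N.
  apply: CinfV_scale => //; first by apply: Cinf_inv => // z /rn0.
  apply: CinfV_add => //; apply: CinfV_scale => //; last exact: CinfV_radial_proj.
  exact: Cinf_opp.
have dN u : derivable N y u by exact: CinfV_derivable cN y0.
have dr u : derivable r y u by exact: Cinf_derivable smooth_r y0.
have ds u : derivable s y u by exact: Cinf_derivable smooth_s y0.
have dom u : derivable om y u by exact: derivable_radial_proj.
have drho u : derivable rho y u by exact: derivable_enorm.
have No z : P z -> dot (N z) (om z) = 0.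
  move=> z0; rewrite /N dotZl dotDl dotZl -sE // dot_radial_proj // mulr1 subrr.
  by rewrite mulr0.
have Nou u : dot ('D_u N y) (om y) = - dot (N y) ('D_u om y).
  apply/eqP; rewrite -addr_eq0 -(derive_dot (dN u) (dom u)); apply/eqP.
  transitivity ('D_u (fun=> 0 : R) y); last exact: derive_constant.
  by apply: near_eq_derive; apply: near_open oP y0 _ => z; exact: No.
have XiE z : P z -> Xi z = r z *: N z + s z *: om z.
  move=> z0; rewrite /N scalerA mulfV ?rn0 // scale1r -addrA scaleNr.
  by rewrite addNr addr0.
have dXi u : 'D_u Xi y = 'D_u r y *: N y + r y *: 'D_u N y
    + ('D_u s y *: om y + s y *: 'D_u om y).
  rewrite -(derive_scalev (dr u) (dN u)) -(derive_scalev (ds u) (dom u)).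
  have d1 := derivable_scalev (dr u) (dN u).
  have d2 := derivable_scalev (ds u) (dom u).
  rewrite -(derive_addv d1 d2).
  by apply: near_eq_derive; apply: near_open oP y0 _; exact: XiE.
have deta u : 'D_u (radial_extension Xi) y = 'D_u rho y *: N y + rho y *: 'D_u N y.
  exact: derive_scalev (drho u) (dN u).
have expand u u' (p t : R) (q : R) : dot (p *: N y + q *: 'D_u N y) (t *: om y + q *: 'D_u' om y) =
    p * q * dot (N y) ('D_u' om y) + q * t * dot ('D_u N y) (om y)
    + q ^+ 2 * dot ('D_u N y) ('D_u' om y).
  rewrite -[X in dot X _]addr0 -[X in _ + X](_ : 0 *: om y + 0 *: 'D_u om y = _); last first.
    by rewrite !scale0r addr0.
  rewrite (deformation_dot _ _ _ _ _ _ (dot_radial_proj y0) (dot_derive_radial_proj y0 _)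
    (dot_derive_radial_proj y0 _) (No y y0)).
  by rewrite !mul0r !addr0.
have isoE u u' : dot ('D_u Xi y) ('D_u' Phi y) =
    'D_u r y * r y * dot (N y) ('D_u' om y) + r y * 'D_u' r y * dot ('D_u N y) (om y)
    + r y ^+ 2 * dot ('D_u N y) ('D_u' om y) + 'D_u s y * 'D_u' r y
    + s y * r y * dot ('D_u om y) ('D_u' om y).
  rewrite dXi (derive_Phi smooth_r PhiE y0).
  exact: (deformation_dot _ _ _ _ _ _ (dot_radial_proj y0)
    (dot_derive_radial_proj y0 u) (dot_derive_radial_proj y0 u') (No y y0)).
have etaE u u' : dot ('D_u (radial_extension Xi) y) u' =
    'D_u rho y * rho y * dot (N y) ('D_u' om y)
    + rho y * 'D_u' rho y * dot ('D_u N y) (om y)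
    + rho y ^+ 2 * dot ('D_u N y) ('D_u' om y).
  rewrite deta [X in dot _ X = _](polar_decomposition y0 u'); exact: expand.
have isoE' u u' : dot ('D_u' Phi y) ('D_u Xi y) =
    'D_u r y * r y * dot (N y) ('D_u' om y) + r y * 'D_u' r y * dot ('D_u N y) (om y)
    + r y ^+ 2 * dot ('D_u N y) ('D_u' om y) + 'D_u s y * 'D_u' r y
    + s y * r y * dot ('D_u' om y) ('D_u om y).
  apply: (etrans (dotC _ _)); apply: (etrans (isoE u u')).
  exact: (congr1 (fun x => _ + s y * r y * x) (dotC _ _)).
have add2 (a b a' b' : R) : a = a' -> b = b' -> a + b = a' + b' by move=> -> ->.
have iso2 := etrans (esym (add2 _ _ _ _ (isoE v w) (isoE' w v))) iso.
rewrite /hform.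
apply: (etrans (isometry_variation_algebra (rho y) (rn0 y y0) (Nou v) (Nou w) iso2
  ('D_v rho y) ('D_w rho y))).
apply: esym; exact: (add2 _ _ _ _ (etaE v w) (etrans (dotC _ _) (etaE w v))).
Qed.

(** Where [r = rho], the radial part [s om] contributes the opposite of [hform], once [v] and [w]
    are written as derivatives of [Phi]. *)
Lemma isometric_of_hform (eta : 'rV[R]_3 -> 'rV[R]_3) y v w : P y -> CinfV P eta ->
  (forall v w, dot ('D_v eta y) w + dot v ('D_w eta y) = hform r s y v w) ->
  r y = rho y -> 'D_v Phi y = v -> 'D_w Phi y = w ->
  dot v ('D_w (fun z => eta z + s z *: om z) y) +
  dot ('D_v (fun z => eta z + s z *: om z) y) w = 0.
Proof.
move=> y0 ceta etaE rE Pv Pw.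
have rn0 : r y != 0 by rewrite gt_eqF // r_gt0.
have deta u : derivable eta y u by exact: CinfV_derivable ceta y0.
have ds u : derivable s y u by exact: Cinf_derivable smooth_s y0.
have dom u : derivable om y u by exact: derivable_radial_proj.
have dX u : 'D_u (fun z => eta z + s z *: om z) y =
    'D_u eta y + ('D_u s y *: om y + s y *: 'D_u om y).
  rewrite -(derive_scalev (ds u) (dom u)).
  exact: derive_addv (deta u) (derivable_scalev (ds u) (dom u)).
have key u u' : 'D_u' Phi y = u' ->
    dot ('D_u (fun z => eta z + s z *: om z) y) u' = dot ('D_u eta y) u' +
    ('D_u s y * 'D_u' r y + s y * r y * dot ('D_u om y) ('D_u' om y)).
  move=> Pu'; rewrite dX dotDl; congr (_ + _).
  rewrite -[in LHS]Pu' (derive_Phi smooth_r PhiE y0).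
  exact: (polar_dot _ _ _ _ (dot_radial_proj y0) (dot_derive_radial_proj y0 _)
    (dot_derive_radial_proj y0 _)).
have add2 (a b a' b' : R) : a = a' -> b = b' -> a + b = a' + b' by move=> -> ->.
have alg (a s' c rv rw sv sw X Y x1 x2 : R) : a != 0 -> a = c -> Y = X ->
    x2 + x1 = - 2%:R * (s' / a) * c ^+ 2 * X - (c / a) ^+ 2 * (rv * sw + sv * rw) ->
    (x1 + (sw * rv + s' * a * Y)) + (x2 + (sv * rw + s' * a * X)) = 0.
  move=> a0 <- -> e.
  have -> : x1 = - 2%:R * (s' / a) * a ^+ 2 * X - (a / a) ^+ 2 * (rv * sw + sv * rw) - x2.
    by rewrite -e; ring.
  by field.
apply: (etrans (add2 _ _ _ _ (etrans (dotC _ _) (key w v Pv)) (key v w Pw))).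
apply: (alg _ _ _ _ _ _ _ _ _ _ _ rn0 rE (dotC _ _)).
exact: (etrans (add2 _ _ _ _ erefl (dotC _ _)) (etaE v w)).
Qed.

End IsometricDeformations.

(** * Killing fields homogeneous of degree 1 *)

Section Killing.
Context {R : realType}.
Local Notation P := ([set y : 'rV[R]_3 | y != 0]).
Local Notation e i := (delta_mx 0 i : 'rV[R]_3).

(* The Hessian of a Killing field is antisymmetric in its last two indices and
   symmetric in the first two, hence zero. *)
Lemma killing_homogeneous (eta : 'I_3 -> 'rV[R]_3 -> R) :
  (forall i, Cinf P (eta i)) ->
  (forall i j y, y != 0 -> 'D_(e i) (eta j) y + 'D_(e j) (eta i) y = 0) ->
  (forall i (c : R) y, 0 < c -> y != 0 -> eta i (c *: y) = c * eta i y) ->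
  exists B : 'M[R]_3, (forall i j, B i j = - B j i) /\
    forall j y, y != 0 -> eta j y = \sum_i y 0 i * B i j.
Proof.
move=> ce anti hom; have oP : open P := open_neq0.
have anti' i j y : P y -> 'D_(e i) (eta j) y = - 'D_(e j) (eta i) y.
  by move=> y0; apply/eqP; rewrite -addr_eq0; apply/eqP; exact: anti.
have swap i j k y : P y ->
    'D_(e i) ('D_(e j) (eta k)) y = 'D_(e j) ('D_(e i) (eta k)) y.
  by move=> y0; exact: (derive_commute (e i) (e j) oP y0 (ce k 2%N)).
have danti k i j y : P y ->
    'D_(e k) ('D_(e i) (eta j)) y = - 'D_(e k) ('D_(e j) (eta i)) y.
  move=> y0.
  have d : derivable ('D_(e j) (eta i)) y (e k).
    exact: Cinf_derivable (Cinf_derive (e j) (ce i)) y0.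
  rewrite -(derive_opp d); apply: near_eq_derive.
  by apply: near_open oP y0 _ => z; exact: anti'.
have hess0 k i j y : P y -> 'D_(e k) ('D_(e i) (eta j)) y = 0.
  move=> y0; pose T a b c := 'D_(e a) ('D_(e b) (eta c)) y.
  have sT a b c : T a b c = T b a c by exact: swap.
  have aT a b c : T a b c = - T a c b by exact: danti.
  rewrite -/(T k i j).
  (* Alternating the two symmetries: kij, -kji, -jki, +jik, +ijk, -ikj, -kij. *)
  have E : T k i j = - T k i j.
    by rewrite {1}aT sT aT opprK sT aT sT.
  by lra.
have const i j : exists c, forall y, y != 0 -> 'D_(e i) (eta j) y = c.
  apply: constant_punctured => z v z0; split.
    exact: Cinf_derivable (Cinf_derive (e i) (ce j)) z0.
  rewrite (derive_partials v oP z0 (Cinf_derive (e i) (ce j))) big1 // => k _.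
  by rewrite hess0 // mulr0.
have [b bP] := choice (fun ij : 'I_3 * 'I_3 => const ij.1 ij.2).
have one0 : (const_mx 1 : 'rV[R]_3) != 0.
  by apply/eqP => /rowP /(_ 0); rewrite !mxE => /eqP; rewrite oner_eq0.
exists (\matrix_(i, j) b (i, j)); split=> [i j|j y y0].
  by rewrite !mxE -(bP (i, j) _ one0) -(bP (j, i) _ one0) /= anti'.
(* Euler's identity in degree 1 recovers [eta] from its constant first derivatives, with no constant
   of integration. *)
have h1 (c : R) : 0 < c -> eta j (c *: y) = c * eta j y by move=> c0; exact: hom.
rewrite -(derive_homogeneous1 h1) (derive_partials y oP y0 (ce j)).
by apply: eq_bigr => i _; rewrite mxE -(bP (i, j) y y0).
Qed.

Lemma ord3_cases (j : 'I_3) : [\/ j = 0, j = 1 | j = 2%:R].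
Proof.
case: j => -[|[|[|//]]] ij; [constructor 1|constructor 2|constructor 3];
  exact: val_inj.
Qed.

Lemma ord3_add : ((1 + 1 = 2%:R :> 'I_3)%R * (1 + 2%:R = 0 :> 'I_3)%R *
  (2%:R + 1 = 0 :> 'I_3)%R * (2%:R + 2%:R = 1 :> 'I_3)%R)%type.
Proof. by do !split; exact: val_inj. Qed.

Lemma sum3 (F : 'I_3 -> R) : \sum_i F i = F 0 + F 1 + F 2%:R.
Proof.
rewrite !big_ord_recl big_ord0 addr0 addrA.
by congr (F _ + F _ + F _); exact: val_inj.
Qed.

(** The axial vector of [B] consists of its entries at cyclically consecutive indices modulo 3. *)
Lemma cross_of_antisymmetric (B : 'M[R]_3) (y : 'rV[R]_3) :
  (forall i j, B i j = - B j i) ->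
  \row_j (\sum_i y 0 i * B i j) =
  cross (\row_m B (m + 1) (m + 2%:R)) y.
Proof.
move=> anti; have diag i : B i i = 0 by have := anti i i; lra.
apply/rowP => j; rewrite !mxE sum3.
case: (ord3_cases j) => ->; rewrite ?add0r !ord3_add ?add0r diag.
- by rewrite (anti 1 0); ring.
- by rewrite (anti 2%:R 1); ring.
- by rewrite (anti 0 2%:R); ring.
Qed.

Lemma dot_cross (a y : 'rV[R]_3) : dot (cross a y) y = 0.
Proof.
rewrite /dot sum3 !mxE !ord3_add ?add0r; ring.
Qed.

End Killing.

(** * The two implications for the surface *)

Section Surface.
Context {R : realType}.
Variables M K : set 'rV[R]_3.
Hypothesis hM : smooth_convex_closed_surface M K.
Hypothesis h0 : K° 0.

Local Notation P := ([set y : 'rV[R]_3 | y != 0]).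
Local Notation om := (@radial_proj R).
Local Notation rho := (@enorm R).
Local Notation e i := (delta_mx 0 i : 'rV[R]_3).
Local Notation lam := (ray_scale M).

Let oP : open P := open_neq0.

Let Phi : 'rV[R]_3 -> 'rV[R]_3 := phi0 M \o radial_proj.
Let r (y : 'rV[R]_3) : R := dist_fun M (radial_proj y).

Let PhiM y : P y -> M (Phi y).
Proof. by move=> y0; rewrite /Phi /=; have [_ My ->] := ray_scaleP hM h0 y0. Qed.

Let rE y : P y -> r y = lam y * rho y.
Proof.
move=> y0; rewrite /r /dist_fun; have [l0 _ ->] := ray_scaleP hM h0 y0.
by rewrite enormZ // ltW.
Qed.

Let r_gt0 y : P y -> 0 < r y.
Proof.
move=> y0; rewrite rE // mulr_gt0 ?enorm_gt0 //.
by have [] := ray_scaleP hM h0 y0.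
Qed.

Let r_smooth : Cinf P r.
Proof.
apply: (Cinf_eq oP (f := fun y => lam y * rho y)) => [y y0|].
  by rewrite rE.
exact: Cinf_mul oP (ray_scale_smooth hM h0) (@Cinf_enorm R).
Qed.

Let PhiE y : P y -> Phi y = r y *: om y.
Proof.
move=> y0; rewrite rE // -scalerA enorm_scale_radial_proj //.
by rewrite /Phi /=; have [] := ray_scaleP hM h0 y0.
Qed.

Let Phi_smooth : CinfV P Phi.
Proof.
apply: (CinfV_eq oP (g1 := fun y => r y *: om y)) => [y y0|]; first by rewrite PhiE.
exact: CinfV_scale oP r_smooth (@CinfV_radial_proj R).
Qed.

Let Phi_homogeneous (c : R) y : 0 < c -> Phi (c *: y) = Phi y.
Proof. by move=> c0; rewrite /Phi /= radial_projZ. Qed.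

Let r_homogeneous (c : R) y : 0 < c -> r (c *: y) = r y.
Proof. by move=> c0; rewrite /r radial_projZ. Qed.

Let Phi_surface y : M y -> Phi y = y.
Proof. by move=> My; exact: (phi0_radial_proj hM h0 My). Qed.

Let M_neq0 y : M y -> P y.
Proof. by move=> My; exact: (surface_neq0 hM h0 My). Qed.

Let r_surface y : M y -> r y = rho y.
Proof. by move=> My; exact: (congr1 (@enorm R) (Phi_surface My)). Qed.

(** [xi] has smooth extensions only locally; as [Phi] takes values in [M], any of them may replace
    [xi], and the composite can be differentiated in all directions. *)
Lemma smooth_on_surface_comp (xi : 'rV[R]_3 -> 'rV[R]_3) :
  smooth_on M xi -> CinfV P (xi \o Phi).
Proof.
move=> sxi i; apply: Cinf_local => y y0.
have [U [F [oU UPhi sF FE]]] := sxi _ (PhiM y0).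
pose V := [set z | P z /\ U (Phi z)].
have oV : open V.
  apply: (open_preimage (g := Phi) oP oU) => z z0; apply/continuous_coord => j.
  exact: Cinf_continuous (Phi_smooth j) z0.
exists V; split=> //.
have cF := (smooth_on_open_coord F oU).1 sF.
apply: (Cinf_eq oV (f := fun z => F (Phi z) 0 i)) => [z [z0 Uz]|].
  by rewrite FE //= inE; split => //; exact: PhiM.
apply: (Cinf_comp (f := fun z => F z 0 i) oU oV) => // [z []//|j].
by apply: Cinf_sub (Phi_smooth j) => z [].
Qed.

Lemma smooth_on_sphere_comp (s : 'rV[R]_3 -> R) :
  smooth_on sphere s -> Cinf P (s \o radial_proj).
Proof.
move=> ss; apply: Cinf_local => y y0.
have [|U [F [oU Uy sF FE]]] := ss (om y); first exact: enorm_radial_proj.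
pose V := [set z | P z /\ U (om z)].
have oV : open V.
  apply: (open_preimage (g := om) oP oU) => z z0; apply/continuous_coord => j.
  exact: Cinf_continuous (@CinfV_radial_proj R j) z0.
exists V; split=> //.
have cF := (smooth_on_open_Cinf U F).1 sF.
apply: (Cinf_eq oV (f := fun z => F (om z))) => [z [z0 Uz]|].
  by rewrite /= FE //= inE; split => //; exact: enorm_radial_proj.
apply: (Cinf_comp (f := F) oU oV) => // [z []//|j].
by apply: Cinf_sub (@CinfV_radial_proj R j) => z [].
Qed.

(** The difference quotient always converges to the linearized curvature along [hform]; uniqueness
    of limits gives the equivalence. *)
Lemma curvature_preservingE (s : 'rV[R]_3 -> R) : smooth_on sphere s ->
  curvature_preserving M s <->
  flat_variation (fun i j y => hform r (s \o radial_proj) y (e i) (e j)).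
Proof.
move=> ss; have cs := smooth_on_sphere_comp ss.
have gramE' t : warped_gram (phi0 M) (fun x => dist_fun M x + t * s x) =
    gram r (s \o radial_proj) Phi t.
  by apply/funext => y; apply/matrixP => i j; rewrite !mxE.
have lim l k i j y : P y ->
    (warped_curvature M s t l k i j y - warped_curvature M s 0 l k i j y) / t
      @[t --> (0 : R)^'] -->
    'D_(e i) (christoffel_variation
      (fun i j y => hform r (s \o radial_proj) y (e i) (e j)) l j k) y
    - 'D_(e j) (christoffel_variation
      (fun i j y => hform r (s \o radial_proj) y (e i) (e j)) l i k) y.
  move=> y0; rewrite /warped_curvature gramE'.
  under eq_fun do rewrite gramE'.
  exact: riemann_gram_variation.
split=> [cp l k i j y y0|flat y y0 l k i j].
  apply/eqP; rewrite -subr_eq0; apply/eqP.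
  have H1 := lim l k i j y y0; have H2 := cp y y0 l k i j.
  exact: (norm_cvg_unique H1 H2).
have transfer (f : R -> R) (A B : R) : A = B ->
    f t @[t --> (0 : R)^'] --> A - B -> f t @[t --> (0 : R)^'] --> (0 : R).
  by move=> ->; rewrite subrr.
exact: (transfer _ _ _ (flat l k i j y y0) (lim l k i j y y0)).
Qed.

Lemma derive_radial (X : 'rV[R]_3 -> 'rV[R]_3) y (c : R) : P y -> CinfV P X ->
  (forall (a : R) z, 0 < a -> X (a *: z) = X z) -> 'D_(c *: y) X y = 0.
Proof.
move=> y0 cX hX; rewrite (derive_scale_dirV y c oP y0 cX).
have hXy (a : R) : 0 < a -> X (a *: y) = X y by exact: hX.
by have [_ ->] := derive_homogeneous0 hXy; rewrite scaler0.
Qed.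

Lemma line_curve y v : (forall u : R, P (u *: v + y)) ->
  smooth_curve_in M (fun u : R => Phi (u *: v + y)).
Proof.
move=> Pl; split=> [|u]; last exact: PhiM.
apply/(smooth_on_open_coord _ openT) => i.
exact: (Cinf_line (f := fun z => Phi z 0 i) Pl (Phi_smooth i)).
Qed.

Lemma derive1_deformed_line (X : 'rV[R]_3 -> 'rV[R]_3) y v (t : R) : P y ->
  CinfV P (X \o Phi) ->
  derive1 ((fun x => x + t *: X x) \o (fun u : R => Phi (u *: v + y))) 0 =
  'D_v Phi y + t *: 'D_v (X \o Phi) y.
Proof.
move=> y0 cX; rewrite derive1E.
apply: (etrans (derive_on_line (fun z => Phi z + t *: (X \o Phi) z) y v 0)).
rewrite scale0r add0r.
have d1 : derivable Phi y v by exact: CinfV_derivable Phi_smooth y0.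
have d2 : derivable (X \o Phi) y v by exact: CinfV_derivable cX y0.
have dt : derivable (fun=> t) y v by exact: derivable_const.
rewrite (derive_addv d1 (derivable_scalev dt d2)) (derive_scalev dt d2).
by rewrite derive_constant scale0r add0r.
Qed.

Lemma hform_constant0 (f : 'rV[R]_3 -> R) y v w : hform f (fun=> 0) y v w = 0.
Proof.
have z u : 'D_u (fun _ : 'rV[R]_3 => 0 : R) y = 0 by exact: derive_constant.
have q : - 2%:R * (0 / f y) * enorm y ^+ 2 = 0 by rewrite mul0r mulr0 mul0r.
by rewrite /hform !z q mul0r !mulr0 mul0r addr0 mulr0 subr0.
Qed.

Lemma dot_basis_derivatives (eta : 'rV[R]_3 -> 'rV[R]_3) i j y : P y -> CinfV P eta ->
  dot ('D_(e i) eta y) (e j) + dot (e i) ('D_(e j) eta y) =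
  'D_(e i) (fun y => eta y 0 j) y + 'D_(e j) (fun y => eta y 0 i) y.
Proof.
move=> y0 ceta; have dotd (u : 'rV[R]_3) k : dot u (e k) = u 0 k.
  rewrite /dot (bigD1 k) //= big1 ?addr0; first by rewrite mxE !eqxx mulr1.
  by move=> l lk; rewrite mxE (negbTE lk) andbF mulr0.
rewrite (dotC (e i)) !dotd; congr (_ + _);
  by apply: derive_coord; exact: CinfV_derivable ceta y0.
Qed.

Lemma isometric_deformation_variation xi y v w : smooth_on M xi ->
  isometric_deformation M xi -> P y ->
  dot ('D_v (xi \o Phi) y) ('D_w Phi y) +
  dot ('D_v Phi y) ('D_w (xi \o Phi) y) = 0.
Proof.
move=> sxi iso y0; have cXi := smooth_on_surface_comp sxi.
have hXi (a : R) z : 0 < a -> (xi \o Phi) (a *: z) = (xi \o Phi) z.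
  by move=> a0; rewrite /= Phi_homogeneous.
have dot0l (u : 'rV[R]_3) : dot 0 u = 0.
  by rewrite /dot big1 // => i _; rewrite mxE mul0r.
(* The curves are projections to M of lines through y, which have to avoid the
   origin; for v or w radial all terms vanish. *)
have [[c ->]|npar_v] := pselect (exists c : R, v = c *: y).
  by rewrite !derive_radial // ?dot0l ?addr0 // => a z; exact: Phi_homogeneous.
have [[c ->]|npar_w] := pselect (exists c : R, w = c *: y).
  rewrite (dotC ('D_v (xi \o Phi) y)) (dotC ('D_v Phi y)).
  by rewrite !derive_radial // ?dot0l ?addr0 // => a z; exact: Phi_homogeneous.
have line (z : 'rV[R]_3) : ~ (exists c : R, z = c *: y) -> forall u : R, P (u *: z + y).
  move=> npar u; apply/eqP => uz0; apply: npar.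
  have [u0|u0] := eqVneq u 0.
    by move: uz0; rewrite u0 scale0r add0r => /eqP; rewrite (negbTE y0).
  have yE : y = - (u *: z) by apply/eqP; rewrite -addr_eq0 addrC; exact/eqP.
  by exists (- u^-1); rewrite yE scaleNr scalerN opprK scalerA mulVf // scale1r.
have := iso _ _ (line_curve (line v npar_v)) (line_curve (line w npar_w)).
rewrite !scale0r => /(_ erefl).
have -> : (fun t : R => induced_metric (fun x => x + t *: xi x)
    (fun u : R => Phi (u *: v + y)) (fun u : R => Phi (u *: w + y))) =
    (fun t : R => dot ('D_v Phi y + t *: 'D_v (xi \o Phi) y)
                      ('D_w Phi y + t *: 'D_w (xi \o Phi) y)).
  by apply/funext => t; rewrite /induced_metric !derive1_deformed_line.
move=> [_ e0].
have [_ e1] := is_derive_dot_line ('D_v Phi y) ('D_v (xi \o Phi) y)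
  ('D_w Phi y) ('D_w (xi \o Phi) y).
by rewrite addrC -e1 e0.
Qed.

(** A curve in [M] satisfies [Phi \o c = c], so its velocity is fixed by the derivative of [Phi].
    Tangency of [v] and [w] is expressed in this way. *)
Lemma isometric_deformation_intro (X : 'rV[R]_3 -> 'rV[R]_3) : CinfV P X ->
  (forall p v w, M p -> 'D_v Phi p = v -> 'D_w Phi p = w ->
    dot v ('D_w X p) + dot ('D_v X p) w = 0) ->
  isometric_deformation M X.
Proof.
move=> cX tangent c1 c2 [s1 M1] [s2 M2] c12.
have der (c : R -> 'rV[R]_3) : smooth_on_open setT c -> (forall u, M (c u)) ->
    'D_('D_1 c 0) Phi (c 0) = 'D_1 c 0 /\
    forall t : R, derive1 ((fun x => x + t *: X x) \o c) 0 =
      'D_1 c 0 + t *: 'D_('D_1 c 0) X (c 0).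
  move=> sc Mc; have dc : derivable c 0 1 by have [_] := sc [::] 0 I; apply.
  have P0 := M_neq0 (Mc 0).
  have [_ e1] := derive_curve oP P0 Phi_smooth dc.
  have [dXc e2] := derive_curve oP P0 cX dc.
  split=> [|t].
    have cE : Phi \o c = c by apply/funext => u; exact: Phi_surface.
    by move: e1; rewrite cE => <-.
  have dt : derivable (fun=> t) (0 : R) (1 : R) by exact: derivable_const.
  rewrite derive1E; apply: (etrans (derive_addv dc (derivable_scalev dt dXc))).
  by rewrite (derive_scalev dt dXc) derive_constant scale0r add0r e2.
have [P1 D1] := der c1 s1 M1; have [P2 D2] := der c2 s2 M2.
have -> : (fun t : R => induced_metric (fun x => x + t *: X x) c1 c2) =
    (fun t : R => dot ('D_1 c1 0 + t *: 'D_('D_1 c1 0) X (c1 0))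
                      ('D_1 c2 0 + t *: 'D_('D_1 c2 0) X (c2 0))).
  by apply/funext => t; rewrite /induced_metric D1 D2.
apply: is_derive_eq; first exact: is_derive_dot_line.
rewrite -c12 in P2 *; exact: tangent.
Qed.

Lemma radial_proj_phi0 x : sphere x -> radial_proj (phi0 M x) = x.
Proof.
move=> x1; have x0 : P x by rewrite /= -enorm_gt0 (x1 : enorm x = 1) ltr01.
have omx : om x = x by exact: radial_proj_sphere.
have -> : phi0 M x = r x *: om x by rewrite -PhiE // /Phi /= omx.
by rewrite (radial_projZ _ (r_gt0 x0)) omx omx.
Qed.

Section FromDistance.
Variable s : 'rV[R]_3 -> R.
Hypothesis smooth_s : smooth_on sphere s.
Hypothesis curv_s : curvature_preserving M s.

Let sh := s \o radial_proj.

Let sh_smooth : Cinf P sh.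
Proof. exact: smooth_on_sphere_comp. Qed.

Let sh_homogeneous (c : R) y : 0 < c -> sh (c *: y) = sh y.
Proof. by move=> c0; rewrite /sh /= radial_projZ. Qed.

Let h i j y := hform r sh y (e i) (e j).

Let h_radial l (y : 'rV[R]_3) : y != 0 -> \sum_k y 0 k * h k l y = 0.
Proof.
move=> y0; rewrite -(hform_partials r_smooth sh_smooth y (e l) y0).
exact: (hform_radial r_homogeneous sh_homogeneous).
Qed.

(** Antisymmetry of [w] makes [eta y] orthogonal to [y]; bilinearity carries the equation for [h]
    from basis vectors to all [v] and [w]. *)
Lemma deformation_field : exists eta : 'rV[R]_3 -> 'rV[R]_3,
  [/\ CinfV P eta, forall y, dot (eta y) y = 0 &
    forall y v w, P y -> dot ('D_v eta y) w + dot v ('D_w eta y) = hform r sh y v w].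
Proof.
have ch i j : Cinf P (h i j) by exact: (hform_smooth r_smooth sh_smooth r_gt0).
have sym i j y : h i j y = h j i y by exact: hform_sym.
have euler i j (y : 'rV[R]_3) : y != 0 -> 'D_y (h i j) y = 0.
  by move=> y0; exact: (hform_euler r_smooth sh_smooth r_gt0 r_homogeneous sh_homogeneous).
have flat : flat_variation h := (curvature_preservingE smooth_s).1 curv_s.
have [w [cw anti dw]] := deformation_of_flat_variation ch sym h_radial euler flat.
pose eta (y : 'rV[R]_3) : 'rV[R]_3 := \row_j \sum_k y 0 k * w k j y.
have etaj j : (fun y => eta y 0 j) = (fun y : 'rV[R]_3 => \sum_k y 0 k * w k j y).
  by apply/funext => y; rewrite mxE.
have ceta : CinfV P eta.
  move=> j; rewrite etaj; apply: Cinf_sum => // k _.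
  by apply: Cinf_mul => //; exact: Cinf_coord.
exists eta; split=> // [y|y v v' y0].
  have E : dot (eta y) y = - dot (eta y) y.
    rewrite {1}/dot; transitivity (\sum_i \sum_k y 0 k * w k i y * y 0 i).
      by apply: eq_bigr => i _; rewrite mxE mulr_suml.
    rewrite exchange_big /= /dot -sumrN; apply: eq_bigr => k _.
    rewrite mxE mulr_suml -sumrN; apply: eq_bigr => i _.
    by rewrite anti; ring.
  by lra.
have deta u i : ('D_u eta y) 0 i = \sum_j u 0 j * 'D_(e j) (fun y => eta y 0 i) y.
  rewrite derive_coord; last exact: CinfV_derivable ceta y0.
  exact: (derive_partials u oP y0 (ceta i)).
rewrite (hform_partials r_smooth sh_smooth v v' y0).
transitivity (\sum_i v 0 i * \sum_j v' 0 j * h i j y); last first.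
  apply: eq_bigr => i _; apply: (congr1 (fun x => v 0 i * x)).
  have E := etrans (hform_sym r sh y (e i) v')
    (hform_partials r_smooth sh_smooth v' (e i) y0).
  apply: (etrans _ (esym E)); apply: eq_bigr => j _.
  exact: (congr1 (fun x => v' 0 j * x) (sym i j y)).
rewrite /dot.
transitivity (\sum_i (\sum_j v 0 i * 'D_(e i) (fun y => eta y 0 j) y * v' 0 j +
                      \sum_j v 0 i * (v' 0 j * 'D_(e j) (fun y => eta y 0 i) y))).
  rewrite big_split /=; congr (_ + _).
    rewrite exchange_big /=; apply: eq_bigr => j _.
    by rewrite deta mulr_suml.
  by apply: eq_bigr => i _; rewrite deta mulr_sumr.
apply: eq_bigr => i _; rewrite mulr_sumr -big_split; apply: eq_bigr => j _ /=.
by rewrite !etaj -(dw i j y y0); ring.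
Qed.

Lemma trivial_of_rigid : infinitesimally_rigid M -> trivial_dist_deformation M s.
Proof.
move=> rigid; have [eta [ceta eta0 etaE]] := deformation_field.
pose X z := eta z + sh z *: om z.
have cX : CinfV P X.
  by apply: CinfV_add => //; apply: CinfV_scale => //; exact: CinfV_radial_proj.
have sX : smooth_on M X.
  move=> p Mp; exists P, X; split=> //; first exact: M_neq0.
  exact/(smooth_on_open_coord X oP).
have iX : isometric_deformation M X.
  apply: isometric_deformation_intro => // p v w Mp Pv Pw.
  apply: (isometric_of_hform r_smooth sh_smooth r_gt0 PhiE (M_neq0 Mp) ceta) => //.
    by move=> v' w'; exact: etaE (M_neq0 Mp).
  exact: r_surface.
have [a [b Xab]] := rigid X sX iX.
exists b => x x1; set p := phi0 M x.
have omp : om p = x by exact: radial_proj_phi0.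
have x0 : P x by rewrite /= -enorm_gt0 (x1 : enorm x = 1) ltr01.
have Mp : M p by have := PhiM x0; rewrite /Phi /= radial_proj_sphere.
have p0 := M_neq0 Mp.
rewrite -[_ *: p]/(om p).
(* Both [eta p] and [cross a p] are orthogonal to [p], so the radial components of [X p] and of the
   trivial field are [s x] and that of [b]. *)
have dotom u : dot u (om p) = (rho p)^-1 * dot u p by rewrite dotZr.
have : dot (X p) (om p) = dot (cross a p + b) (om p) by rewrite Xab.
rewrite /X !dotDl (dotom (eta p)) eta0 mulr0 add0r dotZl dot_radial_proj // mulr1.
by rewrite (dotom (cross a p)) dot_cross mulr0 add0r /sh /= omp.
Qed.

End FromDistance.

Lemma rigid_of_trivial :
  (forall s : 'rV[R]_3 -> R, smooth_on sphere s ->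
     curvature_preserving M s -> trivial_dist_deformation M s) ->
  infinitesimally_rigid M.
Proof.
move=> triv xi sxi iso; have cXi := smooth_on_surface_comp sxi.
pose Xi := xi \o Phi.
have isoXi y v w : P y ->
    dot ('D_v Xi y) ('D_w Phi y) + dot ('D_v Phi y) ('D_w Xi y) = 0.
  exact: isometric_deformation_variation.
pose s x := dot (xi (phi0 M x)) x.
pose sh (y : 'rV[R]_3) := dot (Xi y) (om y).
have csh : Cinf P sh by exact: Cinf_dot oP cXi (@CinfV_radial_proj R).
have ss : smooth_on sphere s.
  move=> x x1; have x0 : P x by rewrite /= -enorm_gt0 (x1 : enorm x = 1) ltr01.
  exists P, sh; split=> //; first exact/smooth_on_open_Cinf.
  move=> z; rewrite inE => -[z1 _].
  by rewrite /sh /Xi /Phi /= radial_proj_sphere.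
have cp : curvature_preserving M s.
  apply/(curvature_preservingE ss).
  have cext := radial_extension_smooth r_smooth csh r_gt0 cXi.
  apply: (flat_variation_of_deformation cext) => i j y y0.
  apply: (etrans (hform_of_isometric (s := sh) r_smooth csh r_gt0 PhiE y0 cXi
    (fun z _ => erefl) (isoXi y _ _ y0))).
  exact: dot_basis_derivatives.
have [a sa] := triv s ss cp.
have sha y : P y -> sh y = dot a (om y).
  move=> y0; have oy : sphere (om y) by exact: enorm_radial_proj.
  have := sa (om y) oy; rewrite -[_ *: phi0 M _]/(om (phi0 M (om y))).
  by rewrite radial_proj_phi0.
pose Xi' y := Xi y + - a.
have cXi' : CinfV P Xi'.
  apply: (CinfV_add oP cXi) => i; exact: Cinf_cst.
have dXi' y v : P y -> 'D_v Xi' y = 'D_v Xi y.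
  move=> y0; have d1 : derivable Xi y v by exact: CinfV_derivable cXi y0.
  have d2 : derivable (fun=> - a) y v by exact: derivable_cst.
  by rewrite (derive_addv d1 d2) derive_cst addr0.
pose eta := radial_extension r (fun=> 0) Xi'.
have c0 : Cinf P (fun=> 0 : R) by exact: Cinf_cst.
have ceta : CinfV P eta by exact: radial_extension_smooth.
have sE z : P z -> 0 = dot (Xi' z) (om z).
  by move=> z0; rewrite dotDl dotNl -sha // subrr.
have killing i j y : y != 0 ->
    'D_(e i) (fun y => eta y 0 j) y + 'D_(e j) (fun y => eta y 0 i) y = 0.
  move=> y0; rewrite -(dot_basis_derivatives i j y0 ceta).
  have iso' : dot ('D_(e i) Xi' y) ('D_(e j) Phi y) +
      dot ('D_(e i) Phi y) ('D_(e j) Xi' y) = 0 by rewrite !dXi' //; exact: isoXi.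
  apply: (etrans (esym (hform_of_isometric r_smooth c0 r_gt0 PhiE y0 cXi' sE iso'))).
  exact: hform_constant0.
(* With [s = 0] the field is [rho] times a function of the direction alone; degree 1 is what
   excludes a translation part. *)
have hom i (c : R) (y : 'rV[R]_3) : 0 < c -> y != 0 ->
    eta (c *: y) 0 i = c * eta y 0 i.
  move=> cp0 y0.
  have Phic : Phi (c *: y) = Phi y by exact: Phi_homogeneous.
  have Xi'c : Xi' (c *: y) = Xi' y by exact: (congr1 (fun p => xi p + - a) Phic).
  have rc : r (c *: y) = r y by exact: r_homogeneous.
  have nc : enorm (c *: y) = c * enorm y by exact: enormZ (ltW cp0).
  by rewrite /eta /radial_extension Xi'c rc nc oppr0 !scale0r -scalerA mxE.
have [B [antiB BE]] := killing_homogeneous ceta killing hom.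
exists (\row_m B (m + 1) (m + 2%:R)), a => p Mp; have p0 := M_neq0 Mp.
have etap : eta p = xi p - a.
  rewrite /eta /radial_extension r_surface // scalerA mulfV ?enorm_neq0 // scale1r.
  by rewrite oppr0 scale0r addr0 /Xi' /Xi /= -/(Phi p) Phi_surface.
rewrite -(cross_of_antisymmetric p antiB).
have -> : \row_j (\sum_i p 0 i * B i j) = eta p.
  by apply/rowP => j; rewrite mxE BE.
by rewrite etap subrK.
Qed.

End Surface.

Theorem theorem4p7 (R : realType) (M K : set 'rV[R]_3)
    (hM : smooth_convex_closed_surface M K) (h0 : K° 0) :
  infinitesimally_rigid M <->
  (forall s : 'rV[R]_3 -> R, smooth_on sphere s ->
     curvature_preserving M s -> trivial_dist_deformation M s).
Proof.
split=> [rigid s ss cs|]; first exact: (trivial_of_rigid hM h0).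
exact: (rigid_of_trivial hM h0).
Qed.
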